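(* Let $\Omega=\mathbb R^2/\mathcal L$ be a flat torus and let $v\in L^1((0,T);C^{0,1}(\Omega;\mathbb R^2))$. For each $N\ge2$, set $h=\sqrt{|\Omega|/N}$ and take pairwise distinct initial generators $X^h(0)\in\Omega^N$ with $$\mathscr F(X^h(0))\le C_1h^2,$$ where $C_1$ does not depend on $h$. Let $\alpha_h$ be a real-valued function which is locally Lipschitz on the open set of configurations $X\in\Omega^N$ with pairwise distinct generators, with $0\le\alpha_h(X)\le\mathscr G(X)/h^{5/2}$, and consider $$\dot x_i^h(t)=v(t,x_i^h(t))+\alpha_h(X^h(t))\left(c_i(X^h(t))-x_i^h(t)\right),\qquad 1\le i\le N.$$ Then this Cauchy problem has a unique absolutely continuous solution $X^h=(x_1^h,\dots,x_N^h)$ on $[0,T]$, the generators remain distinct, and $\alpha_h(t):=\alpha_h(X^h(t))$ is nonnegative and bounded for each fixed $h$. There is a constant $C_2$, depending only on $C_1$, $T$, $\Omega$ and $\Lambda(T)$, such that $$\sup_{t\in[0,T]}\mathscr F(X^h(t))+\int_0^T\alpha_h(t)\mathscr G(X^h(t))\,dt\le C_2h^2,$$ $$d_h:=\sup_{t\in[0,T]}\mathscr D(X^h(t))\le C_2h^{1/2},$$ $$A_h:=\int_0^T\alpha_h(t)\,dt\le C_2h^{-1/4},$$ $$\int_0^T\left(\frac{\mathscr G(X^h(t))}{h^2}\right)^2dt\le C_2h^{1/2}\qquad\text{if }\alpha_h=\mathscr G/h^{5/2}.$$ Moreover, for every $\rho_0\in L^1(\Omega)$ with $\rho_0\ge0$,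 the Voronoi histogram $\mu^h$ and the solution $\mu$ of the continuity equation $\partial_t\rho+\nabla\cdot(\rho v)=0$ with initial datum $\rho_0$ (both defined in the context) satisfy, for all $h\le1$, $$B_h(T)+\sup_{t\in[0,T]}W_1(\mu^h(t),\mu(t))\le C_2\|\rho_0\|_{L^1}h^{1/4},$$ where $$B_h(T):=\int_0^Te^{\Lambda(T)-\Lambda(s)}\alpha_h(s)\sum_{i=1}^NM_i^h\left|c_i(X^h(s))-x_i^h(s)\right|ds,\qquad M_i^h:=\int_{\Omega_i(X^h(0))}\rho_0\,dx.$$
   Context: Domain. $T>0$ is finite. $\Omega=\mathbb R^2/\mathcal L$, where $\mathcal L=\mathbb Z\ell_1+\mathbb Z\ell_2$ with $\ell_1,\ell_2\in\mathbb R^2$ linearly independent. $|x-y|=\min_{k\in\mathcal L}|\tilde x-\tilde y-k|$ denotes the torus distance ($\tilde x,\tilde y\in\mathbb R^2$ representatives); balls and diameters are understood accordingly, and functions on $\Omega$ are identified with $\mathcal L$-periodic functions on $\mathbb R^2$. Voronoi tessellation. For $X=(x_1,\dots,x_N)\in\Omega^N$ with pairwise distinct entries (generators), $\Omega_i(X):=\{x\in\Omega: |x-x_i|<|x-x_j|\ \text{for all } j\ne i\}$ and $V_i(X):=|\Omega_i(X)|$. The displacement from $x_i$ to the centroid $c_i(X)$ of the cell is $c_i(X)-x_i=\frac1{V_i(X)}\int_{P_i}(y-x_i)\,dy\in\mathbb R^2$, where, for representatives $x_j\in\mathbb R^2$, $P_i:=\{y\in\mathbb R^2:\ |y-x_i|\le|y-x_j-k|\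 \text{for all } 1\le j\le N,\ k\in\mathcal L\}$ (Euclidean norms); it does not depend on the chosen representatives. Indicators. $\mathscr F(X):=\sum_{i=1}^N\int_{\Omega_i(X)}|x-x_i|^2\,dx$; $\mathscr G(X):=\sum_{i=1}^NV_i(X)|x_i-c_i(X)|^2$; $\mathscr D(X):=\max_{1\le i\le N}\operatorname{diam}(\Omega_i(X))$. Velocity. $L(t):=\|v(t,\cdot)\|_{C^{0,1}(\Omega)}$ (in particular $v(t,\cdot)$ is $L(t)$-Lipschitz) and $\Lambda(t):=\int_0^tL(s)\,ds$. Histogram and exact solution. $\mu^h(t):=\rho^h(t,\cdot)\,dx$ with $\rho^h(t,x):=\sum_{i=1}^N\frac{M_i^h}{|\Omega_i(X^h(t))|}\mathbf 1_{\Omega_i(X^h(t))}(x)$. $\mu(t):=\Phi(t,\cdot)_\#(\rho_0\,dx)$, where $\Phi$ is the flow of $v$; its density is the unique weak solution of the continuity equation with initial datum $\rho_0$. Wasserstein distance. For nonnegative measures $\mu,\nu$ on $\Omega$ of equal mass, $W_1(\mu,\nu):=\inf_{\pi}\int_{\Omega\times\Omega}|x-y|\,d\pi(x,y)$ over nonnegative measures $\pi$ on $\Omega\times\Omega$ with marginals $\mu$ and $\nu$. *)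

(* Defs.v *)
From HB Require Import structures.
From mathcomp Require Export all_boot all_order all_algebra.
From mathcomp Require Export all_classical all_reals all_analysis.
Set Implicit Arguments.
Unset Strict Implicit.
Unset Printing Implicit Defensive.
Import Order.TTheory GRing.Theory Num.Theory.
Import numFieldNormedType.Exports.
Local Open Scope classical_set_scope.
Local Open Scope ring_scope.

Section Plane.
Variable R : realType.

(* The library norm of [R * R] is the maximum norm. *)
Definition enorm (x : R * R) : R := Num.sqrt (x.1 ^+ 2 + x.2 ^+ 2).

Definition scale2 (c : R) (x : R * R) : R * R := (c * x.1, c * x.2).

Definition linindep (l1 l2 : R * R) : Prop :=
  forall a b : R, scale2 a l1 + scale2 b l2 = 0 -> a = 0 /\ b = 0.

(* The carrier of the library Lebesgue measure is [measurableTypeR R], that is,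
   [R] with its Borel sets. *)
Definition plane : Type := (measurableTypeR R * measurableTypeR R)%type.
HB.instance Definition _ := Measurable.on plane.

Definition leb2 : {measure set plane -> \bar R} :=
  (@lebesgue_measure R \x @lebesgue_measure R)%E.

Definition abs_continuous (T : R) (x : R -> R * R) : Prop :=
  forall e : R, 0 < e -> exists2 d : R, 0 < d &
    forall (n : nat) (a b : 'I_n -> R),
      (forall i, [/\ 0 <= a i, a i <= b i & b i <= T]) ->
      (forall i j, i != j -> b i <= a j \/ b j <= a i) ->
      \sum_(i < n) (b i - a i) < d ->
      \sum_(i < n) enorm (x (b i) - x (a i)) < e.

Definition has_velocity (x : R -> R * R) (t : R) (w : R * R) : Prop :=
  is_derive t 1 (fun s => (x s).1) w.1 /\ is_derive t 1 (fun s => (x s).2) w.2.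

End Plane.

(* Points of the torus [R^2 / L] are given by representatives in the plane;
   subsets of the torus are [L]-invariant subsets of the plane, functions on the
   torus are [L]-periodic functions, and curves in the torus are given by their
   continuous lifts. *)
Section Torus.
Variables (R : realType) (l1 l2 : R * R).

Definition lattice : set (R * R) :=
  [set k | exists m n : int, k = l1 *~ m + l2 *~ n].

Definition same_point (x y : R * R) : Prop := lattice (x - y).

Definition periodic (U : Type) (f : R * R -> U) : Prop :=
  forall x k, lattice k -> f (x + k) = f x.

(* For linearly independent [l1], [l2] the infimum is a minimum. *)
Definition tdist (x y : R * R) : R :=
  inf [set enorm (x - y - k) | k in lattice].

Definition tdiam (A : set (R * R)) : R :=
  sup [set r | exists x y, [/\ A x, A y & r = tdist x y]].

(* The Lebesgue measure of an invariant set [A], viewed in the torus, is the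
   planar measure of [A `&` fund_dom]; integrals over the torus likewise. *)
Definition fund_dom : set (R * R) :=
  [set x | exists a b : R, [/\ 0 <= a < 1, 0 <= b < 1 &
                              x = scale2 a l1 + scale2 b l2]].

Definition torus_area : R := fine (leb2 R fund_dom).

(* The sigma-algebra consists of the invariant Borel sets of the plane, so that
   measures on [torus] are the Borel measures on the quotient. *)
Definition torus : Type :=
  g_sigma_algebraType [set A : set (R * R) | measurable (A : set (plane R)) /\ periodic A].

HB.instance Definition _ := Measurable.on torus.

Section Voronoi.
Variable N : nat.
Implicit Types X : 'I_N -> R * R.

Definition distinct X : Prop := forall i j, i != j -> ~ same_point (X i) (X j).

Definition cell X (i : 'I_N) : set (R * R) :=
  [set x | forall j, j != i -> tdist x (X i) < tdist x (X j)].

Definition cell_area X i : R := fine (leb2 R (cell X i `&` fund_dom)).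

Definition polygon X (i : 'I_N) : set (R * R) :=
  [set y | forall j k, lattice k -> enorm (y - X i) <= enorm (y - X j - k)].

(* [c_i(X) - x_i] *)
Definition cdisp X i : R * R :=
  scale2 (cell_area X i)^-1
    (\int[leb2 R]_(y in polygon X i) (y.1 - (X i).1),
     \int[leb2 R]_(y in polygon X i) (y.2 - (X i).2)).

Definition quant_energy X : R :=
  \sum_(i < N) \int[leb2 R]_(x in cell X i `&` fund_dom)
     (tdist x (X i) ^+ 2).

Definition centroid_defect X : R :=
  \sum_(i < N) cell_area X i * enorm (cdisp X i) ^+ 2.

Definition max_diam X : R := \big[Num.max/0]_(i < N) tdiam (cell X i).

Definition loc_lipschitz (alpha : ('I_N -> R * R) -> R) : Prop :=
  forall X, distinct X -> exists (r K : R), 0 < r /\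
    forall Y Z, distinct Y -> distinct Z ->
      (forall i, tdist (Y i) (X i) < r) -> (forall i, tdist (Z i) (X i) < r) ->
      `|alpha Y - alpha Z| <= K * \sum_(i < N) tdist (Y i) (Z i).

Definition config_periodic (alpha : ('I_N -> R * R) -> R) : Prop :=
  forall X Y, distinct X -> distinct Y ->
    (forall i, same_point (X i) (Y i)) -> alpha X = alpha Y.

Definition mesh : R := Num.sqrt (torus_area / N%:R).

End Voronoi.

Definition C01 (f : R * R -> R * R) : Prop :=
  periodic f /\ exists K : R, (forall x, enorm (f x) <= K) /\
    (forall x y, enorm (f x - f y) <= K * tdist x y).

Definition C01_norm (f : R * R -> R * R) : R :=
  sup [set enorm (f x) | x in [set: R * R]] +
  sup [set r | exists x y, 0 < tdist x y /\ r = enorm (f x - f y) / tdist x y].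

Definition C01_simple (s : R -> R * R -> R * R) : Prop :=
  exists (m : nat) (A : 'I_m -> set R) (g : 'I_m -> R * R -> R * R),
    [/\ forall i, measurable (A i), forall i, C01 (g i) &
        forall t x, s t x = \sum_(i < m) (if t \in A i then g i x else 0)].

(* Bochner integrability: [v] is a.e. the limit, in the [C01] norm, of simple
   functions, and its norm has finite integral. *)
Definition bochner_L1_C01 (T : R) (v : R -> R * R -> R * R) : Prop :=
  [/\ forall t, 0 < t < T -> C01 (v t),
      exists s : nat -> R -> R * R -> R * R,
        (forall n, C01_simple (s n)) /\
        {ae @lebesgue_measure R, forall t, 0 < t < T ->
           (fun n => C01_norm (fun x => s n t x - v t x)) @ \oo --> (0 : R)} &
      (\int[@lebesgue_measure R]_(t in `]0%R, T[) (C01_norm (v t))%:E < +oo)%E].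

Definition Lambda (v : R -> R * R -> R * R) (t : R) : R :=
  \int[@lebesgue_measure R]_(s in `]0, t[) C01_norm (v s).

Definition is_flow (T : R) (v : R -> R * R -> R * R)
    (Phi : R -> R * R -> R * R) : Prop :=
  forall x, [/\ Phi 0 x = x, abs_continuous T (fun t => Phi t x) &
    {ae @lebesgue_measure R, forall t, 0 < t < T ->
       has_velocity (fun s => Phi s x) t (v t (Phi t x))}].

Definition is_solution (N : nat) (T : R) (v : R -> R * R -> R * R)
    (alpha : ('I_N -> R * R) -> R) (X0 : 'I_N -> R * R)
    (X : R -> 'I_N -> R * R) : Prop :=
  [/\ X 0 = X0, forall i, abs_continuous T (fun t => X t i) &
    {ae @lebesgue_measure R, forall t, 0 < t < T -> distinct (X t) /\
       forall i, has_velocity (fun s => X s i) t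
         (v t (X t i) + scale2 (alpha (X t)) (cdisp (X t) i))}].

(* The measure [rho dx] on the torus. *)
Definition density (rho : R * R -> R) (A : set torus) : \bar R :=
  (\int[leb2 R]_(x in (A : set (R * R)) `&` fund_dom) (rho x)%:E)%E.

Definition L1_nonneg (rho : R * R -> R) : Prop :=
  [/\ periodic rho, forall x, 0 <= rho x &
      (leb2 R).-integrable fund_dom (EFin \o rho)].

Definition L1_norm (rho : R * R -> R) : R :=
  \int[leb2 R]_(x in fund_dom) `|rho x|.

Definition cell_mass (N : nat) (rho : R * R -> R) (X : 'I_N -> R * R) (i : 'I_N)
  : R := \int[leb2 R]_(x in cell X i `&` fund_dom) rho x.

Definition histogram (N : nat) (M : 'I_N -> R) (X : 'I_N -> R * R)
    (x : R * R) : R :=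
  \sum_(i < N) M i / cell_area X i * \1_(cell X i) x.

Definition coupling (mu nu : set torus -> \bar R)
    (pi : {measure set (torus * torus) -> \bar R}) : Prop :=
  forall A : set torus, measurable A ->
    pi (A `*` setT) = mu A /\ pi (setT `*` A) = nu A.

Definition W1 (mu nu : set torus -> \bar R) : \bar R :=
  ereal_inf [set c | exists2 pi : {measure set (torus * torus) -> \bar R},
    coupling mu nu pi & c = (\int[pi]_z (tdist z.1 z.2)%:E)%E].

End Torus.

(* Main.v *)
(* The energy [F] is semiconcave in the generators with supergradient
   [- 2 * mom], so along the dynamics its upper Dini derivative is at most
   [4 L F - 2 alpha G]: the relaxation drift contributes [- 2 alpha G], and the
   velocity term is bounded by [4 L F] through a discrete integration by parts
   over the whole torus, in which the cell boundaries do not appear.  Gronwall's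
   inequality bounds [F] and the integral of [alpha G] by a multiple of [h ^ 2].
   A point at distance [d] from all generators forces [F >= kap * d ^ 4], which
   bounds the diameters, and Young's inequality applied to
   [alpha ^ 2 <= alpha G / h ^ (5 / 2)] bounds the integral of [alpha].
   Existence and uniqueness follow from Caratheodory's theorem once generators
   are known to stay apart: the centroid of a cell lies on its own side of every
   bisector, so the distance of two generators decays at most exponentially.
   For the Wasserstein bound, the mass [rho0 dx] of the initial cell [i], moved
   by the flow, is coupled with the uniform measure on the current cell [i]. *)

From HB Require Import structures.
Require Import Defs.
From mathcomp Require Import all_boot all_order all_algebra.
From mathcomp Require Import all_classical all_reals all_analysis.
From mathcomp Require Import measurable_realfun zify ring lra.
Set Implicit Arguments.
Unset Strict Implicit.
Unset Printing Implicit Defensive.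
Import Order.TTheory GRing.Theory Num.Theory.
Import numFieldNormedType.Exports.
Local Open Scope classical_set_scope.
Local Open Scope ring_scope.
(** * Dini derivatives and Gronwall's inequality *)

(** All exponents come from the scale [s], the fourth root of [h]. The energy budget is
    [F <= c s^8]. The cost [kap d^4] of a hole turns it into cell radii of order [s^2], and Young's
    inequality balanced at [alpha ~ 1/s] turns it into an integral of [alpha] of order [1/s].
    Transport errors are a radius, or a radius times that integral, hence at most of order [s] when
    [h <= 1]. The obstacle is regularity. [F] is handled from above only: keeping the old partition
    while the generators move gives a smooth majorant that touches [F], and for an absolutely
    continuous function a bound on the upper right Dini derivative at almost every time is enough.
    [alpha] is controlled only away from collisions, with bounds that may blow up as [h] tends to 0;
    so a cut-off system is solved globally, and the separation estimate, which covers that system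
    too, shows that the cut-off is never felt. The bounds that degenerate with [h] serve existence,
    uniqueness and continuity, and do not reach [C2]. Integrals over cells of the torus are taken
    over bounded planar polygons, from which the cells differ by lattice folding and a null set of
    bisectors. *)

Section AbsolutelyContinuous.
Variable R : realType.
Notation mu := (@lebesgue_measure R).
Implicit Types (T : R) (g : R -> R).

Definition ac T g : Prop :=
  forall e : R, 0 < e -> exists2 d : R, 0 < d &
    forall (n : nat) (a b : 'I_n -> R),
      (forall i, [/\ 0 <= a i, a i <= b i & b i <= T]) ->
      (forall i j, i != j -> b i <= a j \/ b j <= a i) ->
      \sum_(i < n) (b i - a i) < d ->
      \sum_(i < n) `|g (b i) - g (a i)| < e.

(** Each of the finitely many dominating functions has its variation over short families made
    smaller than a fixed fraction of [e]. Differences, products, exponentials, norms and the energy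
    along a trajectory all get their absolute continuity from this domination. *)
Lemma ac_dom (I : finType) (f : I -> R -> R) (C : R) T g :
  (forall i, ac T (f i)) ->
  (forall s t, 0 <= s <= T -> 0 <= t <= T ->
     `|g s - g t| <= C * \sum_i `|f i s - f i t|) ->
  ac T g.
Proof.
move=> acf gf e e0.
(* The added units keep [M] positive when [C] is 0 or the family is empty, and leave room for the
   strict inequality at the end. *)
pose M := (`|C| + 1) * (#|I|%:R + 1).
have M0 : 0 < M by rewrite mulr_gt0// ltr_wpDl.
have H i : exists d : R, 0 < d /\ forall (n : nat) (a b : 'I_n -> R),
      (forall i, [/\ 0 <= a i, a i <= b i & b i <= T]) ->
      (forall i j, i != j -> b i <= a j \/ b j <= a i) ->
      \sum_(i < n) (b i - a i) < d ->
      \sum_(j < n) `|f i (b j) - f i (a j)| < e / M.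
  by have [d d0 dP] := acf i (e / M) (divr_gt0 e0 M0); exists d.
have [d dP] := choice H.
exists (\big[Num.min/1]_i d i).
  by elim/big_ind : _ => // [x y x0 y0|i _]; [rewrite lt_min x0|have [] := dP i].
move=> n a b ab dis sd.
have S i : \sum_(j < n) `|f i (b j) - f i (a j)| <= e / M.
  apply/ltW/(dP i).2 => //; apply: lt_le_trans sd _.
  exact: bigmin_le_cond.
have bnd j : 0 <= a j <= T /\ 0 <= b j <= T.
  by have [h1 h2 h3] := ab j; rewrite h1 h3 (le_trans h1)// (le_trans h2).
apply: (@le_lt_trans _ _ (\sum_(j < n) (`|C| * \sum_i `|f i (b j) - f i (a j)|))).
  apply: ler_sum => j _; have [? ?] := bnd j.
  apply: le_trans (gf _ _ _ _) _ => //.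
  by apply: ler_wpM2r; [exact: sumr_ge0|exact: ler_norm].
rewrite -mulr_sumr exchange_big /=.
apply: (@le_lt_trans _ _ (`|C| * \sum_(i : I) (e / M))).
  by apply: ler_wpM2l => //; exact: ler_sum.
rewrite sumr_const -[X in _ * X]mulr_natr.
have -> : `|C| * (e / M * #|I|%:R) = e * ((`|C| * #|I|%:R) / M).
  by field; rewrite gt_eqF.
rewrite -[ltRHS]mulr1 ltr_pM2l// ltr_pdivrMr// mul1r /M.
have := normr_ge0 C; have : (0 : R) <= #|I|%:R by [].
by move: (`|C|) (#|I|%:R : R) => x y; nra.
Qed.

Lemma ac_unif T g : ac T g -> forall e : R, 0 < e -> exists2 d : R, 0 < d &
  forall s t : R, 0 <= s <= T -> 0 <= t <= T -> `|s - t| < d -> `|g s - g t| < e.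
Proof.
move=> acg e e0; have [d d0 dP] := acg e e0; exists d => //.
suff H (s t : R) : 0 <= s <= T -> 0 <= t <= T -> s <= t -> `|s - t| < d ->
    `|g s - g t| < e.
  move=> s t sT tT st; have [st'|/ltW st'] := leP s t; first exact: H.
  by rewrite distrC; apply: H => //; rewrite distrC.
move=> /andP[s0 sT] /andP[t0 tT] st; rewrite distrC ger0_norm ?subr_ge0// => std.
have := dP 1 (fun=> s) (fun=> t).
rewrite !big_ord1 distrC; apply => //.
by move=> i j; rewrite !ord1 eqxx.
Qed.

(** Walking from 0 in steps of length [d / 2], below the modulus of continuity for the error 1, adds
    at most 1 to the bound at every step. *)
Lemma ac_bounded T g : ac T g -> exists M : R, forall t : R, 0 <= t <= T -> `|g t| <= M.
Proof.
move=> acg; have [d d0 dP] := ac_unif acg ltr01.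
have H n : forall t, 0 <= t <= T -> t <= n%:R * (d / 2) -> `|g t| <= `|g 0| + n%:R.
  elim: n => [|n IH] t /andP[t0 tT].
    rewrite mul0r addr0 => t0'.
    by have -> : t = 0 by apply/eqP; rewrite eq_le t0 t0'.
  move=> tn.
  have [tn'|/ltW tn'] := leP t (n%:R * (d / 2)).
    apply: le_trans (IH _ _ tn') _; first by rewrite t0 tT.
    by rewrite lerD2l ler_nat.
  set s := n%:R * (d / 2) in tn'.
  have s0 : 0 <= s by rewrite mulr_ge0// divr_ge0// ltW.
  have sT : 0 <= s <= T by rewrite s0 (le_trans tn').
  have := IH s sT (lexx _).
  have st : `|t - s| < 1 * d.
    rewrite ger0_norm ?subr_ge0//; move: tn; rewrite /s.
    by rewrite -natr1 mulrDl => tn; lra.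
  rewrite mul1r in st.
  have := dP t s; rewrite t0 tT sT => /(_ isT isT st) gts gs.
  rewrite -natr1; have := lerB_dist (g t) (g s); lra.
exists (`|g 0| + (Num.truncn (T / (d / 2))).+1%:R) => t /andP[t0 tT].
apply: H; first by rewrite t0.
rewrite -ler_pdivrMr ?divr_gt0//.
apply: (@le_trans _ _ (T / (d / 2))).
  by apply: ler_wpM2r => //; rewrite invr_ge0 divr_ge0// ltW.
exact/ltW/truncnS_gt.
Qed.

Lemma sum_disjoint_le (U : set R) n (a b : 'I_n -> R) : measurable U ->
  (forall i, a i <= b i) -> (forall i, `]a i, b i[ `<=` U) ->
  (forall i j, i != j -> b i <= a j \/ b j <= a i) ->
  ((\sum_(i < n) (b i - a i))%:E <= mu U)%E.
Proof.
move=> mU ab abU dis.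
have tI : trivIset [set: 'I_n] (fun i => [set` `]a i, b i[]).
  apply/trivIsetP => i j _ _ ij; apply/seteqP; split => // x /= [].
  rewrite !in_itv/= => /andP[h1 h2] /andP[h3 h4].
  by have [h|h] := dis i j ij; lra.
have -> : ((\sum_(i < n) (b i - a i))%:E = mu (\bigcup_(i in [set: 'I_n]) `]a i, b i[)%classic)%E.
  rewrite measure_fin_bigcup//; last exact: finite_finset.
  have -> : [set: 'I_n] = [set` index_enum 'I_n].
    by apply/seteqP; split => // i _ /=; rewrite mem_index_enum.
  rewrite -fsbig_seq ?index_enum_uniq// -sumEFin; apply: eq_bigr => i _.
  rewrite [RHS]lebesgue_measure_itv/= lte_fin; case: ltP => // h.
  have -> : a i = b i by apply/eqP; rewrite eq_le h ab.
  by rewrite subrr.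
apply: le_measure; rewrite ?inE//; last by move=> x [i _ /abU].
by apply: fin_bigcup_measurable => //; exact: finite_finset.
Qed.

(** This bounds the upper right Dini derivative. Written with increments instead of a limit
    superior, it passes directly through the product and difference rules below. *)
Definition dini_le g t c : Prop := forall e : R, 0 < e -> exists2 d : R, 0 < d &
  forall h : R, 0 < h < d -> g (t + h) - g t <= (c + e) * h.

(* Outside an open set of small measure containing the exceptional null set the
   growth is controlled by the Dini bound, inside by absolute continuity; [phi]
   below is the variation collected inside. *)
Lemma ac_dini_noninc T g : ac T g ->
  {ae mu, forall t : R, 0 < t < T -> dini_le g t 0} ->
  forall t : R, 0 <= t <= T -> g t <= g 0.
Proof.
move=> acg [B [mB B0 BP]] t1 /andP[t10 t1T].
suff H (e : R) : 0 < e -> g t1 - g 0 <= e * T + e.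
  rewrite -subr_le0; apply/ler_addgt0Pl => e e0; rewrite addr0.
  have T1 : 0 < T + 1 by lra.
  have := H (e / (T + 1)) (divr_gt0 e0 T1).
  by have -> : e / (T + 1) * T + e / (T + 1) = e by field; rewrite gt_eqF.
move=> e0; have [d d0 dP] := acg e e0.
(* The Dini bound says nothing at time 0, so 0 joins the exceptional set and will lie in the open
   set [U]. *)
pose B' := B `|` [set 0 : R].
have mB' : measurable B' by apply: measurableU.
have B'0 : mu B' = 0%E by rewrite measureU0//; exact: lebesgue_measure_set1.
have [|U [oU BU muU]] := lebesgue_regularity_outer mB' _ d0.
  by rewrite [X in (X < _)%E]B'0 ltry.
have mU : measurable U by exact: open_measurable.
have {}muU : (mu U < d%:E)%E.
  have UE : U = (U `\` B') `|` B' by rewrite setUC setDUK.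
  apply: le_lt_trans muU; rewrite [X in mu X]UE.
  by rewrite measureU0//; exact: measurableD.
pose V (t : R) := [set s : R | exists n (a b : 'I_n -> R),
  [/\ forall i, [/\ 0 <= a i, a i <= b i & b i <= t],
      forall i, `[a i, b i] `<=` U,
      (forall i j, i != j -> b i <= a j \/ b j <= a i) &
      s = \sum_(i < n) `|g (b i) - g (a i)|]].
have V0 t : V t 0.
  by exists 0%N, (fun=> 0), (fun=> 0); split => [[]//|[]//|[]//|]; rewrite big_ord0.
have Vub t : t <= T -> ubound (V t) e.
  move=> tT s [n [a [b [h1 h2 h3 ->]]]]; apply/ltW/dP => // [i|].
    by have [? ? ?] := h1 i; split => //; apply: le_trans tT.
  rewrite -lte_fin; apply: le_lt_trans muU; apply: sum_disjoint_le => // i.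
    by have [] := h1 i.
  by move=> x xab; apply: h2; exact: subset_itv_oo_cc xab.
pose phi t := sup (V t).
have hV t : t <= T -> has_sup (V t).
  by move=> tT; split; [exists 0; exact: V0|exists e; exact: Vub].
have phi_mono s t : s <= t -> t <= T -> phi s <= phi t.
  move=> st tT; apply: ge_sup; first by exists 0; exact: V0.
  move=> x [n [a [b [h1 h2 h3 ->]]]]; apply: ub_le_sup; first by exists e; exact: Vub.
  exists n, a, b; split => // i; have [? ? ?] := h1 i; split => //.
  exact: le_trans st.
have phi_ext s t : 0 <= s -> s <= t -> t <= T -> `[s, t] `<=` U ->
    phi s + `|g t - g s| <= phi t.
  move=> s0 st tT stU.
  rewrite -lerBrDr; apply: ge_sup; first by exists 0; exact: V0.
  move=> x [n [a [b [h1 h2 h3 ->]]]]; rewrite lerBrDr.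
  apply: ub_le_sup; first by exists e; exact: Vub.
  pose a' (i : 'I_n.+1) := oapp a s (unlift ord_max i).
  pose b' (i : 'I_n.+1) := oapp b t (unlift ord_max i).
  exists n.+1, a', b'; split.
  - move=> i; rewrite /a' /b'; case: unliftP => [j|] /= _ //.
    by have [? ? ?] := h1 j; split => //; apply: le_trans st.
  - by move=> i; rewrite /a' /b'; case: unliftP => [j|] /= _.
  - move=> i j; rewrite /a' /b'; case: unliftP => [i'|] /= ->; case: unliftP => [j'|] /= -> ij.
    + by apply: h3; move: ij; rewrite (inj_eq lift_inj).
    + by left; have [] := h1 i'.
    + by right; have [] := h1 j'.
    + by rewrite eqxx in ij.
  - rewrite big_ord_recr/= /a' /b' unlift_none/=; congr (_ + _).
    apply: eq_bigr => i _; have -> : widen_ord (leqnSn n) i = lift ord_max i.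
      by apply/val_inj => /=; rewrite /bump leqNgt ltn_ord.
    by rewrite liftK.
(* Suppose that the estimate with slack [e * t + phi t] fails somewhere, and let [ts] be the infimum
   of the failing times. By continuity it still holds at [ts], so failing times accumulate at [ts]
   from the right. *)
pose bad := [set t | 0 <= t <= T /\ e * t + phi t < g t - g 0].
rewrite leNgt; apply/negP => gt1.
have b1 : bad t1.
  split; first by rewrite t10.
  apply: le_lt_trans gt1; apply: lerD; first by rewrite ler_pM2l.
  by apply: ge_sup; [exists 0; exact: V0|exact: Vub].
have ib : has_inf bad by split; [exists t1|exists 0 => x [/andP[]]].
pose ts := inf bad.
have ts0 : 0 <= ts by apply: lb_le_inf; [exists t1|move=> x [/andP[]]].
have tst1 : ts <= t1 by apply: ge_inf b1; exists 0 => x [/andP[]].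
have tsT : ts <= T by exact: le_trans t1T.
have good s : 0 <= s < ts -> g s - g 0 <= e * s + phi s.
  move=> /andP[s0 sts]; rewrite leNgt; apply/negP => h.
  have : ts <= s.
    apply: ge_inf; first by exists 0 => x [/andP[]].
    by split => //; rewrite s0/= (le_trans (ltW sts)).
  by rewrite leNgt sts.
have phi0 t : 0 <= t <= T -> 0 <= phi t.
  by move=> /andP[t0 tT]; apply: ub_le_sup; [exists e; exact: Vub|exact: V0].
have goodts : g ts - g 0 <= e * ts + phi ts.
  move: (ts0); rewrite le_eqVlt => /predU1P[ts0'|ts_gt0].
    by rewrite -{1}ts0' subrr addr_ge0// ?mulr_ge0 ?phi0 ?ts0 ?tsT// ltW.
  apply/ler_addgt0Pr => e' e'0.
  have [d' d'0 d'P] := ac_unif acg e'0.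
  pose s := Num.max 0 (ts - d' / 2).
  have s0 : 0 <= s by rewrite le_max lexx.
  have sts : s < ts by rewrite gt_max ts_gt0 /= ltrBlDr ltrDl divr_gt0.
  have ss : ts - d' / 2 <= s by rewrite le_max lexx orbT.
  have := good s; rewrite s0 sts => /(_ isT) gs.
  have := d'P ts s; rewrite ts0 tsT s0 (le_trans (ltW sts) tsT) => /(_ isT isT).
  rewrite ger0_norm ?subr_ge0 ?(ltW sts)// => /(_ _)/wrap[]; first by lra.
  move=> gg; have := ler_norm (g ts - g s).
  have := phi_mono s ts (ltW sts) tsT.
  have : e * s <= e * ts by rewrite ler_pM2l// ltW.
  lra.
have tslt : ts < t1.
  rewrite lt_neqAle tst1 andbT; apply/eqP => E.
  by move: b1 => [_]; rewrite -E ltNge goodts.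
have nxt (d' : R) : 0 < d' -> exists2 h, 0 < h < d' & (ts + h <= T /\ e * (ts + h) + phi (ts + h) < g (ts + h) - g 0).
  move=> d'0; have [x bx xd] := inf_adherent d'0 ib.
  have tsx : ts <= x by apply: ge_inf bx; exists 0 => y [/andP[]].
  have tsx' : ts < x.
    rewrite lt_neqAle tsx andbT; apply/eqP => E.
    by move: bx => [_]; rewrite -E ltNge goodts.
  exists (x - ts).
    by rewrite subr_gt0 tsx' /= ltrBlDl.
  by rewrite addrC subrK; case: bx => /andP[].
(* If [ts] is in [U], so is a short interval to its right, and [phi] absorbs the increment of [g]
   there. Otherwise the Dini bound is available at [ts], and the slack [e * t] absorbs the
   increment. *)
have [Uts|NUts] := pselect (U ts).
  have /nbhs_ballP[d' /= d'0 dU] : nbhs ts U by rewrite nbhsE; exists U.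
  have [h /andP[h0 hd'] [hT hb]] := nxt d' d'0.
  have tsh : ts <= ts + h by lra.
  have := phi_ext ts (ts + h) ts0 tsh hT.
  move=> /(_ _)/wrap[].
    move=> x /=; rewrite in_itv/= => /andP[x1 x2]; apply: dU.
    rewrite /ball/= distrC ger0_norm ?subr_ge0//; lra.
  move=> pe; have := ler_norm (g (ts + h) - g ts).
  have : e * ts <= e * (ts + h) by rewrite ler_pM2l.
  lra.
have NB : ~ B' ts by move=> /BU.
have ts_gt0 : 0 < ts.
  rewrite lt_neqAle ts0 andbT; apply/eqP => E; apply: NB; right; exact/esym.
have : dini_le g ts 0.
  apply: contrapT => nd; apply: NB; left; apply: BP => /= H; apply: nd; apply: H.
  by rewrite ts_gt0 (lt_le_trans tslt).
move=> /(_ e e0)[d' d'0 d'P].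
have [h hd [hT hb]] := nxt d' d'0.
have := d'P h hd; rewrite add0r.
have h0 : 0 < h by case/andP: hd.
have := phi_mono ts (ts + h) _ hT; rewrite lerDl (ltW h0) => /(_ isT).
rewrite mulrDr in hb; lra.
Qed.

End AbsolutelyContinuous.

(** * Primitives of integrable functions, calculus of Dini bounds, Gronwall's inequality *)

Section Primitive.
Variable R : realType.
Notation mu := (@lebesgue_measure R).
Notation intg f := (mu.-integrable [set: R] (EFin \o f)).
Implicit Types (T : R) (f g l q E : R -> R) (P Q : R -> Prop).

Lemma ae_sub P Q : (forall t : R, P t -> Q t) ->
  {ae mu, forall t : R, P t} -> {ae mu, forall t : R, Q t}.
Proof. by move=> PQ; apply: filterS => //; exact: (ae_filter_ringOfSetsType mu). Qed.

Lemma ae_and P Q : {ae mu, forall t : R, P t} -> {ae mu, forall t : R, Q t} ->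
  {ae mu, forall t : R, P t /\ Q t}.
Proof. by apply: filterS2 => [|t]; first exact: (ae_filter_ringOfSetsType mu). Qed.

(** For negative [t] the interval is empty and the value is 0, so a curve written as an initial
    value plus a primitive is constant before time 0. *)
Definition prim f (t : R) : R := \int[mu]_(s in `[0, t]) f s.

Lemma prim0 f : prim f 0 = 0.
Proof. by rewrite /prim set_itv1 Rintegral_set1. Qed.

Lemma prim_lt0 f t : t < 0 -> prim f t = 0.
Proof. by move=> t0; rewrite /prim set_itv_ge ?Rintegral_set0// bnd_simp -ltNge. Qed.

Lemma prim_sub f a b : intg f -> 0 <= a -> a <= b ->
  prim f b - prim f a = \int[mu]_(s in `]a, b]) f s.
Proof.
move=> intf a0 ab; rewrite /prim Rintegral_itvB// ?bnd_simp//.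
exact: integrableS intf.
Qed.

Lemma prim_sub_le f a b : intg f -> 0 <= a -> a <= b ->
  `|prim f b - prim f a| <= \int[mu]_(s in `]a, b]) `|f s|.
Proof.
move=> intf a0 ab; rewrite prim_sub//; apply: le_normr_Rintegral => //.
exact: integrableS intf.
Qed.

Lemma prim_ac T f : intg f -> ac T (prim f).
Proof.
move=> intf e e0; have [d [d0 dP]] := integral_normr_continuous intf e0.
exists d => // n a b ab dis sd.
pose F (i : 'I_n) := `]a i, b i]%classic.
have tI : trivIset [set: 'I_n] F.
  apply/trivIsetP => i j _ _ ij; apply/seteqP; split => // x /= [].
  rewrite /F /= !in_itv/= => /andP[h1 h2] /andP[h3 h4].
  by have [h|h] := dis i j ij; lra.
have sE : [set` index_enum 'I_n] = [set: 'I_n].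
  by apply/seteqP; split => // i _ /=; rewrite mem_index_enum.
pose D := \big[setU/set0]_(i <- index_enum 'I_n) F i.
have DE : D = \bigcup_(i in [set: 'I_n]) F i by rewrite -sE bigcup_seq.
have mF i : measurable (F i) by rewrite /F.
have mD : measurable D.
  by rewrite DE; apply: fin_bigcup_measurable => //; exact: finite_finset.
have inf A : measurable A -> mu.-integrable A (EFin \o (fun x => `|f x|)).
  by move=> mA; apply: integrable_norm; exact: integrableS intf.
have muD : (mu D < d%:E)%E.
  apply: le_lt_trans (_ : _ <= (\sum_(i < n) (b i - a i))%:E)%E _; last by rewrite lte_fin.
  have -> : mu D = (\sum_(i \in [set: 'I_n]) mu (F i))%E.
    rewrite DE; apply: (@measure_fin_bigcup _ _ _ mu) => // [|i _]; [exact: finite_finset|exact: mF].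
  rewrite -sE -fsbig_seq ?index_enum_uniq// -sumEFin; apply: lee_sum => i _.
  rewrite [leLHS]lebesgue_measure_itv/= lte_fin; case: ltP => // h.
  by rewrite lee_fin subr_ge0; have [] := ab i.
apply: le_lt_trans (dP D mD muD).
have -> : \int[mu]_(x in D) `|f x| = \sum_(i < n) \int[mu]_(x in F i) `|f x|.
  rewrite /Rintegral integral_bigsetU_EFin ?index_enum_uniq//; last 2 first.
  - by rewrite sE.
  - by have /integrableP[] := inf D mD.
  rewrite sum_fine// => i _; apply: integrable_fin_num; [exact: mF|exact: (inf _ (mF i))].
by apply: ler_sum => i _; apply: prim_sub_le => //; have [] := ab i.
Qed.

Lemma prim_derive f : intg f ->
  {ae mu, forall t : R, 0 < t -> is_derive t 1 (prim f) (f t)}.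
Proof.
move=> intf.
have iy y : mu.-integrable [set` Interval (BLeft 0) (BRight y)] (EFin \o f).
  exact: integrableS intf.
have il : locally_integrable [set: R] f.
  by apply: open_integrable_locally => //; exact: openT.
have := @FTC1 R f (BLeft 0) iy il.
apply: ae_sub => t H t0.
have [|d1 d2] := H; first by rewrite lte_fin.
by rewrite derive1E in d2; exact: (DeriveDef d1 d2).
Qed.

(** Differentiability as a two-sided first-order expansion, the form that combines with
    [dini_le]. *)
Definition incr_at g (t c : R) : Prop := forall e : R, 0 < e -> exists2 d : R, 0 < d &
  forall h : R, `|h| < d -> `|g (t + h) - g t - c * h| <= e * `|h|.

Lemma is_derive_incr g (t c : R) : is_derive t 1 g c -> incr_at g t c.
Proof.
move=> [dg Dg] e e0.
have : h^-1 *: ((g \o shift t) (h *: 1) - g t) @[h --> 0^'] --> c.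
  by rewrite -Dg.
move=> /cvgrPdist_le /(_ e e0).
rewrite near_withinE near_simpl => /nbhs_ballP[d /= d0 H].
exists d => // h hd; have [->|h0] := eqVneq h 0.
  by rewrite addr0 subrr mulr0 subr0 normr0 mulr0.
have := H h _ h0; rewrite /ball/= sub0r normrN => /(_ hd).
rewrite /= [h *: 1]mulr1 (addrC h t) distrC => H'.
have -> : g (t + h) - g t - c * h = (h^-1 *: (g (t + h) - g t) - c) * h.
  by rewrite mulrBl [_ *: _]mulrC mulfVK.
by rewrite normrM ler_wpM2r.
Qed.

Lemma incr_dini g (t c c' : R) : incr_at g t c -> c <= c' -> dini_le g t c'.
Proof.
move=> H cc e e0; have [d d0 dP] := H e e0; exists d => // h /andP[h0 hd].
have := dP h; rewrite gtr0_norm// => /(_ hd) H'.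
have := ler_norm (g (t + h) - g t - c * h).
have : c * h <= c' * h by rewrite ler_pM2r.
rewrite mulrDl; lra.
Qed.

Lemma incr_cvg g (t c : R) : incr_at g t c -> forall e : R, 0 < e ->
  exists2 d : R, 0 < d & forall h : R, `|h| < d -> `|g (t + h) - g t| <= e.
Proof.
move=> H e e0; have [d d0 dP] := H 1 ltr01.
exists (Num.min d (e / (`|c| + 1))).
  by rewrite lt_min d0 divr_gt0// ltr_wpDl.
move=> h; rewrite lt_min => /andP[hd he].
have {}dP := dP h hd; rewrite mul1r in dP.
have := ler_normD (g (t + h) - g t - c * h) (c * h).
rewrite subrK normrM; move: he; rewrite ltr_pdivlMr ?ltr_wpDl//.
have := normr_ge0 c; have := normr_ge0 h; nra.
Qed.

(** Positivity of [E] preserves the direction of the one-sided bound on the increment of [g]; the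
    increment of [E] is multiplied by [g t], of unknown sign, and therefore has to be controlled
    from both sides. *)
Lemma dini_mul g E (t c c' : R) : (forall s, 0 < E s) -> dini_le g t c ->
  incr_at E t c' -> dini_le (fun s => g s * E s) t (c * E t + g t * c').
Proof.
move=> E0 gc Ec e e0.
(* [k] dominates the sum of the coefficients of [e1 * h] in the three error terms, namely [E t],
   [|c| + 1] and [|g t|]. *)
pose k := E t + `|c| + `|g t| + 3.
have k0 : 0 < k.
  by rewrite /k; have := E0 t; have := normr_ge0 c; have := normr_ge0 (g t); lra.
pose e1 := Num.min 1 (e / k).
have e10 : 0 < e1 by rewrite lt_min ltr01 divr_gt0.
have e11 : e1 <= 1 by rewrite ge_min lexx.
have e1k : e1 * k <= e.
  by rewrite -ler_pdivlMr// ge_min lexx orbT.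
have [d1 d10 d1P] := gc e1 e10.
have [d2 d20 d2P] := Ec e1 e10.
have [d3 d30 d3P] := incr_cvg Ec e10.
exists (Num.min d1 (Num.min d2 d3)); first by rewrite !lt_min d10 d20.
move=> h /andP[h0]; rewrite !lt_min => /and3P[h1 h2 h3].
have {d1P} := d1P h; rewrite h0 => /(_ h1) A1.
have {d2P} := d2P h; rewrite gtr0_norm// => /(_ h2) A2.
have {d3P} := d3P h; rewrite gtr0_norm// => /(_ h3) A3.
have -> : g (t + h) * E (t + h) - g t * E t =
  (g (t + h) - g t) * E (t + h) + g t * (E (t + h) - E t - c' * h) + g t * c' * h by ring.
have B1 : (g (t + h) - g t) * E (t + h) <= (c + e1) * h * E (t + h) by rewrite ler_pM2r.
have B2 : (c + e1) * h * E (t + h) <= (c + e1) * h * E t + `|c + e1| * h * e1.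
  have -> : (c + e1) * h * E (t + h) = (c + e1) * h * E t + h * ((c + e1) * (E (t + h) - E t)) by ring.
  have -> : `|c + e1| * h * e1 = h * (`|c + e1| * e1) by ring.
  rewrite lerD2l ler_pM2l//; apply: (le_trans (ler_norm _)).
  by rewrite normrM ler_wpM2l.
have B3 : g t * (E (t + h) - E t - c' * h) <= `|g t| * (e1 * h).
  by apply: (le_trans (ler_norm _)); rewrite normrM ler_wpM2l.
have B4 : `|c + e1| <= `|c| + 1.
  by apply: (le_trans (ler_normD _ _)); rewrite lerD2l gtr0_norm.
have B5 : `|c + e1| * h * e1 <= (`|c| + 1) * h * e1.
  by rewrite ler_pM2r// ler_pM2r.
have B6 : e1 * k * h <= e * h by rewrite ler_pM2r.
rewrite /k in B6; nra.
Qed.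

Lemma dini_sub g k (t c c' : R) : dini_le g t c -> incr_at k t c' ->
  dini_le (fun s => g s - k s) t (c - c').
Proof.
move=> gc kc e e0; have e20 : 0 < e / 2 by rewrite divr_gt0.
have [d1 d10 d1P] := gc _ e20; have [d2 d20 d2P] := kc _ e20.
exists (Num.min d1 d2); first by rewrite lt_min d10.
move=> h /andP[h0]; rewrite lt_min => /andP[h1 h2].
have := d1P h; rewrite h0 h1 => /(_ isT).
have := d2P h; rewrite gtr0_norm// => /(_ h2).
rewrite ler_norml => /andP[+ _]; lra.
Qed.

Lemma expR_lip (M x y : R) : x <= M -> y <= M ->
  `|expR x - expR y| <= expR M * `|x - y|.
Proof.
suff H (u w : R) : u <= w -> w <= M -> `|expR u - expR w| <= expR M * `|u - w|.
  move=> xM yM; have [h|/ltW h] := leP x y; first exact: H.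
  by rewrite distrC (distrC x); apply: H.
move=> uw wM; rewrite distrC (distrC u) !ger0_norm ?subr_ge0 ?ler_expR//.
(* The tangent of the exponential at [w] lies below its graph. *)
have : expR w * (u - w + 1) <= expR u.
  rewrite -{2}(subrK w u) expRD mulrC ler_pM2r ?expR_gt0// addrC expR_ge1Dx//.
move=> h; have h2 : expR w <= expR M by rewrite ler_expR.
have h3 : expR w * (w - u) <= expR M * (w - u) by rewrite ler_wpM2r// subr_ge0.
lra.
Qed.

Lemma incr_expR g (t c k : R) : is_derive t 1 g c ->
  incr_at (fun s => expR (k * g s)) t (k * c * expR (k * g t)).
Proof.
move=> dg; apply: is_derive_incr.
have d1 : is_derive t 1 (fun s => k * g s) (k * c).
  by have := @is_deriveZ _ _ _ g k t 1 c dg.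
rewrite mulrC; exact: (@is_derive1_comp R expR (fun s => k * g s)).
Qed.

Lemma ac_mulM T g E : ac T g -> ac T E -> ac T (fun s => g s * E s).
Proof.
move=> ag aE; have [M MP] := ac_bounded ag; have [N NP] := ac_bounded aE.
apply: (@ac_dom R bool (fun b => if b then g else E) (`|M| + `|N|)).
  by case.
move=> s t sT tT; rewrite big_bool/=.
have -> : g s * E s - g t * E t = (g s - g t) * E s + g t * (E s - E t) by ring.
apply: (le_trans (ler_normD _ _)); rewrite !normrM.
have := MP t tT; have := NP s sT; have := ler_norm M; have := ler_norm N.
have := normr_ge0 (g s - g t); have := normr_ge0 (E s - E t).
have := normr_ge0 M; have := normr_ge0 N.
move: `|g s - g t| `|E s - E t| `|E s| `|g t| `|M| `|N| => x y z w m n.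
by move=> ? ? ? ? ? ? ? ?; nra.
Qed.

Lemma ac_sub T g E : ac T g -> ac T E -> ac T (fun s => g s - E s).
Proof.
move=> ag aE; apply: (@ac_dom R bool (fun b => if b then g else E) 1).
  by case.
move=> s t sT tT; rewrite big_bool/= mul1r.
have -> : g s - E s - (g t - E t) = (g s - g t) - (E s - E t) by ring.
exact: ler_normB.
Qed.

Lemma ac_expR T g (k : R) : ac T g -> ac T (fun s => expR (k * g s)).
Proof.
move=> ag; have [M MP] := ac_bounded ag.
apply: (@ac_dom R unit (fun=> g) (expR (`|k| * M) * `|k|)) => // s t sT tT.
have H u : 0 <= u <= T -> k * g u <= `|k| * M.
  by move=> uT; apply: (le_trans (ler_norm _)); rewrite normrM ler_wpM2l// MP.
apply: le_trans (expR_lip (H s sT) (H t tT)) _.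
rewrite -mulrA ler_pM2l ?expR_gt0// -mulrBr normrM.
by rewrite (big_pred1 tt)//; case.
Qed.

(** With the integrating factor [expR (- prim l)] the Dini derivative becomes nonpositive. The
    condition on [q] holds for nonnegative [l] and [q], and also for [q = 0] with [l] of any sign;
    the lower bound on the distance of two generators uses the latter with a negative [l]. *)
Lemma gronwall T g l q : ac T g -> intg l -> intg q ->
  (forall t : R, 0 <= t <= T -> expR (- prim l t) * q t <= q t) ->
  {ae mu, forall t : R, 0 < t < T -> dini_le g t (l t * g t + q t)} ->
  forall t : R, 0 <= t <= T -> g t * expR (- prim l t) <= g 0 + prim q t.
Proof.
move=> ag il iq hq dg t tT.
pose E s := expR (-1 * prim l s).
have EE s : expR (- prim l s) = E s by rewrite /E mulN1r.
have E0 : E 0 = 1 by rewrite /E prim0 mulr0 expR0.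
suff : g t * E t - prim q t <= g 0 * E 0 - prim q 0.
  by rewrite E0 mulr1 prim0 subr0 EE lerBlDr.
apply: (@ac_dini_noninc R T (fun s => g s * E s - prim q s)) => //.
  by apply: ac_sub; [apply: ac_mulM => //; apply: ac_expR|]; exact: prim_ac.
have d1 := prim_derive il; have d2 := prim_derive iq.
move: (ae_and dg (ae_and d1 d2)); apply: ae_sub => s [dgs [d1s d2s]] sT; have s0 : 0 < s by case/andP: sT.
have := dini_sub (dini_mul (fun u => expR_gt0 _) (dgs sT) (incr_expR (-1) (d1s s0)))
  (is_derive_incr (d2s s0)).
move=> H e e0; have [d d0 dP] := H e e0; exists d => // h hd.
apply: le_trans (dP h hd) _.
have h0 : 0 < h by case/andP: hd.
rewrite ler_pM2r// lerD2r -/(E s).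
have -> : (l s * g s + q s) * E s + g s * (-1 * l s * E s) - q s =
  E s * q s - q s by ring.
rewrite subr_le0.
have := hq s; rewrite EE; by case/andP: sT => /ltW -> /ltW ->; apply.
Qed.

End Primitive.

(** * Comparison of primitives and the exponential weight for Picard iteration *)

Section PrimitiveBounds.
Variable R : realType.
Notation mu := (@lebesgue_measure R).
Notation intg f := (mu.-integrable [set: R] (EFin \o f)).
Implicit Types (f g l d h : R -> R) (u : nat -> R) (t : R).

Lemma continuous_eps g :
  (forall t (e : R), 0 < e -> exists2 d : R, 0 < d &
     forall s : R, `|s - t| < d -> `|g s - g t| <= e) <-> continuous g.
Proof.
split=> H.
  move=> t; apply/cvgrPdist_le => e e0; have [d d0 dP] := H t e e0.
  apply/nbhs_ballP; exists d => //= s; rewrite /ball/= distrC => st.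
  by rewrite distrC dP.
move=> t e e0; have /cvgrPdist_le /(_ e e0) /nbhs_ballP[d d0 dP] := H t.
by exists d => // s st; rewrite distrC; apply: dP; rewrite /ball/= distrC.
Qed.

Lemma pow2_small (c e : R) : 0 < e -> exists m, c / 2 ^+ m < e.
Proof.
move=> e0; exists (Num.truncn (c / e)).+1.
rewrite ltr_pdivrMr ?exprn_gt0// mulrC -ltr_pdivrMr//.
apply: (lt_le_trans (truncnS_gt _)).
by rewrite -natrX ler_nat ltnW// ltn_expl.
Qed.

Lemma eq0_pow2 (z c : R) : (forall m, `|z| <= c / 2 ^+ m) -> z = 0.
Proof.
move=> H; apply/normr0_eq0/eqP; rewrite eq_le normr_ge0 andbT leNgt.
by apply/negP => z0; have [m] := pow2_small c z0; rewrite ltNge H.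
Qed.

Lemma geo_cvg u (K : R) : (forall m, `|u m.+1 - u m| <= K / 2 ^+ m) ->
  exists a : R, forall m, `|u m - a| <= 2 * K / 2 ^+ m.
Proof.
move=> uK.
have K0 : 0 <= K by have := uK 0%N; rewrite expr0 divr1; apply: le_trans.
(* Subtracting the tail that is still to come makes the induction on [p] close. *)
have H m p : `|u (m + p)%N - u m| <= 2 * K / 2 ^+ m - 2 * K / 2 ^+ (m + p).
  elim: p => [|p IH]; first by rewrite addn0 !subrr normr0.
  rewrite addnS.
  have -> : u (m + p).+1 - u m = (u (m + p).+1 - u (m + p)%N) + (u (m + p)%N - u m) by ring.
  apply: (le_trans (ler_normD _ _)).
  have := uK (m + p)%N; have -> : 2 * K / 2 ^+ (m + p).+1 = K / 2 ^+ (m + p).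
    by rewrite exprS; field; rewrite ?expf_neq0.
  move: IH; have -> : 2 * K / 2 ^+ (m + p) = K / 2 ^+ (m + p) + K / 2 ^+ (m + p) by ring.
  lra.
have H' m p : `|u (m + p)%N - u m| <= 2 * K / 2 ^+ m.
  apply: (le_trans (H m p)); rewrite lerBlDr lerDl.
  by rewrite !mulr_ge0// invr_ge0 exprn_ge0.
have cu : cvgn u.
  apply/cauchy_cvgP/cauchy_exP => e e0.
  have [m me] := pow2_small (2 * K) e0.
  exists (u m), m => // n /= mn; rewrite /ball/= distrC.
  by apply: le_lt_trans me; have := H' m (n - m)%N; rewrite subnKC.
exists (limn u) => m.
apply/ler_addgt0Pr => e e0.
have /cvgrPdist_lt /(_ e e0) [p _ pP] := cu.
have := pP (maxn m p) (leq_maxr _ _); have := H' m (maxn m p - m)%N.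
rewrite subnKC ?leq_maxl// => h1 h2.
have -> : u m - limn u = - (u (maxn m p) - u m) - (limn u - u (maxn m p)) by ring.
apply: (le_trans (ler_normB _ _)); rewrite normrN; exact: lerD (ltW _).
Qed.

Lemma intg_dom f l : measurable_fun [set: R] f -> (forall t, `|f t| <= l t) ->
  intg l -> intg f.
Proof.
move=> mf fl il; apply: le_integrable il => //; first exact/measurable_EFinP.
by move=> t _ /=; rewrite lee_fin (le_trans (fl t))// ler_norm.
Qed.

Lemma prim_dist f g d t : intg f -> intg g -> intg d ->
  (forall s, `|f s - g s| <= d s) -> `|prim f t - prim g t| <= prim d t.
Proof.
move=> jf jg jd H.
have S h : intg h -> mu.-integrable `[0, t] (EFin \o h).
  by move=> ih; exact: integrableS ih.
rewrite /prim -RintegralB//; [|exact: S|exact: S].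
have jfg : mu.-integrable `[0, t] (EFin \o (fun s => f s - g s)).
  by have := integrableB _ (S _ jf) (S _ jg); apply.
apply: le_trans (le_normr_Rintegral _ _) _ => //.
apply: le_Rintegral => //; [exact: integrable_norm|exact: S].
Qed.

Lemma prim_ge0 f t : (forall s, 0 <= f s) -> 0 <= prim f t.
Proof. by move=> f0; apply: Rintegral_ge0 => s _. Qed.

Lemma prim_le f g t : intg f -> intg g -> (forall s, f s <= g s) -> prim f t <= prim g t.
Proof.
move=> jf jg fg; apply: le_Rintegral => //; [exact: integrableS jf|exact: integrableS jg].
Qed.

Lemma primZ f (k : R) t : intg f -> prim (fun s => k * f s) t = k * prim f t.
Proof. by move=> jf; rewrite /prim RintegralZl//; exact: integrableS jf. Qed.

Lemma prim_norm_le f t : intg f -> `|prim f t| <= prim (fun s => `|f s|) t.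
Proof. by move=> jf; apply: le_normr_Rintegral => //; exact: integrableS jf. Qed.

Lemma prim_mono f s t : intg f -> (forall t, 0 <= f t) -> s <= t -> prim f s <= prim f t.
Proof.
move=> jf f0 st; have [s0|s0] := ltP s 0; first by rewrite prim_lt0// prim_ge0.
by rewrite -subr_ge0 prim_sub//; apply: Rintegral_ge0 => u _.
Qed.

Lemma prim_le_total f t : intg f -> (forall s, 0 <= f s) -> prim f t <= \int[mu]_s f s.
Proof.
move=> jf f0; rewrite /prim/Rintegral fine_le//.
- by apply: integrable_fin_num => //; exact: integrableS jf.
- by apply: integrable_fin_num.
- apply: ge0_subset_integral => //; first by have /integrableP[] := jf.
  by move=> s _; rewrite lee_fin.
Qed.

Lemma prim_continuous f : intg f -> continuous (prim f).
Proof.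
move=> jf; apply/continuous_eps => t e e0.
have [t0|t0] := ltP t 0.
  exists (- t); first by rewrite oppr_gt0.
  move=> s st; rewrite !prim_lt0 ?subrr ?normr0 ?ltW//.
  by move: st; rewrite ltr_norml => /andP[_]; rewrite ltrBlDr addNr.
have [d d0 dP] := ac_unif (prim_ac (t + 1) jf) e0.
exists (Num.min d 1); first by rewrite lt_min d0 ltr01.
move=> s; rewrite lt_min => /andP[sd s1]; have [s0|s0] := ltP s 0.
  have b0 : (0 : R) <= 0 <= t + 1 by rewrite lexx addr_ge0.
  have bt : 0 <= t <= t + 1 by rewrite t0 lerDl ler01.
  have := dP 0 t b0 bt; rewrite prim0 (prim_lt0 _ s0) => h.
  apply/ltW/h; apply: le_lt_trans sd.
  rewrite sub0r normrN distrC !ger0_norm ?subr_ge0//; first by rewrite lerDl oppr_ge0 ltW.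
  by rewrite (le_trans (ltW s0)).
apply/ltW/dP => //; first rewrite s0/=.
  by move: s1; rewrite ltr_norml => /andP[_]; lra.
by rewrite t0 lerDl ler01.
Qed.

(** The integrand is almost everywhere the derivative of [expR (k * prim l t)]. Integrating [l]
    against this weight thus returns the weight divided by [k], which is the source of contraction
    in the Picard iteration, however large the integral of [l] is. *)
Lemma prim_weight l (k t : R) : intg l -> (forall s, 0 <= l s) -> 0 < k ->
  intg (fun s => k * l s * expR (k * prim l s)) /\
  prim (fun s => k * l s * expR (k * prim l s)) t <= expR (k * prim l t).
Proof.
move=> jl l0 k0; set h := fun s => _.
have mE : measurable_fun [set: R] (fun s => expR (k * prim l s)).
  apply: continuous_measurable_fun => s.
  apply: continuous_comp; last exact: continuous_expR.
  by apply: cvgM; [exact: cvg_cst|exact: prim_continuous].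
have ml : measurable_fun [set: R] l by have /integrableP[/measurable_EFinP] := jl.
pose M := expR (k * \int[mu]_s l s).
have jh : intg h.
  apply: (@intg_dom h (fun s => k * M * l s)).
  - by apply: measurable_funM => //; apply: measurable_funM.
  - move=> s; rewrite /h ger0_norm; last by rewrite mulr_ge0 ?expR_ge0// mulr_ge0// ltW.
    rewrite mulrAC -!mulrA ler_pM2l// ler_wpM2r// ler_expR ler_pM2l//.
    exact: prim_le_total.
  - by have := integrableZl _ (k * M) jl; apply.
split => //; have [t0|t0] := ltP t 0; first by rewrite prim_lt0 ?expR_ge0.
pose g s := prim h s - expR (k * prim l s).
suff : g t <= g 0.
  rewrite /g !prim0 mulr0 expR0 sub0r; have := expR_ge0 (k * prim l t); lra.
apply: (@ac_dini_noninc R t g) => //; last by rewrite t0 lexx.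
  by apply: ac_sub; [exact: prim_ac|apply: ac_expR; exact: prim_ac].
move: (ae_and (prim_derive jh) (prim_derive jl)); apply: ae_sub => s [d1 d2] /andP[s0 _].
rewrite -(subrr (h s)); apply: dini_sub; last exact: incr_expR (d2 s0).
exact: incr_dini (is_derive_incr (d1 s0)) _.
Qed.

End PrimitiveBounds.

(** * Caratheodory solutions *)

Section Caratheodory.
Variables (R : realType) (I : finType) (f : R -> (I -> R) -> I -> R).
Variables (l : R -> R) (x0 : I -> R).
Notation mu := (@lebesgue_measure R).
Notation intg f := (mu.-integrable [set: R] (EFin \o f)).
Hypothesis jl : intg l.
Hypothesis mf : forall a (x : R -> I -> R), (forall b, continuous (x^~ b)) ->
  measurable_fun [set: R] (fun t => f t (x t) a).
Hypothesis fl : forall t x a, `|f t x a| <= l t.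
Hypothesis flip : forall t x y a, `|f t x a - f t y a| <= l t * \sum_b `|x b - y b|.

Let l0 t (a : I) : 0 <= l t. Proof. exact: le_trans (fl t x0 a). Qed.

Fixpoint picard (m : nat) : R -> I -> R :=
  if m is m'.+1 then
    fun t a => x0 a + prim (fun s => f s (picard m' s) a) t
  else fun=> x0.

Let jf (x : R -> I -> R) a : (forall b, continuous (x^~ b)) ->
  intg (fun s => f s (x s) a).
Proof. by move=> cx; apply: intg_dom jl => //; exact: mf. Qed.

Let picard_cont m b : continuous ((picard m)^~ b).
Proof.
elim: m b => [|m IH] b /=; first by move=> t; exact: cvg_cst.
move=> t; apply: cvgD; first exact: cvg_cst.
exact/prim_continuous/jf.
Qed.

Let jpicard m a : intg (fun s => f s (picard m s) a).
Proof. exact: (jf a (@picard_cont m)). Qed.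

(** As [l] bounds the field and its Lipschitz constant globally, the weighted contraction makes the
    iterates converge uniformly on the whole line at once; no local solutions have to be
    continued. *)
Theorem caratheodory : exists x : R -> I -> R, (forall b, continuous (x^~ b)) /\
  forall t a, x t a = x0 a + prim (fun s => f s (x s) a) t.
Proof.
have [a0|noI] := pselect (exists a : I, True); last first.
  by exists (fun=> x0); split=> [b|t a]; case: noI; [exists b|exists a].
have {a0}l0' t : 0 <= l t by case: a0 => a _; exact: l0 a.
(* [k] exceeds twice the number of components, so summing the [n] componentwise estimates still
   leaves a factor [n / k <= 1 / 2]. *)
pose n : R := #|I|%:R; pose k := 2 * n + 1.
have n0 : 0 <= n by [].
have k0 : 0 < k by rewrite /k; lra.
pose M := \int[mu]_s l s; pose C := n * M.
have primM t : prim l t <= M by exact: prim_le_total.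
have M0 : 0 <= M by apply: le_trans (primM 0); rewrite prim0.
have C0 : 0 <= C by rewrite mulr_ge0.
pose E t := expR (k * prim l t).
(* The iterates contract by 1/2 in the norm weighted by [E^-1]. *)
have step m t : \sum_a `|picard m.+1 t a - picard m t a| <= C / 2 ^+ m * E t.
  elim: m t => [|m IH] t.
    apply: (@le_trans _ _ C); last first.
      rewrite expr0 divr1 ler_peMr// -expR0 ler_expR.
      by rewrite mulr_ge0 ?prim_ge0// ltW.
    apply: (@le_trans _ _ (\sum_(a : I) M)); last by rewrite sumr_const /C /n mulr_natl.
    apply: ler_sum => a _ /=; rewrite addrC addKr.
    apply: le_trans (primM t); apply: le_trans (prim_norm_le _ _) _.
      by apply: (@jf (fun=> x0)) => b s; exact: cvg_cst.
    apply: prim_le => //; apply/integrable_norm/(@jf (fun=> x0)) => b s.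
    exact: cvg_cst.
  pose w s := C / 2 ^+ m / k * (k * l s * E s).
  have [jw wE] := prim_weight t jl l0' k0.
  have Hk a : `|picard m.+2 t a - picard m.+1 t a| <= prim w t.
    rewrite [picard m.+2 _ _]/= [picard m.+1 _ _]/= opprD addrACA subrr add0r.
    apply: (@prim_dist _ _ _ w t (jpicard m.+1 a) (jpicard m a)).
    - by have := integrableZl _ (C / 2 ^+ m / k) jw; apply.
    - move=> s; apply: le_trans (flip _ _ _ _) _.
      have -> : w s = l s * (C / 2 ^+ m * E s).
        by rewrite /w; field; rewrite (gt_eqF k0)/= ?expf_neq0.
      by apply: ler_wpM2l.
  apply: (@le_trans _ _ (\sum_(a : I) prim w t)); first exact: ler_sum.
  have -> : \sum_(a : I) prim w t = n * prim w t by rewrite sumr_const /n mulr_natl.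
  rewrite /w primZ//.
  set P := prim _ t in wE *.
  have D0 : 0 <= C / 2 ^+ m by rewrite divr_ge0// exprn_ge0.
  have -> : n * (C / 2 ^+ m / k * P) = C / 2 ^+ m * (n / k * P).
    by field; rewrite (gt_eqF k0)/= ?expf_neq0.
  have -> : C / 2 ^+ m.+1 * E t = C / 2 ^+ m * (1 / 2 * E t).
    by rewrite exprS; field; rewrite ?expf_neq0.
  apply: ler_wpM2l => //; apply: (@le_trans _ _ (n / k * E t)).
    by apply: ler_wpM2l => //; rewrite divr_ge0// ltW.
  rewrite ler_wpM2r ?expR_ge0// ler_pdivrMr// /k; lra.
pose K := C * expR (k * M).
have step' m t a : `|picard m.+1 t a - picard m t a| <= K / 2 ^+ m.
  apply: le_trans (_ : _ <= \sum_a `|picard m.+1 t a - picard m t a|) _.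
    by rewrite (bigD1 a)//= lerDl sumr_ge0.
  apply: le_trans (step m t) _; rewrite /K mulrAC ler_wpM2r ?invr_ge0 ?exprn_ge0//.
  by rewrite ler_wpM2l// ler_expR ler_pM2l.
have lim t a : exists z, forall m, `|picard m t a - z| <= 2 * K / 2 ^+ m.
  exact: geo_cvg.
have /choice[x xP] : forall ta : R * I, exists z, forall m, `|picard m ta.1 ta.2 - z| <= 2 * K / 2 ^+ m.
  by move=> [t a]; exact: lim.
have K0 : 0 <= K by rewrite mulr_ge0// expR_ge0.
have cx b : continuous (fun t => x (t, b)).
  apply/continuous_eps => t e e0.
  have e30 : 0 < e / 3 by rewrite divr_gt0.
  have [m me] := pow2_small (2 * K) e30.
  have [d d0 dP] := (continuous_eps _).2 (@picard_cont m b) t _ e30.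
  exists d => // s sd.
  have := xP (s, b) m; have := xP (t, b) m; have := dP s sd => /=.
  have -> : x (s, b) - x (t, b) = (picard m t b - x (t, b)) - (picard m s b - x (s, b)) +
    (picard m s b - picard m t b) by ring.
  move=> h1 h2 h3; apply: (le_trans (ler_normD _ _)).
  have := ler_normB (picard m t b - x (t, b)) (picard m s b - x (s, b)).
  lra.
exists (fun t b => x (t, b)); split => // t a.
apply/eqP; rewrite -subr_eq0; apply/eqP.
(* The limit and its image under the integral operator are both within a geometric error of the
   iterate of index [m.+1], for every [m]. *)
apply: (@eq0_pow2 _ _ (2 * K + M * (n * (2 * K)))) => m.
pose c := n * (2 * K / 2 ^+ m).
have h1 : `|picard m.+1 t a - (x0 a + prim (fun s => f s (fun b => x (s, b)) a) t)| <= c * M.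
  rewrite /= opprD addrACA subrr add0r.
  apply: (@le_trans _ _ (prim (fun s => c * l s) t)).
    apply: (@prim_dist _ _ _ (fun s => c * l s) t (jpicard m a) (jf a cx)).
    - by have := integrableZl _ c jl; apply.
    - move=> s; apply: le_trans (flip _ _ _ _) _; rewrite mulrC ler_wpM2r//.
      apply: (@le_trans _ _ (\sum_(b : I) (2 * K / 2 ^+ m))).
        by apply: ler_sum => b _; exact: (xP (s, b)).
      by rewrite sumr_const /c /n [leRHS]mulr_natl.
  by rewrite primZ// ler_wpM2l// /c mulr_ge0// divr_ge0 ?exprn_ge0// mulr_ge0.
have h2 := xP (t, a) m.+1; rewrite /= in h2.
set A := x0 a + _ in h1 *; set B := x (t, a) in h2 *.
have -> : B - A = (picard m.+1 t a - A) - (picard m.+1 t a - B) by ring.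
apply: (le_trans (ler_normB _ _)).
have -> : (2 * K + M * (n * (2 * K))) / 2 ^+ m = c * M + 2 * K / 2 ^+ m.
  by rewrite /c; ring.
apply: lerD => //; apply: (le_trans h2).
rewrite ler_wpM2l ?mulr_ge0// lef_pV2 ?posrE ?exprn_gt0// exprS ler_peMl//.
by rewrite ler1n.
Qed.

End Caratheodory.

(** * Lebesgue measure on the plane *)

Section Plane.
Variable R : realType.
Notation mu := (@lebesgue_measure R).
Implicit Types (x y z w : R * R) (a b c r e : R).

Lemma pair_ext2 x y : x.1 = y.1 -> x.2 = y.2 -> x = y.
Proof. by case: x => ? ?; case: y => ? ? /= -> ->. Qed.

Lemma enorm_ge0 x : 0 <= enorm x. Proof. exact: sqrtr_ge0. Qed.

Lemma enorm_sq x : enorm x ^+ 2 = x.1 ^+ 2 + x.2 ^+ 2.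
Proof. by rewrite sqr_sqrtr// addr_ge0 ?sqr_ge0. Qed.

Lemma enormN x : enorm (- x) = enorm x.
Proof. by rewrite /enorm/= !sqrrN. Qed.

Lemma enormB x y : enorm (x - y) = enorm (y - x).
Proof. by rewrite -enormN opprB. Qed.

Lemma enorm0 : enorm (0 : R * R) = 0.
Proof. by rewrite /enorm/= expr0n/= addr0 sqrtr0. Qed.

Definition dotp x y := x.1 * y.1 + x.2 * y.2.

Lemma dotp_le x y : `|dotp x y| <= enorm x * enorm y.
Proof.
rewrite -(@ler_pXn2r _ 2)// ?nnegrE ?mulr_ge0 ?enorm_ge0//.
rewrite exprMn !enorm_sq real_normK ?num_real// /dotp -subr_ge0.
have -> : (x.1 ^+ 2 + x.2 ^+ 2) * (y.1 ^+ 2 + y.2 ^+ 2) - (x.1 * y.1 + x.2 * y.2) ^+ 2 =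
  (x.1 * y.2 - x.2 * y.1) ^+ 2 by ring.
exact: sqr_ge0.
Qed.

Lemma enormD x y : enorm (x + y) <= enorm x + enorm y.
Proof.
rewrite -(@ler_pXn2r _ 2)// ?nnegrE ?addr_ge0 ?enorm_ge0//.
rewrite sqrrD !enorm_sq /=; have := dotp_le x y; rewrite /dotp => h.
have := ler_norm (x.1 * y.1 + x.2 * y.2); lra.
Qed.

Lemma enorm_triangle z x y : enorm (x - y) <= enorm (x - z) + enorm (z - y).
Proof. by apply: le_trans (enormD _ _); rewrite addrA subrK. Qed.

Lemma enorm_sub_le x y : `|enorm x - enorm y| <= enorm (x - y).
Proof.
have h1 := enormD (x - y) y; rewrite subrK in h1.
have h2 := enormD (y - x) x; rewrite subrK enormB in h2.
rewrite ler_norml; lra.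
Qed.

Lemma enorm_fst x : `|x.1| <= enorm x.
Proof. by rewrite -sqrtr_sqr ler_wsqrtr// lerDl sqr_ge0. Qed.

Lemma enorm_snd x : `|x.2| <= enorm x.
Proof. by rewrite -sqrtr_sqr ler_wsqrtr// lerDr sqr_ge0. Qed.

Lemma enorm_le_sum x : enorm x <= `|x.1| + `|x.2|.
Proof.
rewrite -(@ler_pXn2r _ 2)// ?nnegrE ?addr_ge0 ?enorm_ge0//.
rewrite enorm_sq sqrrD !real_normK ?num_real//.
have : 0 <= `|x.1| * `|x.2| by rewrite mulr_ge0.
lra.
Qed.

Lemma enorm_eq0 x : enorm x = 0 -> x = 0.
Proof.
move=> h; have := enorm_fst x; have := enorm_snd x; rewrite h !normr_le0.
by case: x {h} => u v /= /eqP -> /eqP ->.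
Qed.

Lemma enorm_gt0 x : x != 0 -> 0 < enorm x.
Proof.
by move=> x0; rewrite lt_neqAle enorm_ge0 andbT eq_sym; apply: contra x0 => /eqP/enorm_eq0 ->.
Qed.

Lemma enorm_scale c x : enorm (scale2 c x) = `|c| * enorm x.
Proof. by rewrite /enorm/= !exprMn -mulrDr sqrtrM ?sqr_ge0// sqrtr_sqr. Qed.

Lemma enorm_sqB x y : enorm (x - y) ^+ 2 = enorm x ^+ 2 - 2 * dotp x y + enorm y ^+ 2.
Proof. by rewrite !enorm_sq /dotp /=; ring. Qed.

Lemma enorm_sqD x y : enorm (x + y) ^+ 2 = enorm x ^+ 2 + 2 * dotp x y + enorm y ^+ 2.
Proof. by rewrite !enorm_sq /dotp /=; ring. Qed.

Lemma measurable_pfst : measurable_fun [set: plane R] (fun z : plane R => z.1 : R).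
Proof. exact: measurable_fst. Qed.

Lemma measurable_psnd : measurable_fun [set: plane R] (fun z : plane R => z.2 : R).
Proof. exact: measurable_snd. Qed.

Lemma measurable_plane_pair d (T : measurableType d) (f g : T -> R) :
  measurable_fun [set: T] f -> measurable_fun [set: T] g ->
  measurable_fun [set: T] (fun t : T => (f t, g t) : plane R).
Proof. by move=> mf mg; apply: measurable_fun_pair. Qed.

Lemma measurable_enorm d (T : measurableType d) (f g : T -> R) :
  measurable_fun [set: T] f -> measurable_fun [set: T] g ->
  measurable_fun [set: T] (fun t : T => enorm (f t, g t)).
Proof.
move=> mf mg; rewrite /enorm /=.
apply: (@measurableT_comp _ _ _ _ _ _ (@Num.sqrt R) _ (fun t => f t ^+ 2 + g t ^+ 2)).
  by apply: continuous_measurable_fun; exact: sqrt_continuous.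
by apply: measurable_funD; exact: measurable_funX.
Qed.

Lemma measurable_inf_seq d (T : measurableType d) (h : nat -> T -> R) (f : T -> R) :
  (forall n, measurable_fun [set: T] (h n)) ->
  (forall n (t : T), f t <= h n t) ->
  (forall (t : T) e, 0 < e -> exists n, h n t < f t + e) ->
  measurable_fun [set: T] f.
Proof.
move=> mh fh hf.
have -> : f = fun t : T => infs (h^~ t) 0%N.
  apply/funext => x; rewrite /infs /sdrop /=.
  apply/eqP; rewrite eq_le; apply/andP; split.
    apply: lb_le_inf; first by exists (h 0%N x), 0%N.
    by move=> _ [n _ <-].
  apply/ler_addgt0Pr => e e0; have [n hn] := hf x e e0.
  apply: le_trans (ltW hn); apply: ge_inf; last by exists n.
  by exists (f x) => _ [m _ <-].
apply: measurable_fun_infs => // x _; exists (f x) => _ [n _ <-]; exact: fh.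
Qed.

Definition qpt (n : nat) : R * R :=
  if @unpickle (rat * rat)%type n is Some p then (ratr p.1, ratr p.2) else 0.

Lemma qpt_dense x e : 0 < e -> exists n, enorm (x - qpt n) < e.
Proof.
move=> e0.
have H a : exists q : rat, `|a - ratr q| < e / 2.
  have [|q] := @rat_in_itvoo R (a - e / 2) (a + e / 2); first by lra.
  rewrite in_itv/= => /andP[h1 h2]; exists q.
  by rewrite ltr_distlC; lra.
have [p hp] := H x.1; have [q hq] := H x.2.
exists (pickle (p, q)); rewrite /qpt pickleK/=.
apply: le_lt_trans (enorm_le_sum _) _ => /=; lra.
Qed.

(** McShane's formula: [f] is the infimum of the cones [f q + K |x - q|] over the rational points
    [q], and a countable infimum preserves measurability for the product sigma-algebra. *)
Lemma measurable_lip (K : R) (f : R * R -> R) :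
  (forall x y, `|f x - f y| <= K * enorm (x - y)) ->
  measurable_fun [set: plane R] (f : plane R -> R).
Proof.
move=> fK; apply: (@measurable_inf_seq _ _ (fun n x => f (qpt n) + K * enorm (x - qpt n))).
- move=> n; apply: measurable_funD; first exact: measurable_cst.
  apply: measurable_funM; first exact: measurable_cst.
  apply: (@measurable_enorm _ _ (fun z : plane R => z.1 - (qpt n).1) (fun z : plane R => z.2 - (qpt n).2)).
    by apply: measurable_funB; [exact: measurable_pfst|exact: measurable_cst].
  by apply: measurable_funB; [exact: measurable_psnd|exact: measurable_cst].
- by move=> n x; rewrite -lerBlDl; apply: le_trans (fK _ _); exact: ler_norm.
move=> x e e0; have K1 : 0 < 2 * (`|K| + 1) by rewrite mulr_gt0// ltr_wpDl.
have [n hn] := qpt_dense x (divr_gt0 e0 K1); exists n.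
have := fK (qpt n) x; rewrite enormB => h.
have h2 := ler_norm (f (qpt n) - f x).
have h3 : K * enorm (x - qpt n) <= `|K| * enorm (x - qpt n).
  by rewrite ler_wpM2r ?enorm_ge0// ler_norm.
rewrite ltr_pdivlMr// in hn.
have := enorm_ge0 (x - qpt n); move: (enorm _) => E in h h3 hn * => E0.
nra.
Qed.

Lemma lebesgue_shift a (A : set R) : measurable A ->
  mu ((fun t => t + a) @^-1` A) = mu A.
Proof.
move=> mA.
have ms : measurable_fun [set: R] (fun t : R => t + a).
  by apply: measurable_funD => //; exact: measurable_cst.
have ms' : @measurable_fun _ _ (measurableTypeR R) (measurableTypeR R) setT (fun t : R => t + a).
  exact: ms.
pose phi : {mfun (measurableTypeR R) >-> (measurableTypeR R)} :=
  HB.pack (fun t : R => t + a) (isMeasurableFun.Build _ _ _ _ _ ms').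
apply/esym/(@lebesgue_measure_unique R (pushforward mu phi)) => //.
move=> _ [[x y] _ <-]; rewrite /=.
transitivity (mu `]x - a, y - a]%classic); last first.
  congr (mu _); apply/seteqP; split => t /=; rewrite !in_itv/= ltrBlDr lerBrDr//.
rewrite [LHS]lebesgue_measure_itv [RHS]lebesgue_measure_itv/= !lte_fin ltrD2r.
by case: ifP => // _; rewrite -!EFinD; congr EFin; ring.
Qed.

Definition tr (p : R * R) (z : plane R) : plane R := (z : R * R) + p.

Lemma measurable_shift (p : R * R) : measurable_fun [set: plane R] (tr p).
Proof.
apply: (@measurable_plane_pair _ _ (fun z : plane R => z.1 + p.1) (fun z : plane R => z.2 + p.2)).
  by apply: measurable_funD; [exact: measurable_pfst|exact: measurable_cst].
by apply: measurable_funD; [exact: measurable_psnd|exact: measurable_cst].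
Qed.

Definition shift_set (p : R * R) (A : set (plane R)) : set (plane R) := tr p @^-1` A.

Lemma measurable_shift_set p (A : set (plane R)) : measurable A ->
  measurable (shift_set p A : set (plane R)).
Proof.
move=> mA; rewrite -[shift_set _ _]setTI.
exact: (measurable_shift p).
Qed.

Lemma leb2_shift p (A : set (plane R)) : measurable A -> leb2 R (shift_set p A) = leb2 R A.
Proof.
move=> mA.
pose phi : {mfun (plane R) >-> (plane R)} :=
  HB.pack (tr p)
    (isMeasurableFun.Build _ _ _ _ _ (measurable_shift p)).
apply/esym; apply: (@product_measure_unique _ _ _ _ R mu mu (pushforward (leb2 R) phi)) => //.
move=> B C mB mC; transitivity (leb2 R (((fun t => t + p.1) @^-1` B) `*` ((fun t => t + p.2) @^-1` C))).
  by [].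
have mS (a : R) (D : set R) : measurable D -> measurable ((fun t => t + a) @^-1` D).
  move=> mD; rewrite -[_ @^-1` _]setTI.
  have : measurable_fun [set: R] (fun t : R => t + a).
    by apply: measurable_funD => //; exact: measurable_cst.
  by apply.
rewrite [LHS]product_measure1E; [|exact: mS|exact: mS].
by rewrite [X in (X * _)%E](lebesgue_shift p.1 mB) [X in (_ * X)%E](lebesgue_shift p.2 mC).
Qed.

Lemma ge0_integral_shift p (A : set (plane R)) (f : plane R -> \bar R) :
  measurable A -> measurable_fun [set: plane R] f -> (forall z, 0 <= f z)%E ->
  (\int[leb2 R]_(z in shift_set p A) f (tr p z) = \int[leb2 R]_(z in A) f z)%E.
Proof.
move=> mA mf f0.
pose phi : {mfun (plane R) >-> (plane R)} :=
  HB.pack (tr p) (isMeasurableFun.Build _ _ _ _ _ (measurable_shift p)).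
have H := @ge0_integral_pushforward _ _ _ _ R _ (measurable_shift p) (leb2 R) A f mA
  (measurable_funTS mf) (fun z _ => f0 z).
transitivity (\int[pushforward (leb2 R) phi]_(y in A) f y)%E; first exact/esym/H.
by apply: eq_measure_integral => B mB _; exact: leb2_shift.
Qed.

Lemma leb2_box (i j : interval R) :
  leb2 R ([set` i] `*` [set` j]) = (mu [set` i] * mu [set` j])%E.
Proof. exact: product_measure1E. Qed.

Definition box (c : R * R) (r : R) : set (R * R) :=
  `[c.1 - r, c.1 + r]%classic `*` `[c.2 - r, c.2 + r]%classic.

Lemma measurable_box (c : R * R) r : measurable (box c r : set (plane R)).
Proof. by apply: measurableX; exact: measurable_itv. Qed.

Lemma leb2_boxE (c : R * R) r : 0 <= r -> leb2 R (box c r) = ((2 * r) ^+ 2)%:E.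
Proof.
move=> r0; rewrite leb2_box; have H (t : R) : mu `[t - r, t + r]%classic = (2 * r)%:E.
  rewrite [LHS]lebesgue_measure_itv/= lte_fin; case: ifP => h.
    by rewrite -EFinB; congr EFin; ring.
  have -> : r = 0 by apply/eqP; rewrite eq_le r0 andbT leNgt; apply/negP => r1; move: h; lra.
  by rewrite mulr0.
by rewrite !H -EFinM expr2.
Qed.

Lemma box_enorm (c z : R * R) r : enorm (z - c) <= r -> box c r z.
Proof.
move=> h; have h1 := enorm_fst (z - c); have h2 := enorm_snd (z - c).
rewrite /box; split; rewrite /= in_itv/= -ler_distlC distrC.
  exact: le_trans h1 h.
exact: le_trans h2 h.
Qed.

Lemma enorm_box (c z : R * R) r : box c r z -> enorm (z - c) <= 2 * r.
Proof.
move=> [/=]; rewrite !in_itv/= -!ler_distlC => h1 h2.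
apply: (le_trans (enorm_le_sum _)) => /=; rewrite distrC (distrC z.2); lra.
Qed.

Lemma leb2_bounded_lty (A : set (plane R)) (c : R * R) r : measurable A ->
  (forall z, A z -> enorm (z - c) <= r) -> (leb2 R A < +oo)%E.
Proof.
move=> mA Ar.
have [r0|r0] := ltP r 0.
  suff -> : A = set0 by rewrite measure0.
  by apply/seteqP; split => // z /Ar h; have := enorm_ge0 (z - c); rewrite leNgt (le_lt_trans h).
apply: (@le_lt_trans _ _ (leb2 R (box c r))); last by rewrite leb2_boxE// ltry.
apply: le_measure; rewrite ?inE//; first exact: measurable_box.
by move=> z /Ar; exact: box_enorm.
Qed.

(** When two generators move, their bisector sweeps a set of this kind; the square keeps its area
    finite. *)
Definition strip (M : R) (e : R * R) (c d : R) : set (R * R) :=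
  [set z | [/\ `|z.1| <= M, `|z.2| <= M & c <= dotp e z <= c + d]].

Lemma measurable_strip M (e : R * R) c (d : R) : measurable (strip M e c d : set (plane R)).
Proof.
have m1 : measurable_fun [set: plane R] (fun z : plane R => `|z.1| : R).
  by apply: measurableT_comp; [exact: normr_measurable|exact: measurable_pfst].
have m2 : measurable_fun [set: plane R] (fun z : plane R => `|z.2| : R).
  by apply: measurableT_comp; [exact: normr_measurable|exact: measurable_psnd].
have m3 : measurable_fun [set: plane R] (fun z : plane R => dotp e z : R).
  by apply: measurable_funD; apply: measurable_funM;
    [exact: measurable_cst|exact: measurable_pfst|exact: measurable_cst|exact: measurable_psnd].
have -> : strip M e c d = [set z : plane R | `|z.1| <= M] `&` ([set z : plane R | `|z.2| <= M]
   `&` ([set z : plane R | c <= dotp e z] `&` [set z : plane R | dotp e z <= c + d])).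
  apply/seteqP; split => z; first by move=> [h1 h2 /andP[h3 h4]].
  by move=> [h1 [h2 [h3 h4]]]; split => //; apply/andP; split.
have mle (f g : plane R -> R) : measurable_fun [set: plane R] f -> measurable_fun [set: plane R] g ->
    measurable [set z | f z <= g z].
  move=> mf mg; have := measurable_fun_ler mf mg measurableT (_ : measurable [set true]).
  move=> /(_ _)/wrap[]; first by [].
  by rewrite setTI.
by do 3?apply: measurableI; apply: mle => //; exact: measurable_cst.
Qed.

Lemma lebesgue_slab (a b c d : R) : a != 0 -> 0 <= d ->
  (mu [set t : R | (c <= a * t + b <= c + d)%R] <= (d / `|a|)%:E)%E.
Proof.
move=> a0 d0.
wlog {a0} a0 : a b c / 0 < a.
  move=> H; have [a1|a1|a1] := ltgtP a 0; last by rewrite a1 eqxx in a0.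
    have := H (- a) (- b) (- c - d); rewrite oppr_gt0 => /(_ a1); rewrite normrN.
    apply: le_trans; rewrite le_eqVlt; apply/orP; left; apply/eqP; congr (mu _).
    by apply/seteqP; split => t /=; lra.
  exact: H.
rewrite gtr0_norm//.
have -> : [set t : R | (c <= a * t + b <= c + d)%R] = `[(c - b) / a, (c - b) / a + d / a]%classic.
  apply/seteqP; split => t /=; rewrite in_itv/= -mulrDl ler_pdivrMr// ler_pdivlMr//; lra.
rewrite [leLHS]lebesgue_measure_itv/= lte_fin; case: ifP => _.
  by rewrite -EFinB lee_fin; lra.
by rewrite lee_fin divr_ge0// ltW.
Qed.

Let strip_section1 (M : R) (e : R * R) (c d : R) (x : R) : e.2 != 0 -> 0 <= d ->
  (mu (xsection (strip M e c d : set (plane R)) x) <=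
     (d / `|e.2| * \1_(`[- M, M]) x)%:E)%E.
Proof.
move=> e20 d0; rewrite indicE; have [xM|xM] := boolP (x \in `[- M, M]%classic).
  rewrite mulr1; apply: le_trans (lebesgue_slab (e.1 * x) c e20 d0).
  apply: le_measure; rewrite ?inE.
  - by apply: measurable_xsection; exact: measurable_strip.
  - have -> : [set t | c <= e.2 * t + e.1 * x <= c + d] =
      [set t | c <= e.2 * t + e.1 * x] `&` [set t | e.2 * t + e.1 * x <= c + d].
      by apply/seteqP; split => t /=; [case/andP|case=> -> ->].
    have m : measurable_fun [set: R] (fun t : R => e.2 * t + e.1 * x).
      by apply: measurable_funD; [exact: mulrl_measurable|exact: measurable_cst].
    apply: measurableI; rewrite -[X in measurable X]setTI.
      have := measurable_fun_ler (measurable_cst c) m measurableT (_ : measurable [set true]).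
      exact.
    have := measurable_fun_ler m (measurable_cst (c + d)) measurableT (_ : measurable [set true]).
    exact.
  - by move=> t; rewrite /xsection/= inE => -[_ _ /=]; rewrite /dotp/= addrC.
rewrite mulr0 (_ : xsection _ _ = set0) ?measure0//.
apply/seteqP; split => // t; rewrite /xsection/= inE => -[/= h _ _].
by move: xM; rewrite notin_setE /= in_itv/= -ler_norml.
Qed.

Let strip_section2 (M : R) (e : R * R) (c d : R) (y : R) : e.1 != 0 -> 0 <= d ->
  (mu (ysection (strip M e c d : set (plane R)) y) <=
     (d / `|e.1| * \1_(`[- M, M]) y)%:E)%E.
Proof.
move=> e10 d0; apply: le_trans (@strip_section1 M (e.2, e.1) c d y e10 d0).
apply: le_measure; rewrite ?inE.
- by apply: measurable_ysection; exact: measurable_strip.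
- by apply: measurable_xsection; exact: measurable_strip.
- move=> t; rewrite /xsection/ysection/= !inE => -[/= h1 h2 h3]; split => //=.
  by move: h3; rewrite /dotp/= addrC.
Qed.

Let integral_indic_itv (M k : R) : 0 <= M -> 0 <= k ->
  (\int[mu]_x (k * \1_(`[- M, M]) x)%:E = (k * (2 * M))%:E)%E.
Proof.
move=> M0 k0; under eq_integral do rewrite EFinM.
rewrite ge0_integralZl_EFin//; last by apply/measurable_EFinP/measurable_indic.
rewrite integral_indic// setIT [X in (_ * X)%E]lebesgue_measure_itv/= lte_fin EFinM; congr (_ * _)%E.
case: ifP => h; first by rewrite -EFinB; congr EFin; ring.
have -> : M = 0 by apply/eqP; rewrite eq_le M0 andbT leNgt; apply/negP => M1; move: h; lra.
by rewrite mulr0.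
Qed.

(** Fix the coordinate in which [e] is smaller. Every section is then an interval of length at most
    [d / |k|], with [k] the larger component of [e], over a segment of length [2 * M]; the norm of
    [e] is at most [2 |k|]. *)
Lemma leb2_strip (M : R) (e : R * R) (c d : R) : 0 <= M -> 0 <= d -> e != 0 ->
  (leb2 R (strip M e c d) <= (4 * M * d / enorm e)%:E)%E.
Proof.
move=> M0 d0 e0; have e_gt0 := enorm_gt0 e0.
have le_half (k : R) : enorm e <= 2 * `|k| -> k != 0 /\ d / `|k| * (2 * M) <= 4 * M * d / enorm e.
  move=> ek; have k0 : 0 < `|k| by lra.
  split; first by rewrite -normr_gt0.
  have -> : d / `|k| * (2 * M) = (2 * M * d) / `|k| by ring.
  rewrite ler_pdivrMr// [leRHS]mulrAC ler_pdivlMr//.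
  have -> : 4 * M * d * `|k| = 2 * M * d * (2 * `|k|) by ring.
  by apply: ler_wpM2l => //; rewrite mulr_ge0// mulr_ge0.
have h12 := enorm_le_sum e.
have mS := measurable_strip M e c d.
have [h|h] := leP (`|e.1|) (`|e.2|).
  have [k0 kle] := le_half e.2 ltac:(lra).
  apply: (@le_trans _ _ (\int[mu]_x (d / `|e.2| * \1_(`[- M, M]) x)%:E)%E); last first.
    by rewrite integral_indic_itv ?lee_fin// divr_ge0.
  apply: ge0_le_integral => //.
  - exact: measurable_fun_xsection.
  - apply/measurable_EFinP; apply: measurable_funM; first exact: measurable_cst.
    exact: measurable_indic.
  - by move=> x _; exact: strip_section1.
have [k0 kle] := le_half e.1 ltac:(lra).
have -> : leb2 R (strip M e c d) = (\int[mu]_y mu (ysection (strip M e c d : set (plane R)) y))%E.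
  have := @indic_fubini_tonelli _ _ _ _ R mu mu (strip M e c d : set (plane R)) mS.
  by rewrite indic_fubini_tonelli_FE// indic_fubini_tonelli_GE.
apply: (@le_trans _ _ (\int[mu]_x (d / `|e.1| * \1_(`[- M, M]) x)%:E)%E); last first.
  by rewrite integral_indic_itv ?lee_fin// divr_ge0.
apply: ge0_le_integral => //.
- exact: measurable_fun_ysection.
- apply/measurable_EFinP; apply: measurable_funM; first exact: measurable_cst.
  exact: measurable_indic.
- by move=> x _; exact: strip_section2.
Qed.

End Plane.

(** * Lattices and periodic integrals *)

Section Lattice.
Variables (R : realType) (l1 l2 : R * R).
Hypothesis hl : linindep l1 l2.
Implicit Types (x y z k : R * R) (p q : int * int).
Notation lattice := (lattice l1 l2).
Notation tdist := (tdist l1 l2).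
Notation fund_dom := (fund_dom l1 l2).

Definition ldet : R := l1.1 * l2.2 - l1.2 * l2.1.
Definition ca x : R := (x.1 * l2.2 - x.2 * l2.1) / ldet.
Definition cb x : R := (l1.1 * x.2 - l1.2 * x.1) / ldet.

Lemma ldet_neq0 : ldet != 0.
Proof.
apply/eqP => d0.
have [h1 h2] : l2.2 = 0 /\ - l1.2 = 0.
  apply: hl; rewrite /scale2; congr pair => /=; move: d0; rewrite /ldet; lra.
have [h3 h4] : - l2.1 = 0 /\ l1.1 = 0.
  apply: hl; rewrite /scale2; congr pair => /=; move: d0; rewrite /ldet; lra.
have [] : (1 : R) = 0 /\ (1 : R) = 0; last by move=> /eqP; rewrite oner_eq0.
apply: hl; rewrite /scale2 !mul1r; congr pair => /=; lra.
Qed.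

Lemma coordE x : x = scale2 (ca x) l1 + scale2 (cb x) l2.
Proof.
case: x => x1 x2; rewrite /ca /cb /scale2; congr pair => /=;
  by have := ldet_neq0; rewrite /ldet => h; field; rewrite h.
Qed.

Lemma ca_coord (a b : R) : ca (scale2 a l1 + scale2 b l2) = a.
Proof. by rewrite /ca /= /ldet; have := ldet_neq0; rewrite /ldet => h; field; rewrite h. Qed.

Lemma cb_coord (a b : R) : cb (scale2 a l1 + scale2 b l2) = b.
Proof. by rewrite /cb /= /ldet; have := ldet_neq0; rewrite /ldet => h; field; rewrite h. Qed.

Lemma caD x y : ca (x + y) = ca x + ca y. Proof. by rewrite /ca /=; ring. Qed.
Lemma cbD x y : cb (x + y) = cb x + cb y. Proof. by rewrite /cb /=; ring. Qed.
Lemma caN x : ca (- x) = - ca x. Proof. by rewrite /ca /=; ring. Qed.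
Lemma cbN x : cb (- x) = - cb x. Proof. by rewrite /cb /=; ring. Qed.

Definition lat p : R * R := l1 *~ p.1 + l2 *~ p.2.

Lemma latE p : lat p = scale2 p.1%:~R l1 + scale2 p.2%:~R l2.
Proof.
have H (u : R * R) (m : int) : u *~ m = scale2 m%:~R u.
  rewrite /scale2 !mulrzl; rewrite [LHS]surjective_pairing.
  by congr pair; [exact: (raddfMz fst)|exact: (raddfMz snd)].
by rewrite /lat !H.
Qed.

Lemma latticeE k : lattice k <-> exists p, k = lat p.
Proof. by split => [[m [n ->]]|[[m n] ->]]; [exists (m, n)|exists m, n]. Qed.

Lemma lat_lattice p : lattice (lat p). Proof. by apply/latticeE; exists p. Qed.

Lemma latD p q : lat (p + q) = lat p + lat q.
Proof. by rewrite !latE /scale2 /= !intrD; congr pair => /=; ring. Qed.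

Lemma latN p : lat (- p) = - lat p.
Proof. by rewrite !latE /scale2 /= !intrN; congr pair => /=; ring. Qed.

Lemma lat0 : lat 0 = 0.
Proof. by rewrite latE /scale2 /= !mul0r addr0. Qed.

Lemma ca_lat p : ca (lat p) = p.1%:~R. Proof. by rewrite latE ca_coord. Qed.
Lemma cb_lat p : cb (lat p) = p.2%:~R. Proof. by rewrite latE cb_coord. Qed.

Lemma lat_inj p q : lat p = lat q -> p = q.
Proof.
move=> h; have := congr1 ca h; have := congr1 cb h; rewrite !ca_lat !cb_lat.
move=> /eqP; rewrite eqr_int => /eqP h2 /eqP; rewrite eqr_int => /eqP h1.
by rewrite [p]surjective_pairing h1 h2 -surjective_pairing.
Qed.

Lemma lattice0 : lattice 0. Proof. by rewrite -lat0; exact: lat_lattice. Qed.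

Lemma latticeD x y : lattice x -> lattice y -> lattice (x + y).
Proof. by move=> /latticeE[p ->] /latticeE[q ->]; rewrite -latD; exact: lat_lattice. Qed.

Lemma latticeN x : lattice x -> lattice (- x).
Proof. by move=> /latticeE[p ->]; rewrite -latN; exact: lat_lattice. Qed.

Lemma latticeB x y : lattice x -> lattice y -> lattice (x - y).
Proof. by move=> hx hy; apply: latticeD => //; exact: latticeN. Qed.

(** Cramer's rule and the Cauchy-Schwarz inequality bound the lattice coordinates of [x] by this
    constant times the norm of [x]. *)
Definition lK : R := (enorm l1 + enorm l2) / `|ldet| + 1.

Lemma lK_gt0 : 0 < lK.
Proof. by rewrite ltr_wpDl// divr_ge0// addr_ge0 ?enorm_ge0. Qed.

Lemma ca_le x : `|ca x| <= lK * enorm x.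
Proof.
rewrite /ca normrM normfV.
have := dotp_le x (l2.2, - l2.1); rewrite /dotp/= mulrN => h.
have e2 : enorm (l2.2, - l2.1) = enorm l2 by rewrite /enorm/= sqrrN addrC.
rewrite e2 in h; have d0 : 0 < `|ldet| by rewrite normr_gt0 ldet_neq0.
rewrite ler_pdivrMr//; apply: (le_trans h).
rewrite mulrC -mulrA [_ * `|ldet|]mulrC mulrA.
apply: ler_wpM2r; first exact: enorm_ge0.
rewrite /lK mulrDl mulfVK ?gt_eqF// mul1r.
by have := enorm_ge0 l1; lra.
Qed.

Lemma cb_le x : `|cb x| <= lK * enorm x.
Proof.
rewrite /cb normrM normfV.
have := dotp_le (- l1.2, l1.1) x; rewrite /dotp/= mulNr addrC => h.
have e2 : enorm (- l1.2, l1.1) = enorm l1 by rewrite /enorm/= sqrrN addrC.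
rewrite e2 in h; have d0 : 0 < `|ldet| by rewrite normr_gt0 ldet_neq0.
rewrite ler_pdivrMr//; apply: (le_trans h).
rewrite -[leRHS]mulrA [_ * `|ldet|]mulrC mulrA.
apply: ler_wpM2r; first exact: enorm_ge0.
rewrite /lK mulrDl mulfVK ?gt_eqF// mul1r.
by have := enorm_ge0 l2; lra.
Qed.

(** One of the two integer coordinates is nonzero, hence at least 1 in absolute value, and
    coordinates are bounded by [lK] times the norm. *)
Lemma lattice_min k : lattice k -> k != 0 -> 1 / lK <= enorm k.
Proof.
move=> /latticeE[p ->] p0; rewrite ler_pdivrMr ?lK_gt0// mulrC.
have [h|h] : p.1 != 0 \/ p.2 != 0.
- have [h1|h1] := eqVneq p.1 0; [right|by left].
  apply/eqP => h2; move: p0; rewrite (_ : p = 0) ?lat0 ?eqxx//.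
  by rewrite [p]surjective_pairing h1 h2.
- apply: le_trans (ca_le _); rewrite ca_lat -intr_norm -[1]/(1%:~R) ler_int.
  by rewrite -gtz0_ge1 normr_gt0.
- apply: le_trans (cb_le _); rewrite cb_lat -intr_norm -[1]/(1%:~R) ler_int.
  by rewrite -gtz0_ge1 normr_gt0.
Qed.

Definition lfl x : int * int := (Num.floor (ca x), Num.floor (cb x)).

Lemma fund_domE x : fund_dom x <-> (0 <= ca x < 1) /\ (0 <= cb x < 1).
Proof.
split => [[a [b [ha hb ->]]]|[ha hb]]; first by rewrite ca_coord cb_coord.
by exists (ca x), (cb x); split => //; exact: coordE.
Qed.

Lemma lfl_fund x : fund_dom (x - lat (lfl x)).
Proof.
apply/fund_domE; rewrite caD cbD caN cbN ca_lat cb_lat /lfl/=.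
have := floor_itv (ca x); have := floor_itv (cb x); rewrite !intrD.
by move=> /andP[h1 h2] /andP[h3 h4]; split; apply/andP; split; lra.
Qed.

Lemma fund_uniq x p q : fund_dom (x - lat p) -> fund_dom (x - lat q) -> p = q.
Proof.
move=> /fund_domE + /fund_domE; rewrite !caD !cbD !caN !cbN !ca_lat !cb_lat.
move=> [/andP[a1 a2] /andP[b1 b2]] [/andP[c1 c2] /andP[d1 d2]].
have H (u : R) (m n : int) : 0 <= u - m%:~R -> u - m%:~R < 1 -> 0 <= u - n%:~R -> u - n%:~R < 1 -> m = n.
  move=> h1 h2 h3 h4; transitivity (Num.floor u); [apply/esym|]; apply: floor_def;
    by rewrite intrD; apply/andP; split; lra.
by rewrite [p]surjective_pairing [q]surjective_pairing (H (ca x) p.1 q.1)// (H (cb x) p.2 q.2).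
Qed.

(** It bounds the norm on the fundamental domain, hence every torus distance, and serves as the
    universal bound on the radius of a Voronoi polygon. *)
Definition lR : R := enorm l1 + enorm l2.

Lemma lR_ge0 : 0 <= lR. Proof. by rewrite addr_ge0 ?enorm_ge0. Qed.

Lemma fund_bounded x : fund_dom x -> enorm x <= lR.
Proof.
move=> [a [b [/andP[a0 a1] /andP[b0 b1] ->]]].
apply: (le_trans (enormD _ _)); rewrite !enorm_scale !ger0_norm// /lR.
by apply: lerD; rewrite ler_piMl ?enorm_ge0// ltW.
Qed.

Definition ordint m (i : 'I_(2 * m).+1) : int := i%:Z - m%:Z.

Lemma ordintP m (n : int) : `|n| <= m%:Z -> exists i : 'I_(2 * m).+1, n = ordint i.
Proof.
move=> h; have [n' nE] : exists n' : nat, n + m%:Z = n'%:Z.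
  by exists (absz (n + m%:Z)); rewrite abszE ger0_norm//; lia.
have n'm : (n' < (2 * m).+1)%N by lia.
by exists (Ordinal n'm); rewrite /ordint /=; lia.
Qed.

Definition latbox m (ij : 'I_(2 * m).+1 * 'I_(2 * m).+1) : int * int := (ordint ij.1, ordint ij.2).

Lemma latbox_exists (M : R) : exists m, forall p, enorm (lat p) <= M ->
  exists ij : 'I_(2 * m).+1 * 'I_(2 * m).+1, p = latbox ij.
Proof.
exists (Num.truncn (lK * M)).+1 => p pM.
have H (n : int) : `|n%:~R : R| <= lK * M -> `|n| <= (Num.truncn (lK * M)).+1%:Z.
  move=> h; rewrite -(ler_int R) intr_norm; apply: (le_trans h).
  by apply/ltW; rewrite -pmulrn; exact: truncnS_gt.
have KM : lK * enorm (lat p) <= lK * M by rewrite ler_pM2l// lK_gt0.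
have [|i iE] := @ordintP (Num.truncn (lK * M)).+1 p.1.
  by apply: H; rewrite -ca_lat (le_trans (ca_le _)).
have [|j jE] := @ordintP (Num.truncn (lK * M)).+1 p.2.
  by apply: H; rewrite -cb_lat (le_trans (cb_le _)).
by exists (i, j); rewrite /latbox /= -iE -jE -surjective_pairing.
Qed.

Lemma tdist_le x y k : lattice k -> tdist x y <= enorm (x - y - k).
Proof.
move=> lk; apply: ge_inf; last by exists k.
by exists 0 => _ [? _ <-]; exact: enorm_ge0.
Qed.

Lemma tdist_ge0 x y : 0 <= tdist x y.
Proof.
apply: lb_le_inf; first by exists (enorm (x - y - 0)), 0 => //; exact: lattice0.
by move=> _ [? _ <-]; exact: enorm_ge0.
Qed.

(** Reduction to the fundamental domain gives a competitor of norm at most [lR]. Only finitely many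
    lattice vectors can do better, and the minimum over these is attained. *)
Lemma tdist_ex x y : exists2 k, lattice k & tdist x y = enorm (x - y - k).
Proof.
set d := x - y.
have [m mP] := latbox_exists (lR + enorm d).
have near p : enorm (d - lat p) <= lR -> exists ij : 'I_(2 * m).+1 * 'I_(2 * m).+1, p = latbox ij.
  move=> h; apply: mP; rewrite addrC; have := enorm_triangle d (lat p) 0.
  by rewrite !subr0 enormB => h'; lra.
have [i0 i0E] := near (lfl d) (fund_bounded (lfl_fund d)).
have [i _ imin] := @arg_minP _ _ _ i0 xpredT (fun ij => enorm (d - lat (latbox ij))) isT.
exists (lat (latbox i)); first exact: lat_lattice.
apply/eqP; rewrite eq_le tdist_le ?andTb; last exact: lat_lattice.
apply: lb_le_inf; first by exists (enorm (d - 0)), 0 => //; exact: lattice0.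
move=> _ [k /latticeE[p ->] <-]; rewrite -/d.
have [h|/ltW h] := leP (enorm (d - lat p)) lR.
  by have [j ->] := near p h; exact: imin.
apply: le_trans h; apply: le_trans (imin i0 isT) _.
by rewrite -i0E; exact/fund_bounded/lfl_fund.
Qed.

Lemma tdist_leR x y : tdist x y <= lR.
Proof.
apply: le_trans (tdist_le _ _ (lat_lattice (lfl (x - y)))) _.
exact/fund_bounded/lfl_fund.
Qed.

Lemma tdist_le_enorm x y : tdist x y <= enorm (x - y).
Proof. by have := tdist_le x y lattice0; rewrite subr0. Qed.

Lemma tdistC x y : tdist x y = tdist y x.
Proof.
suff H u w : tdist u w <= tdist w u by apply/eqP; rewrite eq_le !H.
have [k lk ->] := tdist_ex w u.
apply: le_trans (tdist_le _ _ (latticeN lk)) _.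
rewrite -enormN (_ : - (u - w - - k) = w - u - k)//.
by apply: pair_ext2 => /=; ring.
Qed.

Lemma tdist_triangle z x y : tdist x y <= tdist x z + tdist z y.
Proof.
have [k lk ->] := tdist_ex x z; have [k' lk' ->] := tdist_ex z y.
apply: le_trans (tdist_le _ _ (latticeD lk lk')) _.
apply: le_trans (enormD _ _).
by rewrite (_ : x - y - (k + k') = x - z - k + (z - y - k'))// addrACA -opprD addrA subrK.
Qed.

Lemma tdistDl x y k : lattice k -> tdist (x + k) y = tdist x y.
Proof.
move=> lk.
suff H u k' : lattice k' -> tdist (u + k') y <= tdist u y.
  apply/eqP; rewrite eq_le H//=; have := H (x + k) (- k) (latticeN lk).
  by rewrite addrK.
move=> lk'; have [j lj ->] := tdist_ex u y.
apply: le_trans (tdist_le _ _ (latticeD lj lk')) _.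
rewrite (_ : u + k' - y - (j + k') = u - y - j)//.
by apply: pair_ext2 => /=; ring.
Qed.

Lemma tdist_lip x y z : `|tdist x z - tdist y z| <= enorm (x - y).
Proof.
have h1 := tdist_triangle y x z; have h2 := tdist_triangle x y z.
have h3 := tdist_le_enorm x y; rewrite (tdistC y x) in h2.
by rewrite ler_norml; lra.
Qed.

Lemma tdistxx x : tdist x x = 0.
Proof.
apply/eqP; rewrite eq_le tdist_ge0 andbT; apply: le_trans (tdist_le_enorm _ _) _.
by rewrite subrr enorm0.
Qed.

Lemma tdist_eq0 x y : tdist x y = 0 -> same_point l1 l2 x y.
Proof.
have [k lk ->] := tdist_ex x y; move=> /enorm_eq0/eqP; rewrite subr_eq0 => /eqP h.
by rewrite /same_point h.
Qed.

Lemma measurable_ca : measurable_fun [set: plane R] (ca : plane R -> R).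
Proof.
apply: measurable_funM; last exact: measurable_cst.
by apply: measurable_funB; apply: measurable_funM;
  [exact: measurable_pfst|exact: measurable_cst|exact: measurable_psnd|exact: measurable_cst].
Qed.

Lemma measurable_cb : measurable_fun [set: plane R] (cb : plane R -> R).
Proof.
apply: measurable_funM; last exact: measurable_cst.
by apply: measurable_funB; apply: measurable_funM;
  [exact: measurable_cst|exact: measurable_psnd|exact: measurable_cst|exact: measurable_pfst].
Qed.

Lemma measurable_fund_dom : measurable (fund_dom : set (plane R)).
Proof.
have -> : (fund_dom : set (plane R)) = (ca : plane R -> R) @^-1` `[0, 1[ `&` (cb : plane R -> R) @^-1` `[0, 1[.
  by apply/seteqP; split => x /=; rewrite !in_itv/=; [move/fund_domE|move=> ?; apply/fund_domE].
apply: measurableI; rewrite -[X in measurable X]setTI.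
  exact: measurable_ca.
exact: measurable_cb.
Qed.

Lemma fund_dom_lty : (leb2 R fund_dom < +oo)%E.
Proof.
apply: (@leb2_bounded_lty _ _ 0 lR); first exact: measurable_fund_dom.
by move=> z; rewrite subr0; exact: fund_bounded.
Qed.

(** The enumeration of pairs of integers is sealed, so that only its two cancellation laws are
    visible later. *)
Let zenum : {ed : (int * int -> nat) * (nat -> option (int * int)) |
  pcancel ed.1 ed.2 /\ ocancel ed.2 ed.1}.
Proof.
by exists (@pickle (int * int)%type, @pickle_inv (int * int)%type); split;
  [exact: pickleK_inv|exact: pickle_invK].
Qed.

Definition zenc := (sval zenum).1.
Definition zdec := (sval zenum).2.

Lemma zencK p : zdec (zenc p) = Some p. Proof. exact: (svalP zenum).1. Qed.
Lemma zdecK : ocancel zdec zenc. Proof. exact: (svalP zenum).2. Qed.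

Lemma ge0_integral_lattice (G : int * int -> set (plane R)) (f : plane R -> \bar R) :
  (forall p, measurable (G p)) -> (forall p q x, G p x -> G q x -> p = q) ->
  measurable_fun [set: plane R] f -> (forall z, 0 <= f z)%E ->
  (\int[leb2 R]_(x in [set x | exists p, G p x]) f x =
   \sum_(0 <= n <oo) oapp (fun p => \int[leb2 R]_(x in G p) f x) 0 (zdec n))%E.
Proof.
move=> mG dG mf f0.
pose F n : set (plane R) := oapp G set0 (zdec n).
have mF n : measurable (F n) by rewrite /F; case: zdec => /=.
have FE : [set x | exists p, G p x] = \bigcup_n F n.
  apply/seteqP; split => x [p h].
    by exists (zenc p); rewrite ?/F ?zencK.
  by move: h; rewrite /F; case: zdec => // q h; exists q.
have tF : trivIset [set: nat] F.
  apply/trivIsetP => m n _ _ mn; apply/seteqP; split => // x; rewrite /F => -[].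
  have := zdecK m; have := zdecK n.
  case: (zdec m) => [p|//]; case: (zdec n) => [q|//] /= pm qn h1 h2.
  by move: mn; rewrite -pm -qn (dG _ _ _ h1 h2) eqxx.
rewrite FE ge0_integral_bigcup//; last exact: measurable_funTS.
by apply: eq_eseriesr => n _; rewrite /F; case: zdec => //=; rewrite integral_set0.
Qed.

(** Cut the folded set by the translates of [P], and [P] by the translates of the fundamental
    domain. The piece of index [p] on one side is a lattice translate of the piece on the other
    side, and the periodic [f] does not notice the translation. All passages between torus and plane
    rest on this. *)
Lemma integral_unfold (P : set (plane R)) (f : plane R -> \bar R) :
  measurable P -> measurable_fun [set: plane R] f -> (forall z, 0 <= f z)%E ->
  Defs.periodic l1 l2 f ->
  (forall p q (z : plane R), P (tr (- lat p) z) -> P (tr (- lat q) z) -> p = q) ->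
  (\int[leb2 R]_(z in [set z | exists p, P (tr (- lat p)%R z)] `&` fund_dom) f z =
   \int[leb2 R]_(z in P) f z)%E.
Proof.
move=> mP mf f0 pf dP.
pose G p : set (plane R) := shift_set (- lat p) P `&` fund_dom.
pose H p : set (plane R) := P `&` shift_set (lat p) fund_dom.
have mG p : measurable (G p).
  by apply: measurableI; [exact: measurable_shift_set|exact: measurable_fund_dom].
have mH p : measurable (H p).
  by apply: measurableI => //; exact: (measurable_shift_set _ measurable_fund_dom).
have GE : [set z | exists p, P (tr (- lat p)%R z)] `&` fund_dom = [set x | exists p, G p x].
  by apply/seteqP; split => x; [move=> [[p h] h']; exists p|move=> [p [h h']]; split => //; exists p].
have HE : P = [set x | exists p, H p x].
  apply/seteqP; split => x; last by move=> [p []].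
  move=> Px; exists (- lfl x); split => //; rewrite /shift_set /preimage /= /tr latN.
  exact: lfl_fund.
rewrite GE [in RHS]HE !ge0_integral_lattice//.
- apply: eq_eseriesr => n _; case: zdec => //= p.
  rewrite -(ge0_integral_shift (lat p) (mG p) mf f0).
  have -> : shift_set (lat p) (G p) = H p.
    apply/seteqP; split => x; rewrite /shift_set/preimage/= /G/H => -[h1 h2]; split => //.
      by move: h1; rewrite /shift_set/preimage/tr /= addrK.
    by move: h1; rewrite /shift_set/preimage/tr /= addrK.
  by apply: eq_integral => z _; rewrite /tr pf//; exact: lat_lattice.
- move=> p q x [_ h1] [_ h2].
  have := @fund_uniq x (- p) (- q); rewrite !latN !opprK => /(_ h1 h2) /eqP.
  by rewrite eqr_opp => /eqP.
- by move=> p q x [h1 _] [h2 _]; exact: dP h1 h2.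
Qed.

(** A translate of the fundamental domain is again a fundamental domain, so unfolding applies to
    it. *)
Lemma ge0_integral_fund_shift (f : plane R -> \bar R) (a : R * R) :
  measurable_fun [set: plane R] f -> (forall z, 0 <= f z)%E -> Defs.periodic l1 l2 f ->
  (\int[leb2 R]_(z in fund_dom) f (tr a z) = \int[leb2 R]_(z in fund_dom) f z)%E.
Proof.
move=> mf f0 pf.
have mD := measurable_fund_dom.
have -> : (\int[leb2 R]_(z in fund_dom) f (tr a z) =
  \int[leb2 R]_(z in shift_set (- a)%R fund_dom) f z)%E.
  rewrite -(ge0_integral_shift a (measurable_shift_set _ mD) mf f0).
  rewrite (_ : shift_set a (shift_set (- a) fund_dom) = fund_dom)//.
  by apply/seteqP; split => z; rewrite /shift_set/preimage/= /tr addrK.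
rewrite -integral_unfold//.
- congr (integral _ _ _); apply/seteqP; split => z; first by case.
  move=> Dz; split => //; exists (lfl (z - a)).
  rewrite /shift_set/preimage/= /tr addrAC; exact: lfl_fund.
- exact: measurable_shift_set.
- move=> p q z; rewrite /shift_set/preimage/= /tr !(addrAC _ _ (- a)).
  exact: fund_uniq.
Qed.

Lemma measurable_tdist y : measurable_fun [set: plane R] ((fun x => tdist x y) : plane R -> R).
Proof. by apply: (@measurable_lip _ 1) => x z; rewrite mul1r; exact: tdist_lip. Qed.

Lemma small_box_unfold : exists2 s : R, 0 < s & forall (c : R * R) r p q (z : plane R),
  r <= s -> box c r (tr (- lat p) z) -> box c r (tr (- lat q) z) -> p = q.
Proof.
(* A point of the box is within [2 * r] of its centre. Two lattice translates in one box therefore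
   differ by at most [4 * s], which is less than the lower bound [1 / lK] for nonzero lattice
   vectors. *)
exists (1 / lK / 5); first by rewrite divr_gt0// divr_gt0// lK_gt0.
move=> c r p q z rs /enorm_box h1 /enorm_box h2.
apply: lat_inj; apply/eqP; rewrite -subr_eq0; apply/negPn/negP => n0.
have := lattice_min (latticeB (lat_lattice p) (lat_lattice q)) n0.
have -> : lat p - lat q = (tr (- lat q) z - c) - (tr (- lat p) z - c).
  by apply: pair_ext2 => /=; ring.
move=> h; have := enorm_triangle 0 (tr (- lat q) z - c) (tr (- lat p) z - c).
rewrite subr0 sub0r enormN.
have : 0 < 1 / lK by rewrite divr_gt0// lK_gt0.
lra.
Qed.

End Lattice.

Ltac vring := apply: pair_ext2 => /=; ring.

(** * Voronoi cells *)

Section Negligible.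
Variable R : realType.
Notation leb := (leb2 R).
Implicit Types (e a b z : R * R).

Lemma negl_sub (A B : set (plane R)) : A `<=` B -> leb.-negligible B -> leb.-negligible A.
Proof. by move=> AB [C [mC C0 BC]]; exists C; split => //; exact: subset_trans BC. Qed.

Lemma negl_bigcup_pair (G : int * int -> set (plane R)) :
  (forall p, leb.-negligible (G p)) -> leb.-negligible [set z | exists p, G p z].
Proof.
move=> nG; apply: (@negl_sub _ (\bigcup_n oapp G set0 (zdec n))).
  by move=> z [p h]; exists (zenc p) => //; rewrite zencK.
apply: negligible_bigcup => n; case: (zdec n) => //=.
exact: negligible_set0.
Qed.

Lemma negl_bigcup_ord (I : finType) (G : I -> set (plane R)) :
  (forall i, leb.-negligible (G i)) -> leb.-negligible [set z | exists i, G i z].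
Proof.
move=> nG; apply: (@negl_sub _ (\big[setU/set0]_(i <- index_enum I) G i)).
  move=> z [i h]; rewrite -bigcup_seq; exists i => //=; exact: mem_index_enum.
elim: (index_enum I) => [|i s IH]; first by rewrite big_nil; exact: negligible_set0.
by rewrite big_cons; exact: negligibleU.
Qed.

(** The line is exhausted by strips of width 0. *)
Lemma negl_line e (c : R) : e != 0 -> leb.-negligible [set z : plane R | dotp e z = c].
Proof.
move=> e0.
apply: (@negl_sub _ (\bigcup_n (strip n%:R e c 0 : set (plane R)))).
  move=> z /= zc; exists (Num.truncn (enorm z)).+1 => //.
  have h : enorm z <= (Num.truncn (enorm z)).+1%:R by exact/ltW/truncnS_gt.
  split; [exact: le_trans (enorm_fst z) h|exact: le_trans (enorm_snd z) h|].
  by rewrite addr0 zc lexx.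
apply: negligible_bigcup => n; apply/negligibleP; first exact: measurable_strip.
apply/eqP; rewrite -measure_le0; apply: le_trans (leb2_strip _ (ler0n _ n) (lexx 0) e0) _.
by rewrite mulr0 mul0r.
Qed.

Lemma negl_bisector a b : a != b ->
  leb.-negligible [set z : plane R | enorm ((z : R * R) - a) = enorm ((z : R * R) - b)].
Proof.
move=> ab; apply: (@negl_sub _ [set z : plane R | dotp (b - a) z = (enorm b ^+ 2 - enorm a ^+ 2) / 2]).
  move=> z /= h; have := congr1 (fun t => t ^+ 2) h; rewrite /= !enorm_sqB /dotp /=; lra.
by apply: negl_line; rewrite subr_eq0 eq_sym.
Qed.

Lemma integral_eq_negl (A B : set (plane R)) (f : plane R -> \bar R) :
  measurable A -> measurable B -> A `<=` B -> leb.-negligible (B `\` A) ->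
  measurable_fun [set: plane R] f -> (forall z, 0 <= f z)%E ->
  (\int[leb]_(z in A) f z = \int[leb]_(z in B) f z)%E.
Proof.
move=> mA mB AB nBA mf f0.
have mN : measurable (B `\` A) by exact: measurableD.
rewrite [RHS](@ge0_negligible_integral _ _ _ _ _ (B `\` A))//; last 2 first.
- exact: measurable_funTS.
- exact: measure_negligible.
by rewrite setDD setIC setIidl.
Qed.

End Negligible.

Section Voronoi.
Variables (R : realType) (l1 l2 : R * R).
Hypothesis hl : linindep l1 l2.
Variable N : nat.
Implicit Types (x y z k : R * R) (p q : int * int) (X Y : 'I_N -> R * R) (i j : 'I_N).
Notation leb := (leb2 R).
Notation lattice := (lattice l1 l2).
Notation tdist := (tdist l1 l2).
Notation fund_dom := (fund_dom l1 l2).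
Notation polygon := (polygon l1 l2).
Notation cell := (cell l1 l2).
Notation distinct := (distinct l1 l2).
Notation lat := (lat l1 l2).
Notation lR := (lR l1 l2).

Lemma polygonP X i y : polygon X i y <-> forall j, enorm (y - X i) <= tdist y (X j).
Proof.
split => [H j|H j k lk]; last exact: le_trans (H j) (tdist_le _ _ lk).
by have [k lk ->] := tdist_ex hl y (X j); exact: H.
Qed.

Lemma polygon_tdist X i y : polygon X i y -> tdist y (X i) = enorm (y - X i).
Proof. by move=> /polygonP /(_ i) h; apply/eqP; rewrite eq_le h tdist_le_enorm. Qed.

Lemma measurable_dist_to x : measurable_fun [set: plane R] ((fun z => enorm ((z : R * R) - x)) : plane R -> R).
Proof.
apply: (@measurable_lip _ 1) => z w; rewrite mul1r.
by apply: le_trans (enorm_sub_le _ _) _; rewrite opprB addrA subrK.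
Qed.

Lemma measurable_le_set (f g : plane R -> R) : measurable_fun [set: plane R] f ->
  measurable_fun [set: plane R] g -> measurable [set z | f z <= g z].
Proof.
move=> mf mg; have := measurable_fun_ler mf mg measurableT (_ : measurable [set true]).
by rewrite setTI; apply.
Qed.

Lemma measurable_lt_set (f g : plane R -> R) : measurable_fun [set: plane R] f ->
  measurable_fun [set: plane R] g -> measurable [set z | f z < g z].
Proof.
move=> mf mg; have := measurable_fun_ltr mf mg measurableT (_ : measurable [set true]).
by rewrite setTI; apply.
Qed.

Lemma measurable_forall (I : finType) (A : I -> set (plane R)) : (forall c, measurable (A c)) ->
  measurable [set z | forall c, A c z].
Proof.
move=> mA; have -> : [set z | forall c, A c z] = \bigcap_(c in [set: I]) A c.
  by apply/seteqP; split => z h c; [move=> _; exact: h|exact: h].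
by apply: fin_bigcap_measurable => //; exact: finite_finset.
Qed.

Lemma measurable_imply (b : bool) (A : set (plane R)) : measurable A ->
  measurable [set z | b -> A z].
Proof.
move=> mA; case: b; last by rewrite (_ : [set _ | _] = setT)//; apply/seteqP.
by rewrite (_ : [set _ | _] = A)//; apply/seteqP; split => z; [apply|move=> ? _].
Qed.

Lemma measurable_polygon X i : measurable (polygon X i : set (plane R)).
Proof.
have -> : (polygon X i : set (plane R)) = [set z | forall j, enorm ((z : R * R) - X i) <= tdist z (X j)].
  by apply/seteqP; split => z /polygonP.
apply: measurable_forall => j; apply: measurable_le_set; first exact: measurable_dist_to.
exact: measurable_tdist.
Qed.

Lemma measurable_cell X i : measurable (cell X i : set (plane R)).
Proof.
apply: (@measurable_forall _ (fun j => [set z : plane R | j != i -> tdist z (X i) < tdist z (X j)])) => j.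
by apply: measurable_imply; apply: measurable_lt_set; exact: measurable_tdist.
Qed.

(** Strictness also against the lattice copies of the generator itself makes the lattice translates
    of this set pairwise disjoint, as unfolding requires. *)
Definition open_polygon X i : set (plane R) :=
  [set y | (forall j, j != i -> enorm ((y : R * R) - X i) < tdist y (X j)) /\
           (forall p, p != 0 -> enorm ((y : R * R) - X i) < enorm ((y : R * R) - X i - lat p))].

Lemma measurable_open_polygon X i : measurable (open_polygon X i).
Proof.
have md := measurable_dist_to.
pose A : set (plane R) := [set y | forall j, j != i -> enorm ((y : R * R) - X i) < tdist y (X j)].
pose B p : set (plane R) := [set y | p != 0 -> enorm ((y : R * R) - X i) < enorm ((y : R * R) - (X i + lat p))].
have -> : open_polygon X i = A `&` ~` (\bigcup_p ~` B p).
  apply/seteqP; split => z [h1 h2]; split => //.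
    by move=> [p _]; apply => p0; rewrite opprD addrA; exact: h2.
  move=> p p0; rewrite ltNge; apply/negP => h'; apply: h2; exists p => // /(_ p0).
  by rewrite opprD addrA ltNge h'.
apply: measurableI.
  apply: (@measurable_forall _ (fun j => [set y : plane R | j != i -> enorm ((y : R * R) - X i) < tdist y (X j)])) => j.
  by apply: measurable_imply; apply: measurable_lt_set; [exact: md|exact: measurable_tdist].
apply: measurableC; apply: countable_bigcupT_measurable; first exact: countableP.
by move=> p; apply: measurableC; apply: measurable_imply; exact: measurable_lt_set.
Qed.

Lemma open_polygon_sub X i : open_polygon X i `<=` polygon X i.
Proof.
move=> y [h1 h2]; apply/polygonP => j; have [->|ji] := eqVneq j i; last exact/ltW/h1.
have [k /latticeE[p ->] ->] := tdist_ex hl y (X i).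
by have [->|p0] := eqVneq p 0; [rewrite lat0 subr0|exact/ltW/h2].
Qed.

Lemma lat_eq0 p : lat p = 0 -> p = 0.
Proof. by rewrite -(lat0 l1 l2); exact: lat_inj. Qed.

Lemma polygon_negl X i : distinct X -> leb.-negligible ((polygon X i : set (plane R)) `\` open_polygon X i).
Proof.
move=> dX.
apply: (@negl_sub _ _ [set z : plane R | exists j, [set z : plane R | exists p, [set z : plane R |
    X i != X j + lat p /\ enorm ((z : R * R) - X i) = enorm ((z : R * R) - (X j + lat p))] z] z]).
  move=> y [/polygonP Py NSy]; apply: contrapT => H; apply: NSy; split.
    move=> j ji; rewrite lt_neqAle Py andbT; apply/eqP => E; apply: H; exists j.
    have [k /latticeE[p ->] kE] := tdist_ex hl y (X j); exists p; split.
      apply/eqP => E'; apply: (dX i j); first by rewrite eq_sym.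
      by rewrite /same_point E' addrAC subrr add0r; exact: lat_lattice.
    by rewrite E kE; congr enorm; vring.
  move=> p p0; rewrite lt_neqAle; apply/andP; split; last first.
    by apply: le_trans (Py i) _; apply: tdist_le; exact: lat_lattice.
  apply/eqP => E; apply: H; exists i, p; split; last by rewrite E; congr enorm; vring.
  apply/eqP => E'; move/eqP: p0; apply; apply: lat_eq0; apply: (addrI (X i)).
  by rewrite addr0.
apply: negl_bigcup_ord => j; apply: negl_bigcup_pair => p.
have [E|E] := eqVneq (X i) (X j + lat p).
  by apply: (@negl_sub _ _ set0); [move=> z []|exact: negligible_set0].
by apply: negl_sub (negl_bisector E) => z [].
Qed.

Lemma tr_sub p (z : plane R) x : (tr (- lat p) z : R * R) - x = (z : R * R) - (x + lat p).
Proof. by rewrite /tr; vring. Qed.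

Lemma open_polygon_disj X i p q (z : plane R) :
  open_polygon X i (tr (- lat p) z) -> open_polygon X i (tr (- lat q) z) -> p = q.
Proof.
move=> [_ h1] [_ h2]; apply/eqP; rewrite -subr_eq0; apply/negPn/negP => pq.
have := h2 (p - q) pq; have := h1 (q - p).
rewrite -opprB oppr_eq0 => /(_ pq).
rewrite !latN !latD !latN !tr_sub.
have -> : z - (X i + lat p) - - (lat p - lat q) = z - (X i + lat q) by apply: pair_ext2 => /=; ring.
have -> : z - (X i + lat q) - (lat p - lat q) = z - (X i + lat p) by apply: pair_ext2 => /=; ring.
by move=> a b; have := lt_trans a b; rewrite ltxx.
Qed.

Definition tiling X i : set (plane R) := [set z | exists p, open_polygon X i (tr (- lat p)%R z)].

Lemma measurable_tiling X i : measurable (tiling X i).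
Proof.
have -> : tiling X i = \bigcup_p shift_set (- lat p) (open_polygon X i).
  by apply/seteqP; split => z [p]; [exists p|move=> _ h; exists p].
apply: countable_bigcupT_measurable; first exact: countableP.
by move=> p; exact: (measurable_shift_set _ (measurable_open_polygon X i)).
Qed.

Lemma tdist_tr p (z : plane R) x : tdist (tr (- lat p) z) x = tdist z x.
Proof. by rewrite /tr tdistDl//; apply/latticeN/lat_lattice. Qed.

Lemma tiling_cell X i : tiling X i `<=` cell X i.
Proof.
move=> z [p [h1 h2]] j ji; rewrite -(tdist_tr p z (X i)) -(tdist_tr p z (X j)).
exact: le_lt_trans (tdist_le_enorm _ _ _ _) (h1 j ji).
Qed.

(** A cell tolerates ties between two lattice copies of its own generator, which the orbit of the
    open polygon excludes. Such ties lie on countably many bisectors. *)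
Lemma cell_tiling_negl X i : leb.-negligible ((cell X i : set (plane R)) `\` tiling X i).
Proof.
apply: (@negl_sub _ _ [set z : plane R | exists p, [set z : plane R | exists q, [set z : plane R |
    X i + lat p != X i + lat q /\
    enorm ((z : R * R) - (X i + lat p)) = enorm ((z : R * R) - (X i + lat q))] z] z]).
  move=> z [cz Nz]; apply: contrapT => H; apply: Nz.
  have [k /latticeE[p ->] kE] := tdist_ex hl z (X i); exists p; split.
    by move=> j ji; rewrite tr_sub tdist_tr opprD addrA -kE; exact: cz.
  move=> q q0; rewrite lt_neqAle; apply/andP; split; last first.
    have := tdist_le (z : R * R) (X i) (lat_lattice l1 l2 (p + q)).
    rewrite kE latD tr_sub => h.
    rewrite (_ : z - (X i + lat p) = z - X i - lat p); last by vring.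
    rewrite (_ : z - X i - lat p - lat q = z - X i - (lat p + lat q)) //; vring.
  apply/eqP => E; apply: H; exists p, (p + q); split; last first.
    have E' := E; rewrite !tr_sub in E'; rewrite E' latD; congr enorm; vring.
  rewrite latD; apply/eqP => E'; move/eqP: q0; apply; apply: lat_eq0.
  by apply: (addrI (X i + lat p)); rewrite addr0 [RHS]E'; vring.
apply: negl_bigcup_pair => p; apply: negl_bigcup_pair => q.
have [E|E] := eqVneq (X i + lat p) (X i + lat q).
  by apply: (@negl_sub _ _ set0); [by move=> z /= []|exact: negligible_set0].
by apply: negl_sub (negl_bisector E) => z [].
Qed.

(** From the cell to the orbit of the open polygon, by unfolding to the open polygon, and from there
    to the polygon; the first and the last replacement change a null set. *)
Lemma ge0_integral_cell X i (f : plane R -> \bar R) : distinct X ->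
  measurable_fun [set: plane R] f -> (forall z, 0 <= f z)%E -> Defs.periodic l1 l2 f ->
  (\int[leb]_(z in (cell X i : set (plane R)) `&` fund_dom) f z =
   \int[leb]_(z in (polygon X i : set (plane R))) f z)%E.
Proof.
move=> dX mf f0 pf; have mD := measurable_fund_dom hl.
transitivity (\int[leb]_(z in tiling X i `&` fund_dom) f z)%E.
  apply/esym/integral_eq_negl => //.
  - by apply: measurableI => //; exact: measurable_tiling.
  - by apply: measurableI => //; exact: measurable_cell.
  - by apply: setSI; exact: tiling_cell.
  - by apply: negl_sub (cell_tiling_negl X i) => z [[h1 h2] h3]; split => // h; apply: h3.
transitivity (\int[leb]_(z in open_polygon X i) f z)%E.
  by rewrite -(integral_unfold hl (measurable_open_polygon X i) mf f0 pf (@open_polygon_disj X i)).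
apply: integral_eq_negl => //.
- exact: measurable_open_polygon.
- exact: measurable_polygon.
- exact: open_polygon_sub.
- exact: polygon_negl.
Qed.

(** The seed [lR] of the minimum bounds every torus distance, so for [0 < N] this is the distance
    from [y] to the nearest generator. *)
Definition nd X y : R := \big[Num.min/lR]_(j < N) tdist y (X j).

Lemma nd_le X y j : nd X y <= tdist y (X j).
Proof. exact: bigmin_le_cond. Qed.

Lemma nd_ge0 X y : 0 <= nd X y.
Proof.
rewrite /nd; elim/big_ind : _ => [|a b a0 b0|j _]; first exact: lR_ge0.
  by rewrite le_min a0.
exact: tdist_ge0.
Qed.

Lemma nd_leR X y : nd X y <= lR.
Proof. by rewrite /nd; apply: bigmin_le_id. Qed.

Lemma nd_ex X y : (0 < N)%N -> exists j, nd X y = tdist y (X j).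
Proof.
move=> N0; rewrite /nd (@bigmin_eq_arg _ _ _ _ (Ordinal N0))//; last first.
  by move=> i _; exact: tdist_leR.
by eexists.
Qed.

Lemma nd_lip X y z : `|nd X y - nd X z| <= enorm (y - z).
Proof.
have [N0|N0] := posnP N.
  rewrite /nd; case: N X N0 => // X _; by rewrite !big_ord0 subrr normr0 enorm_ge0.
suff H u w : nd X u <= nd X w + enorm (u - w).
  by have := H y z; have := H z y; rewrite enormB ler_norml; lra.
have [j ->] := nd_ex X w N0; apply: le_trans (nd_le X u j) _.
by have := tdist_lip hl u w (X j); rewrite ler_norml => /andP[_]; lra.
Qed.

Lemma measurable_nd X : measurable_fun [set: plane R] (nd X : plane R -> R).
Proof. by apply: (@measurable_lip _ 1) => y z; rewrite mul1r nd_lip. Qed.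

Lemma nd_per X : Defs.periodic l1 l2 (nd X).
Proof. by move=> y k lk; apply: eq_bigr => j _; rewrite tdistDl. Qed.

Lemma polygon_nd X i y : polygon X i y -> nd X y = enorm (y - X i).
Proof.
move=> Py; apply/eqP; rewrite eq_le; apply/andP; split.
  by apply: le_trans (nd_le X y i) _; exact: tdist_le_enorm.
have [|j ->] := nd_ex X y; first exact: leq_ltn_trans (leq0n i) (ltn_ord i).
by move/polygonP : Py; apply.
Qed.

Lemma cell_nd X i y : cell X i y -> nd X y = tdist y (X i).
Proof.
move=> cy; apply/eqP; rewrite eq_le nd_le /=.
have [|j ->] := nd_ex X y; first exact: leq_ltn_trans (leq0n i) (ltn_ord i).
by have [->|ji] := eqVneq j i; [|exact/ltW/cy].
Qed.

Lemma polygon_bounded X i y : polygon X i y -> enorm (y - X i) <= lR.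
Proof. by move=> /polygon_nd <-; exact: nd_leR. Qed.

Lemma polygon_lty X i : (leb (polygon X i) < +oo)%E.
Proof.
apply: (@leb2_bounded_lty _ _ (X i) lR); first exact: measurable_polygon.
by move=> z; exact: polygon_bounded.
Qed.

Lemma integrable_bounded (A : set (plane R)) (f : plane R -> R) (M : R) :
  measurable A -> (leb A < +oo)%E -> measurable_fun [set: plane R] f ->
  (forall z, A z -> `|f z| <= M) -> leb.-integrable A (EFin \o f).
Proof.
move=> mA fA mf fM; apply: measurable_bounded_integrable => //; first exact: measurable_funTS.
exists M; split; first exact: num_real.
by move=> t Mt z Az /=; apply: le_trans (fM z Az) (ltW Mt).
Qed.

(** Adding a constant reduces identities for bounded signed integrands to nonnegative ones, for
    which unfolding and translation invariance are available. *)
Lemma Rintegral_addM (A : set (plane R)) (f : plane R -> R) (M : R) :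
  measurable A -> (leb A < +oo)%E -> leb.-integrable A (EFin \o f) ->
  \int[leb]_(z in A) f z = \int[leb]_(z in A) (f z + M) - M * fine (leb A).
Proof.
move=> mA fA intf.
have iM : leb.-integrable A (EFin \o cst M).
  apply: (@integrable_bounded _ _ `|M|) => //; exact: measurable_cst.
by rewrite RintegralD// Rintegral_cst// addrK.
Qed.

Lemma cell_fund_lty X i : (leb ((cell X i : set (plane R)) `&` fund_dom) < +oo)%E.
Proof.
apply: le_lt_trans (fund_dom_lty hl); apply: le_measure; rewrite ?inE.
- by apply: measurableI; [exact: measurable_cell|exact: measurable_fund_dom].
- exact: measurable_fund_dom.
- by move=> z [].
Qed.

Lemma leb2_cell X i : distinct X ->
  leb ((cell X i : set (plane R)) `&` fund_dom) = leb (polygon X i : set (plane R)).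
Proof.
move=> dX; have := @ge0_integral_cell X i (cst 1%E) dX.
rewrite !integral_cst ?mul1e; [|exact: measurable_polygon|]; last first.
  by apply: measurableI; [exact: measurable_cell|exact: measurable_fund_dom].
by apply.
Qed.

Lemma cell_areaE X i : distinct X -> cell_area l1 l2 X i = fine (leb (polygon X i : set (plane R))).
Proof. by move=> dX; rewrite /cell_area leb2_cell. Qed.

Lemma measurable_fun_addM (f : plane R -> R) (M : R) :
  measurable_fun [set: plane R] f -> measurable_fun [set: plane R] (fun z => f z + M).
Proof. by move=> mf; apply: measurable_funD => //; exact: measurable_cst. Qed.

Lemma addM_ge0 (f : plane R -> R) (M : R) z : (forall z, `|f z| <= M) -> 0 <= f z + M.
Proof. by move=> fM; have := fM z; rewrite ler_norml => /andP[h _]; lra. Qed.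

Lemma Rintegral_cell X i (f : R * R -> R) (M : R) : distinct X ->
  measurable_fun [set: plane R] (f : plane R -> R) -> (forall z, `|f z| <= M) ->
  Defs.periodic l1 l2 f ->
  \int[leb]_(z in (cell X i : set (plane R)) `&` fund_dom) f z =
  \int[leb]_(z in (polygon X i : set (plane R))) f z.
Proof.
move=> dX mf fM pf.
have mC : measurable ((cell X i : set (plane R)) `&` fund_dom).
  by apply: measurableI; [exact: measurable_cell|exact: measurable_fund_dom].
have mP := measurable_polygon X i.
rewrite (@Rintegral_addM _ _ M mC (cell_fund_lty X i)); last first.
  exact: (@integrable_bounded _ _ M mC (cell_fund_lty X i)).
rewrite (@Rintegral_addM _ _ M mP (polygon_lty X i)); last first.
  exact: (@integrable_bounded _ _ M mP (polygon_lty X i)).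
rewrite leb2_cell//; congr (_ - _); rewrite /Rintegral; congr fine.
apply: ge0_integral_cell => //.
- by apply/measurable_EFinP; exact: measurable_fun_addM.
- by move=> z; rewrite lee_fin; exact: (@addM_ge0 f).
- by move=> z k lk; rewrite pf.
Qed.

Lemma cell_disj X i j z : cell X i z -> cell X j z -> i = j.
Proof.
move=> ci cj; apply/eqP/negPn/negP => ij.
have h1 := cj i ij; rewrite eq_sym in ij; have := lt_trans h1 (ci j ij).
by rewrite ltxx.
Qed.

(** A point outside all cells is at equal distance from lattice copies of two different generators,
    hence on one of countably many bisectors. *)
Lemma cells_cover_negl X : (0 < N)%N -> distinct X ->
  leb.-negligible [set z : plane R | ~ exists i, cell X i z].
Proof.
move=> N0 dX.
apply: (@negl_sub _ _ [set z : plane R | exists i, [set z : plane R | exists j, [set z : plane R | exists p, [set z : plane R | exists q, [set z : plane R |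
    X i + lat p != X j + lat q /\
    enorm ((z : R * R) - (X i + lat p)) = enorm ((z : R * R) - (X j + lat q))] z] z] z] z]).
  move=> z nz; apply: contrapT => H; apply: nz.
  have [i iE] := nd_ex X z N0; exists i => j ji; rewrite lt_neqAle -iE nd_le andbT.
  apply/eqP => E; apply: H.
  have [k /latticeE[p ->] kE] := tdist_ex hl z (X i).
  have [k' /latticeE[q ->] kE'] := tdist_ex hl z (X j).
  exists i, j, p, q; split.
    apply/eqP => E'; apply: (dX i j); first by rewrite eq_sym.
    rewrite /same_point (_ : X i - X j = lat q - lat p); last first.
      by rewrite (_ : X i = X i + lat p - lat p); [rewrite E'; vring|vring].
    exact/latticeB/lat_lattice/lat_lattice.
  rewrite (_ : z - (X i + lat p) = z - X i - lat p); last by vring.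
  rewrite (_ : z - (X j + lat q) = z - X j - lat q); last by vring.
  by rewrite -kE -kE' -iE.
apply: negl_bigcup_ord => i; apply: negl_bigcup_ord => j.
apply: negl_bigcup_pair => p; apply: negl_bigcup_pair => q.
have [E|E] := eqVneq (X i + lat p) (X j + lat q).
  by apply: (@negl_sub _ _ set0); [by move=> z /= []|exact: negligible_set0].
by apply: negl_sub (negl_bisector E) => z [].
Qed.

Lemma ge0_integral_cells X (f : plane R -> \bar R) : (0 < N)%N -> distinct X ->
  measurable_fun [set: plane R] f -> (forall z, 0 <= f z)%E ->
  (\int[leb]_(z in fund_dom) f z =
   \sum_(i < N) \int[leb]_(z in (cell X i : set (plane R)) `&` fund_dom) f z)%E.
Proof.
move=> N0 dX mf f0; have mD := measurable_fund_dom hl.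
pose C i : set (plane R) := (cell X i : set (plane R)) `&` fund_dom.
have mC i : measurable (C i) by apply: measurableI => //; exact: measurable_cell.
have E : \big[setU/set0]_(i <- index_enum 'I_N) C i = [set z | exists i, C i z].
  rewrite -bigcup_seq; apply/seteqP; split => z; first by move=> [i _ ?]; exists i.
  by move=> [i ?]; exists i => //=; exact: mem_index_enum.
have mU : measurable (\big[setU/set0]_(i <- index_enum 'I_N) C i).
  by apply: bigsetU_measurable => i _; exact: mC.
rewrite -(@ge0_integral_bigsetU _ _ _ leb _ C) ?index_enum_uniq//.
- apply/esym/integral_eq_negl => //.
    by rewrite E => z [i []].
  rewrite E; apply: negl_sub (cells_cover_negl N0 dX) => z [Dz nz] [i ci].
  by apply: nz; exists i.
- by apply/trivIsetP => i j _ _ ij; apply/seteqP; split => // z [[ci _] [cj _]];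
    move: ij; rewrite (cell_disj ci cj) eqxx.
- exact: measurable_funTS.
Qed.

Lemma Rintegral_fund X (f : R * R -> R) (M : R) : (0 < N)%N -> distinct X ->
  measurable_fun [set: plane R] (f : plane R -> R) -> (forall z, `|f z| <= M) ->
  Defs.periodic l1 l2 f ->
  \int[leb]_(z in (fund_dom : set (plane R))) f z =
  \sum_(i < N) \int[leb]_(z in (polygon X i : set (plane R))) f z.
Proof.
move=> N0 dX mf fM pf.
have mD := measurable_fund_dom hl.
have mC i : measurable ((cell X i : set (plane R)) `&` fund_dom).
  by apply: measurableI => //; exact: measurable_cell.
transitivity (\sum_(i < N) \int[leb]_(z in (cell X i : set (plane R)) `&` fund_dom) f z); last first.
  by apply: eq_bigr => i _; apply: (@Rintegral_cell _ _ _ M).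
have H (g : plane R -> R) (K : R) : measurable_fun [set: plane R] g -> (forall z, `|g z| <= K) -> (forall z, 0 <= g z) ->
   \int[leb]_(z in (fund_dom : set (plane R))) g z =
   \sum_(i < N) \int[leb]_(z in (cell X i : set (plane R)) `&` fund_dom) g z.
  move=> mg gK g0; rewrite /Rintegral (@ge0_integral_cells X)//; last exact/measurable_EFinP.
  rewrite sum_fine// => i _; apply: integrable_fin_num => //.
  exact: (@integrable_bounded _ _ K (mC i) (cell_fund_lty X i)).
rewrite (@Rintegral_addM _ _ M mD (fund_dom_lty hl)); last first.
  exact: (@integrable_bounded _ _ M mD (fund_dom_lty hl)).
under [RHS]eq_bigr => i _ do rewrite (@Rintegral_addM _ _ M (mC i) (cell_fund_lty X i)
  (@integrable_bounded _ _ M (mC i) (cell_fund_lty X i) mf (fun z _ => fM z))).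
rewrite big_split /= sumrN -mulr_sumr; congr (_ - _).
  apply: (H _ (`|M| + `|M|)).
  - exact: measurable_fun_addM.
  - move=> z; apply: (le_trans (ler_normD _ _)); rewrite lerD2r.
    exact: le_trans (fM z) (ler_norm _).
  - by move=> z; exact: (@addM_ge0 f).
congr (_ * _).
have := @H (cst 1) 1; rewrite Rintegral_cst// mul1r => ->//; last by move=> z; rewrite normr1.
by apply: eq_bigr => i _; rewrite Rintegral_cst// mul1r.
Qed.

Lemma Rintegral_fund_shift (f : R * R -> R) (M : R) (a : R * R) :
  measurable_fun [set: plane R] (f : plane R -> R) -> (forall z, `|f z| <= M) ->
  Defs.periodic l1 l2 f ->
  \int[leb]_(z in (fund_dom : set (plane R))) f (tr a z) =
  \int[leb]_(z in (fund_dom : set (plane R))) f z.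
Proof.
move=> mf fM pf; have mD := measurable_fund_dom hl.
have mft : measurable_fun [set: plane R] (fun z : plane R => f (tr a z)).
  by apply: (@measurableT_comp _ _ _ _ _ _ (f : plane R -> R)) => //; exact: measurable_shift.
rewrite (@Rintegral_addM _ _ M mD (fund_dom_lty hl)); last first.
  exact: (@integrable_bounded _ _ M mD (fund_dom_lty hl)).
rewrite [RHS](@Rintegral_addM _ _ M mD (fund_dom_lty hl)); last first.
  exact: (@integrable_bounded _ _ M mD (fund_dom_lty hl)).
congr (_ - _); rewrite /Rintegral; congr fine.
apply: (@ge0_integral_fund_shift _ _ _ hl (fun z => (f z + M)%:E)).
- by apply/measurable_EFinP; exact: measurable_fun_addM.
- by move=> z; rewrite lee_fin; exact: (@addM_ge0 f).
- by move=> z k lk; rewrite pf.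
Qed.

End Voronoi.

(** * The quantization energy *)

Section Energy.
Variables (R : realType) (l1 l2 : R * R).
Hypothesis hl : linindep l1 l2.
Variable N : nat.
Hypothesis N0 : (0 < N)%N.
Implicit Types (x y z k e : R * R) (p q : int * int) (X Y : 'I_N -> R * R) (i j : 'I_N).
Notation leb := (leb2 R).
Notation lattice := (lattice l1 l2).
Notation tdist := (tdist l1 l2).
Notation fund_dom := (fund_dom l1 l2 : set (plane R)).
Notation polygon X i := (polygon l1 l2 X i : set (plane R)).
Notation cell := (cell l1 l2).
Notation distinct := (distinct l1 l2).
Notation lat := (lat l1 l2).
Notation lR := (lR l1 l2).
Notation nd := (nd l1 l2).
Notation cell_area := (cell_area l1 l2).
Notation cdisp := (cdisp l1 l2).
Notation quant_energy := (quant_energy l1 l2).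

Definition parea X i : R := fine (leb (polygon X i)).
(** The first moment about the generator, that is, the area times [cdisp]; without the division it
    depends linearly on the cell. *)
Definition mom X i : R * R :=
  (\int[leb]_(y in polygon X i) (y.1 - (X i).1), \int[leb]_(y in polygon X i) (y.2 - (X i).2)).

Lemma parea_ge0 X i : 0 <= parea X i. Proof. exact: fine_ge0. Qed.

Lemma cdispE X i : distinct X -> cdisp X i = scale2 (parea X i)^-1 (mom X i).
Proof. by move=> dX; rewrite /cdisp cell_areaE. Qed.

Lemma poly_int X i (f : plane R -> R) (M : R) : measurable_fun [set: plane R] f ->
  (forall y, polygon X i y -> `|f y| <= M) -> leb.-integrable (polygon X i) (EFin \o f).
Proof.
move=> mf fM; apply: (integrable_bounded _ (polygon_lty hl X i) mf fM).
exact: measurable_polygon.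
Qed.

Lemma fund_int (f : plane R -> R) (M : R) : measurable_fun [set: plane R] f ->
  (forall y, `|f y| <= M) -> leb.-integrable fund_dom (EFin \o f).
Proof.
move=> mf fM; apply: (integrable_bounded _ (fund_dom_lty hl) mf (fun z _ => fM z)).
exact: measurable_fund_dom.
Qed.

Lemma measurable_dot e x : measurable_fun [set: plane R] ((fun y => dotp e ((y : R * R) - x)) : plane R -> R).
Proof.
by apply: measurable_funD; apply: measurable_funM; try exact: measurable_cst;
  apply: measurable_funB; try exact: measurable_cst; [exact: measurable_pfst|exact: measurable_psnd].
Qed.

Lemma poly_dot_le X i e y : polygon X i y -> `|dotp e ((y : R * R) - X i)| <= enorm e * lR.
Proof.
move=> Py; apply: le_trans (dotp_le _ _) _.
by rewrite ler_wpM2l ?enorm_ge0//; exact: (polygon_bounded hl Py).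
Qed.

Lemma poly_int_dot X i e : leb.-integrable (polygon X i) (EFin \o (fun y => dotp e ((y : R * R) - X i))).
Proof. exact: (poly_int (measurable_dot e (X i)) (@poly_dot_le X i e)). Qed.

Lemma poly_int_cst X i (c : R) : leb.-integrable (polygon X i) (EFin \o cst c).
Proof. by apply: (@poly_int _ _ _ `|c|) => //; exact: measurable_cst. Qed.

Lemma Rint_dot X i e : \int[leb]_(y in polygon X i) dotp e ((y : R * R) - X i) = dotp e (mom X i).
Proof.
have mP := measurable_polygon hl X i.
have j1 : leb.-integrable (polygon X i) (EFin \o (fun y : plane R => y.1 - (X i).1)).
  have := poly_int_dot X i (1, 0); apply: eq_integrable => // y _ /=.
  by rewrite /dotp/= mul1r mul0r addr0.
have j2 : leb.-integrable (polygon X i) (EFin \o (fun y : plane R => y.2 - (X i).2)).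
  have := poly_int_dot X i (0, 1); apply: eq_integrable => // y _ /=.
  by rewrite /dotp/= mul1r mul0r add0r.
rewrite /dotp /mom /= -!RintegralZl// -RintegralD//.
  by have := integrableZl mP e.1 j1; apply.
by have := integrableZl mP e.2 j2; apply.
Qed.

Lemma measurable_dist2 x : measurable_fun [set: plane R] ((fun y => enorm ((y : R * R) - x) ^+ 2) : plane R -> R).
Proof. by apply: measurable_funX; exact: measurable_dist_to. Qed.

Lemma measurable_nd2 X : measurable_fun [set: plane R] ((fun y => nd X y ^+ 2) : plane R -> R).
Proof. by apply: measurable_funX; exact: measurable_nd. Qed.

Lemma nd2_le X y : `|nd X y ^+ 2| <= lR ^+ 2.
Proof.
rewrite ger0_norm ?sqr_ge0// ler_pXn2r// ?nnegrE ?nd_ge0 ?lR_ge0//.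
exact: nd_leR.
Qed.

Lemma nd2_per X : Defs.periodic l1 l2 (fun y => nd X y ^+ 2).
Proof. by move=> y k lk; rewrite nd_per. Qed.

Lemma quant_energy_poly X : distinct X ->
  quant_energy X = \sum_(i < N) \int[leb]_(y in polygon X i) (enorm ((y : R * R) - X i) ^+ 2).
Proof.
move=> dX; apply: eq_bigr => i _.
rewrite (@Rintegral_cell _ _ _ hl _ X i (fun x => tdist x (X i) ^+ 2) (lR ^+ 2))//.
- by apply: eq_Rintegral => y; rewrite inE => Py; rewrite (polygon_tdist hl Py).
- by apply: measurable_funX; exact: measurable_tdist.
- move=> z; rewrite ger0_norm ?sqr_ge0// ler_pXn2r// ?nnegrE ?tdist_ge0 ?lR_ge0//.
  exact: tdist_leR.
- by move=> y k lk; rewrite tdistDl.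
Qed.

Lemma quant_energyE X : distinct X ->
  quant_energy X = \int[leb]_(y in fund_dom) (nd X y ^+ 2).
Proof.
move=> dX; rewrite quant_energy_poly// (@Rintegral_fund _ _ _ hl _ X _ (lR ^+ 2))//.
- apply: eq_bigr => i _; apply: eq_Rintegral => y; rewrite inE => Py.
  by rewrite (polygon_nd hl Py).
- exact: measurable_nd2.
- exact: nd2_le.
- exact: nd2_per.
Qed.

Lemma quant_energy_ge0 X : 0 <= quant_energy X.
Proof. by apply: sumr_ge0 => i _; apply: Rintegral_ge0 => y _; exact: sqr_ge0. Qed.

Lemma sum_parea X : distinct X -> \sum_i parea X i = torus_area l1 l2.
Proof.
move=> dX; have := @Rintegral_fund _ _ _ hl _ X (cst 1) 1 N0 dX.
rewrite Rintegral_cst ?mul1r; last exact: measurable_fund_dom.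
rewrite /torus_area => ->//; last by move=> z; rewrite normr1.
by apply: eq_bigr => i _; rewrite Rintegral_cst ?mul1r//; exact: measurable_polygon.
Qed.

(** Measure the energy of [Y] on the partition belonging to [X]: on the polygon of [X i] the nearest
    generator of [Y] is at most as far as [Y i]. Expanding the square of [y - Y i] around [X i]
    gives the three terms. *)
Lemma quant_energy_semiconcave X Y : distinct X -> distinct Y ->
  quant_energy Y <= quant_energy X - 2 * \sum_i dotp (Y i - X i) (mom X i)
     + \sum_i parea X i * enorm (Y i - X i) ^+ 2.
Proof.
move=> dX dY; rewrite (quant_energyE dY) quant_energy_poly//.
rewrite (@Rintegral_fund _ _ _ hl _ X _ (lR ^+ 2))//; last 3 first.
- exact: measurable_nd2.
- exact: nd2_le.
- exact: nd2_per.
rewrite mulr_sumr -sumrB -big_split /=; apply: ler_sum => i _.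
have mP := measurable_polygon hl X i.
have jq : leb.-integrable (polygon X i) (EFin \o (fun y => enorm ((y : R * R) - X i) ^+ 2)).
  apply: (@poly_int X i _ (lR ^+ 2)); first exact: measurable_dist2.
  move=> y Py; rewrite ger0_norm ?sqr_ge0// ler_pXn2r// ?nnegrE ?enorm_ge0 ?lR_ge0//.
  exact: (polygon_bounded hl Py).
have jd := poly_int_dot X i (Y i - X i).
have jd2 := integrableZl mP 2 jd.
have jc := poly_int_cst X i (enorm (Y i - X i) ^+ 2).
have -> : parea X i * enorm (Y i - X i) ^+ 2 =
    \int[leb]_(y in polygon X i) cst (enorm (Y i - X i) ^+ 2) y.
  by rewrite Rintegral_cst// mulrC.
rewrite -Rint_dot -RintegralZl// -RintegralB//; last first.
have jb : leb.-integrable (polygon X i) (EFin \o (fun y =>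
    enorm ((y : R * R) - X i) ^+ 2 - 2 * dotp (Y i - X i) ((y : R * R) - X i))).
  by have := integrableB mP jq jd2; apply.
rewrite -RintegralD//; apply: le_Rintegral => //.
- apply: (@poly_int X i _ (lR ^+ 2)); first exact: measurable_nd2.
  by move=> y _; exact: nd2_le.
- by have := integrableD mP jb jc; apply.
- move=> y Py /=; apply: (@le_trans _ _ (enorm ((y : R * R) - Y i) ^+ 2)).
    rewrite ler_pXn2r// ?nnegrE ?nd_ge0 ?enorm_ge0//.
    exact: le_trans (nd_le _ _ _ _ i) (tdist_le_enorm _ _ _ _).
  rewrite (_ : y - Y i = (y - X i) - (Y i - X i)); last by vring.
  by rewrite enorm_sqB /dotp; lra.
Qed.

(* A substitute for the divergence theorem: with [W = nd X ^ 2], the integral of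
   [h y - h (y + a e)], [h = W (u + M)], vanishes by periodicity, while on the
   cell of [X i] the value [W (y + a e)] is at most the squared distance to the
   same generator [X i]; dividing by [a] and letting [a] tend to 0 gives the
   bound. *)
Lemma drift_coord X e (u : R * R -> R) (L M : R) : distinct X -> enorm e = 1 -> 0 <= L ->
  Defs.periodic l1 l2 u -> (forall y, `|u y| <= M) ->
  (forall y z, `|u y - u z| <= L * enorm (y - z)) ->
  \sum_i \int[leb]_(y in polygon X i) (- (2 * dotp e ((y : R * R) - X i) * u y)) <=
  L * quant_energy X.
Proof.
move=> dX e1 L0 pu uM uL.
have M0 : 0 <= M by exact: le_trans (uM 0).
have mu : measurable_fun [set: plane R] (u : plane R -> R) by exact: measurable_lip uL.
set F := quant_energy X.
suff H (a : R) : 0 < a -> \sum_i \int[leb]_(y in polygon X i) (- (2 * dotp e ((y : R * R) - X i) * u y)) <=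
    L * F + 3 * a * M * torus_area l1 l2.
  apply/ler_addgt0Pr => d d0; pose c := 3 * M * torus_area l1 l2.
  have c0 : 0 <= c by rewrite !mulr_ge0// fine_ge0.
  have c1 : 0 < c + 1 by lra.
  apply: le_trans (H _ (divr_gt0 d0 c1)) _; rewrite lerD2l.
  have -> : 3 * (d / (c + 1)) * M * torus_area l1 l2 = d * (c / (c + 1)).
    by rewrite /c; field; rewrite gt_eqF.
  rewrite -[leRHS]mulr1 ler_pM2l// ler_pdivrMr//; lra.
move=> a0; pose W y := nd X y ^+ 2.
have WM := @nd2_le X; have mW := @measurable_nd2 X; have pW := @nd2_per X.
have W0 y : 0 <= W y by exact: sqr_ge0.
have W1 y : W y <= lR ^+ 2 by exact: le_trans (ler_norm _) (WM y).
pose h y := W y * (u y + M).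
have uM0 y : 0 <= u y + M by have := uM y; rewrite ler_norml; lra.
have uM1 y : u y + M <= 2 * M by have := uM y; rewrite ler_norml; lra.
have hM y : `|h y| <= lR ^+ 2 * (2 * M).
  have hy0 : 0 <= h y by exact: (mulr_ge0 (W0 y) (uM0 y)).
  by rewrite ger0_norm// /h; apply: (ler_pM (W0 y) (uM0 y) (W1 y) (uM1 y)).
have mh : measurable_fun [set: plane R] (h : plane R -> R).
  by apply: measurable_funM => //; exact: measurable_fun_addM.
have ph : Defs.periodic l1 l2 h by move=> y k lk; rewrite /h /W pW// pu.
pose ae := scale2 a e.
have aeN : enorm ae = a by rewrite enorm_scale e1 mulr1 gtr0_norm.
have mtr b (g : plane R -> R) : measurable_fun [set: plane R] g ->
    measurable_fun [set: plane R] (fun y => g (tr b y)).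
  by move=> mg; apply: (@measurableT_comp _ _ _ _ _ _ g) => //; exact: measurable_shift.
have jh := fund_int mh hM; have jht := fund_int (mtr ae _ mh) (fun y => hM _).
have jW := fund_int mW WM; have jWt b := fund_int (mtr b _ mW) (fun y => WM _).
have mD := measurable_fund_dom hl.
(* The shift by [M] makes the factor [u + M] nonnegative but leaves a term [2 * d * M], which the
   backward difference of [W] cancels; by periodicity that difference also integrates to 0. The
   remainder [3 * a * M] collects [a (u + M) <= 2 a M] and the error [a M] of the backward
   difference. *)
pose T y : R := a^-1 * (h y - h (tr ae y)) + L * W (tr ae y) +
   M / a * (W y - W (tr (- ae) y)) + 3 * a * M.
have mT : measurable_fun [set: plane R] (T : plane R -> R).
  apply: measurable_fun_addM; apply: measurable_funD.
    apply: measurable_funD; apply: measurable_funM; try exact: measurable_cst.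
      by apply: measurable_funB => //; exact: (mtr ae _ mh).
    exact: (mtr ae _ mW).
  apply: measurable_funM; first exact: measurable_cst.
  by apply: measurable_funB => //; exact: (mtr _ _ mW).
pose K := a^-1 * (2 * (lR ^+ 2 * (2 * M))) + L * lR ^+ 2 + M / a * (2 * lR ^+ 2) + 3 * a * M.
have TK y : `|T y| <= K.
  have i0 : 0 <= a^-1 by rewrite invr_ge0 ltW.
  apply: le_trans (ler_normD _ _) _; apply: lerD; last first.
    by rewrite ger0_norm// !mulr_ge0// ltW.
  apply: le_trans (ler_normD _ _) _; apply: lerD; last first.
    rewrite normrM ger0_norm ?mulr_ge0//; apply: ler_wpM2l; first by rewrite mulr_ge0.
    apply: le_trans (ler_normB _ _) _; have := WM y; have := WM (tr (- ae) y); rewrite /W; lra.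
  apply: le_trans (ler_normD _ _) _; apply: lerD.
    rewrite normrM ger0_norm//; apply: ler_wpM2l => //.
    by apply: le_trans (ler_normB _ _) _; have := hM y; have := hM (tr ae y); lra.
  rewrite normrM ger0_norm//; apply: ler_wpM2l => //; exact: WM.
have pT : Defs.periodic l1 l2 T.
  move=> y k lk; have E b : tr b (y + k) = (tr b y : R * R) + k by rewrite /tr addrAC.
  have Wk z : W (z + k) = W z by exact: pW.
  have hk z : h (z + k) = h z by exact: ph.
  by rewrite /T !E !hk !Wk.
apply: (@le_trans _ _ (\sum_i \int[leb]_(y in polygon X i) T y)).
  apply: ler_sum => i _; apply: le_Rintegral.
  - exact: measurable_polygon.
  - apply: (@poly_int X i _ (2 * lR * M)).
      apply: measurable_funN; apply: measurable_funM => //.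
      apply: measurable_funM; first exact: measurable_cst.
      exact: measurable_dot.
    move=> y Py; rewrite normrN !normrM.
    apply: ler_pM => //; rewrite ?mulr_ge0// ger0_norm// ler_pM2l//.
    by have := poly_dot_le e Py; rewrite e1 mul1r.
  - by apply: (@poly_int X i _ K) => // y _; exact: TK.
  - move=> y Py.
    have yE : W y = enorm ((y : R * R) - X i) ^+ 2 by rewrite /W (polygon_nd hl Py).
    have wle b : W (tr b y) <= W y + 2 * dotp b ((y : R * R) - X i) + enorm b ^+ 2.
      apply: (@le_trans _ _ (enorm ((tr b y : R * R) - X i) ^+ 2)).
        rewrite ler_pXn2r// ?nnegrE ?nd_ge0 ?enorm_ge0//.
        exact: le_trans (nd_le _ _ _ _ i) (tdist_le_enorm _ _ _ _).
      rewrite (_ : (tr b y : R * R) - X i = (y - X i) + b); last by rewrite /tr; vring.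
      by rewrite enorm_sqD yE /dotp; lra.
    have := wle ae; have := wle (- ae); rewrite enormN aeN.
    have -> : dotp (- ae) ((y : R * R) - X i) = - (a * dotp e ((y : R * R) - X i)).
      by rewrite /dotp/ae/scale2/=; ring.
    have -> : dotp ae ((y : R * R) - X i) = a * dotp e ((y : R * R) - X i).
      by rewrite /dotp/ae/scale2/=; ring.
    set d := dotp e _; move=> h1 h2.
    have h3 : W (tr ae y) * (u (tr ae y) - u y) <= L * a * W (tr ae y).
      rewrite mulrC; apply: ler_wpM2r => //; apply: le_trans (ler_norm _) _.
      apply: le_trans (uL _ _) _; rewrite /tr (_ : y + ae - y = ae) ?aeN//.
      by vring.
    have h4 : (W (tr ae y) - W y - 2 * (a * d) - a ^+ 2) * (u y + M) <= 0.
      by apply: mulr_le0_ge0 => //; lra.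
    rewrite -(ler_pM2l a0) /T /h.
    have -> : a * (a^-1 * (W y * (u y + M) - W (tr ae y) * (u (tr ae y) + M)) +
      L * W (tr ae y) + M / a * (W y - W (tr (- ae) y)) + 3 * a * M) =
      (W y * (u y + M) - W (tr ae y) * (u (tr ae y) + M)) +
      L * a * W (tr ae y) + M * (W y - W (tr (- ae) y)) + 3 * a ^+ 2 * M.
      by field; rewrite gt_eqF.
    have h5 : M * (W (tr (- ae) y) - W y + 2 * (a * d) - a ^+ 2) <= 0.
      by rewrite mulr_ge0_le0//; lra.
    have h6 : a ^+ 2 * (u y + M) <= a ^+ 2 * (2 * M) by rewrite ler_wpM2l// sqr_ge0.
    lra.
rewrite -(@Rintegral_fund _ _ _ hl _ X T K)//.
have jc : leb.-integrable fund_dom (EFin \o cst (3 * a * M)).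
  by apply: (@fund_int _ `|3 * a * M|) => //; exact: measurable_cst.
have jhh : leb.-integrable fund_dom (EFin \o (fun y => h y - h (tr ae y))).
  by have := integrableB mD jh jht; apply.
have jWW : leb.-integrable fund_dom (EFin \o (fun y => W y - W (tr (- ae) y))).
  by have := integrableB mD jW (jWt (- ae)); apply.
have j1 : leb.-integrable fund_dom (EFin \o (fun y => a^-1 * (h y - h (tr ae y)))).
  by have := integrableZl mD a^-1 jhh; apply.
have j2 : leb.-integrable fund_dom (EFin \o (fun y => L * W (tr ae y))).
  by have := integrableZl mD L (jWt ae); apply.
have j3 : leb.-integrable fund_dom (EFin \o (fun y => M / a * (W y - W (tr (- ae) y)))).
  by have := integrableZl mD (M / a) jWW; apply.
have j12 : leb.-integrable fund_dom (EFin \o (fun y => a^-1 * (h y - h (tr ae y)) + L * W (tr ae y))).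
  by have := integrableD mD j1 j2; apply.
have j123 : leb.-integrable fund_dom (EFin \o (fun y => a^-1 * (h y - h (tr ae y)) + L * W (tr ae y)
     + M / a * (W y - W (tr (- ae) y)))).
  by have := integrableD mD j12 j3; apply.
rewrite /T RintegralD// RintegralD// RintegralD// !RintegralZl//; last exact: jWt.
rewrite !RintegralB//; last exact: jWt.
rewrite (@Rintegral_fund_shift _ _ _ hl h (lR ^+ 2 * (2 * M)) ae)//.
rewrite (@Rintegral_fund_shift _ _ _ hl W (lR ^+ 2) ae)//.
rewrite (@Rintegral_fund_shift _ _ _ hl W (lR ^+ 2) (- ae))//.
rewrite !subrr !mulr0 add0r addr0 Rintegral_cst// /F quant_energyE//.
  by rewrite /torus_area mulrA.
by apply: (@fund_int (cst M) `|M|) => //; exact: measurable_cst.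
Qed.

(** Replacing [v (X i)] by [v y] under the integral costs at most [L |y - X i|^2]. Twice the
    left-hand side is then bounded by [2 L F] for this replacement plus [L F] for each coordinate of
    [v]. *)
Lemma drift_bound X (v : R * R -> R * R) (L M : R) : distinct X -> 0 <= L ->
  Defs.periodic l1 l2 v -> (forall y, enorm (v y) <= M) ->
  (forall y z, enorm (v y - v z) <= L * enorm (y - z)) ->
  - (\sum_i dotp (v (X i)) (mom X i)) <= 2 * L * quant_energy X.
Proof.
move=> dX L0 pv vM vL.
have h1 : \sum_i \int[leb]_(y in polygon X i) (- (2 * dotp (1, 0) ((y : R * R) - X i) * (v y).1)) <= L * quant_energy X.
  apply: (@drift_coord _ _ _ L M) => //.
  - by rewrite /enorm/= expr1n expr0n/= addr0 sqrtr1.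
  - by move=> y k lk; rewrite pv.
  - by move=> y; apply: le_trans (enorm_fst _) (vM y).
  - by move=> y z; apply: le_trans (enorm_fst (v y - v z)) (vL y z).
have h2 : \sum_i \int[leb]_(y in polygon X i) (- (2 * dotp (0, 1) ((y : R * R) - X i) * (v y).2)) <= L * quant_energy X.
  apply: (@drift_coord _ _ _ L M) => //.
  - by rewrite /enorm/= expr1n expr0n/= add0r sqrtr1.
  - by move=> y k lk; rewrite pv.
  - by move=> y; apply: le_trans (enorm_snd _) (vM y).
  - by move=> y z; apply: le_trans (enorm_snd (v y - v z)) (vL y z).
suff : 2 * (- (\sum_i dotp (v (X i)) (mom X i))) <= 2 * L * quant_energy X
   + \sum_i \int[leb]_(y in polygon X i) (- (2 * dotp (1, 0) ((y : R * R) - X i) * (v y).1))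
   + \sum_i \int[leb]_(y in polygon X i) (- (2 * dotp (0, 1) ((y : R * R) - X i) * (v y).2)).
  by lra.
rewrite -sumrN mulr_sumr quant_energy_poly// mulr_sumr -!big_split /=.
apply: ler_sum => i _; have mP := measurable_polygon hl X i.
have jd e : leb.-integrable (polygon X i) (EFin \o (fun y => dotp e ((y : R * R) - X i))) by exact: poly_int_dot.
have jq : leb.-integrable (polygon X i) (EFin \o (fun y => enorm ((y : R * R) - X i) ^+ 2)).
  apply: (@poly_int X i _ (lR ^+ 2)); first exact: measurable_dist2.
  move=> y Py; rewrite ger0_norm ?sqr_ge0// ler_pXn2r// ?nnegrE ?enorm_ge0 ?lR_ge0//.
  exact: (polygon_bounded hl Py).
have M0 : 0 <= M by exact: le_trans (enorm_ge0 _) (vM 0).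
have mv1 : measurable_fun [set: plane R] ((fun y => (v y).1) : plane R -> R).
  apply: (@measurable_lip _ L) => y z.
  exact: le_trans (enorm_fst (v y - v z)) (vL y z).
have mv2 : measurable_fun [set: plane R] ((fun y => (v y).2) : plane R -> R).
  apply: (@measurable_lip _ L) => y z.
  exact: le_trans (enorm_snd (v y - v z)) (vL y z).
have ju e (u : R * R -> R) : measurable_fun [set: plane R] (u : plane R -> R) -> (forall y, `|u y| <= M) ->
    leb.-integrable (polygon X i) (EFin \o (fun y => - (2 * dotp e ((y : R * R) - X i) * u y))).
  move=> mu uM; apply: (@poly_int X i _ (2 * (enorm e * lR) * M)).
    apply: measurable_funN; apply: measurable_funM => //.
    apply: measurable_funM; first exact: measurable_cst.
    exact: measurable_dot.
  move=> y Py; rewrite normrN !normrM; apply: ler_pM => //; rewrite ?mulr_ge0// ger0_norm// ler_pM2l//.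
  exact: poly_dot_le.
have j1 := ju (1, 0) _ mv1 (fun y => le_trans (enorm_fst _) (vM y)).
have j2 := ju (0, 1) _ mv2 (fun y => le_trans (enorm_snd _) (vM y)).
have jq2 : leb.-integrable (polygon X i) (EFin \o (fun y => 2 * L * (enorm ((y : R * R) - X i) ^+ 2))).
  by have := integrableZl mP (2 * L) jq; apply.
have j3 : leb.-integrable (polygon X i) (EFin \o (fun y => 2 * L * (enorm ((y : R * R) - X i) ^+ 2)
   + - (2 * dotp (1, 0) ((y : R * R) - X i) * (v y).1))).
  by have := integrableD mP jq2 j1; apply.
have j4 : leb.-integrable (polygon X i) (EFin \o (fun y => (-2) * dotp (v (X i)) ((y : R * R) - X i))).
  by have := integrableZl mP (-2) (jd (v (X i))); apply.
have -> : 2 * - dotp (v (X i)) (mom X i) =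
   \int[leb]_(y in polygon X i) ((-2) * dotp (v (X i)) ((y : R * R) - X i)).
  by rewrite RintegralZl// Rint_dot; ring.
rewrite -RintegralZl// -RintegralD// -RintegralD//.
apply: le_Rintegral => //; first by have := integrableD mP j3 j2; apply.
move=> y Py; have := dotp_le (v (X i) - v y) ((y : R * R) - X i).
have := vL (X i) y; rewrite (enormB (X i)) => b1 b2.
have b3 : - dotp (v (X i) - v y) ((y : R * R) - X i) <= L * enorm ((y : R * R) - X i) ^+ 2.
  apply: le_trans (ler_norm _) _; rewrite normrN; apply: (le_trans b2).
  by rewrite expr2 mulrA ler_wpM2r// enorm_ge0.
move: b3; rewrite /dotp /=; lra.
Qed.

(** Pairing the moment with itself turns its squared norm into an integral to which the
    Cauchy-Schwarz inequality applies pointwise. *)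
Lemma mom_le X i (r : R) : (forall y, polygon X i y -> enorm ((y : R * R) - X i) <= r) ->
  enorm (mom X i) <= r * parea X i.
Proof.
move=> yr; have [->|m0] := eqVneq (mom X i) 0.
  rewrite enorm0; have [r0|r0] := leP 0 r; first by rewrite mulr_ge0 ?parea_ge0.
  suff -> : parea X i = 0 by rewrite mulr0.
  rewrite /parea (_ : polygon X i = set0) ?measure0//.
  by apply/seteqP; split => // y /yr h; have := enorm_ge0 ((y : R * R) - X i); rewrite leNgt (le_lt_trans h).
have m_gt0 := enorm_gt0 m0; have mP := measurable_polygon hl X i.
rewrite -(ler_pM2l m_gt0) -expr2.
have -> : enorm (mom X i) ^+ 2 = dotp (mom X i) (mom X i) by rewrite enorm_sq /dotp !expr2.
rewrite -Rint_dot; have -> : enorm (mom X i) * (r * parea X i) =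
    \int[leb]_(y in polygon X i) cst (enorm (mom X i) * r) y.
  by rewrite Rintegral_cst// mulrA.
apply: le_Rintegral => //; [exact: poly_int_dot|exact: poly_int_cst|].
move=> y Py; apply: le_trans (ler_norm _) _; apply: le_trans (dotp_le _ _) _.
by rewrite ler_wpM2l ?enorm_ge0// yr.
Qed.

Lemma parea_inv_le1 X i : 0 <= (parea X i)^-1 * parea X i <= 1.
Proof.
have [->|p0] := eqVneq (parea X i) 0; first by rewrite mulr0 lexx ler01.
by rewrite mulVf// lexx ler01.
Qed.

Lemma cdisp_le X i (r : R) : distinct X -> 0 <= r ->
  (forall y, polygon X i y -> enorm ((y : R * R) - X i) <= r) -> enorm (cdisp X i) <= r.
Proof.
move=> dX r0 yr; rewrite cdispE// enorm_scale.
have p0 := parea_ge0 X i; have pi0 : 0 <= (parea X i)^-1 by rewrite invr_ge0.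
rewrite ger0_norm//; apply: le_trans (ler_wpM2l pi0 (mom_le yr)) _.
rewrite mulrCA; case/andP: (parea_inv_le1 X i) => _ h; exact: ler_piMr.
Qed.

Lemma mom_cdisp X i : distinct X -> dotp (cdisp X i) (mom X i) = cell_area X i * enorm (cdisp X i) ^+ 2.
Proof.
move=> dX; have mE : mom X i = scale2 (parea X i) (cdisp X i).
  rewrite cdispE//; have [p0|p0] := eqVneq (parea X i) 0.
    have := @mom_le X i lR (fun y => @polygon_bounded _ _ _ hl _ X i y).
    rewrite p0 mulr0 => h; have /enorm_eq0 -> : enorm (mom X i) = 0.
      by apply/eqP; rewrite eq_le h enorm_ge0.
    by rewrite /scale2/= !mul0r.
  by apply: pair_ext2 => /=; rewrite mulrA divff// mul1r.
by rewrite mE cell_areaE// enorm_sq /dotp /scale2 /= -/(parea X i); ring.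
Qed.

(** Each point [y] of the polygon satisfies [dotp e (y - X i) >= - |e|^2 / 2], by comparing its
    squared distances to the two generators. The condition is affine in [y], so it survives
    averaging over the cell. *)
Lemma cdisp_sep X i j k : distinct X -> lattice k ->
  - (enorm (X i - X j - k) ^+ 2 / 2) <= dotp (X i - X j - k) (cdisp X i).
Proof.
move=> dX lk; set e := X i - X j - k; have mP := measurable_polygon hl X i.
have h : - (enorm e ^+ 2 / 2) * parea X i <= dotp e (mom X i).
  rewrite -Rint_dot -Rintegral_cst//; apply: le_Rintegral => //.
  - exact: (poly_int_cst X i (- (enorm e ^+ 2 / 2))).
  - exact: poly_int_dot.
  move=> y Py; have := Py j k lk.
  rewrite -(@ler_pXn2r _ 2)// ?nnegrE ?enorm_ge0//.
  rewrite (_ : y - X j - k = (y - X i) + e); last by rewrite /e; vring.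
  have -> := enorm_sqD ((y : R * R) - X i) e; clearbody e => h.
  have -> : dotp e ((y : R * R) - X i) = e.1 * (y.1 - (X i).1) + e.2 * (y.2 - (X i).2) by [].
  move: h; rewrite /dotp /=; move: (enorm e ^+ 2) (enorm _ ^+ 2) => a b; lra.
have pi0 : 0 <= (parea X i)^-1 by rewrite invr_ge0 parea_ge0.
have -> : dotp e (cdisp X i) = (parea X i)^-1 * dotp e (mom X i).
  by rewrite cdispE// /dotp/scale2/=; ring.
apply: le_trans (ler_wpM2l pi0 h); case/andP: (parea_inv_le1 X i) => h1 h2.
rewrite mulrCA mulNr lerN2; apply: ler_piMr => //.
by rewrite divr_ge0// sqr_ge0.
Qed.

Lemma centroid_defect_ge0 X : 0 <= centroid_defect l1 l2 X.
Proof. by apply: sumr_ge0 => i _; rewrite mulr_ge0 ?sqr_ge0// fine_ge0. Qed.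

Lemma centroid_defectE X : distinct X -> centroid_defect l1 l2 X = \sum_i dotp (cdisp X i) (mom X i).
Proof. by move=> dX; apply: eq_bigr => i _; rewrite mom_cdisp. Qed.

Lemma centroid_defect_le X : distinct X -> centroid_defect l1 l2 X <= lR ^+ 2 * torus_area l1 l2.
Proof.
move=> dX; rewrite -(sum_parea dX) mulr_sumr; apply: ler_sum => i _.
rewrite cell_areaE// mulrC ler_wpM2r ?parea_ge0// ler_pXn2r// ?nnegrE ?enorm_ge0 ?lR_ge0//.
apply: cdisp_le => //; first exact: lR_ge0.
exact: (@polygon_bounded _ _ _ hl _ X i).
Qed.

Lemma max_diam_le X (r : R) : distinct X -> (forall y, nd X y <= r) -> max_diam l1 l2 X <= 2 * r.
Proof.
move=> dX ndr; have r0 : 0 <= r by exact: le_trans (nd_ge0 _ _ _ 0) (ndr 0).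
apply/bigmax_leP; split => [|i _]; first by rewrite mulr_ge0.
apply: ge_sup.
  have ci : cell X i (X i).
    move=> j ji; rewrite tdistxx// lt_neqAle tdist_ge0// andbT; apply/eqP => E.
    by apply: (dX i j); [rewrite eq_sym|exact: (tdist_eq0 hl)].
  by exists (tdist (X i) (X i)), (X i), (X i).
move=> _ [x [y [cx cy ->]]]; apply: le_trans (tdist_triangle hl (X i) _ _) _.
rewrite (tdistC hl _ y) -(cell_nd hl cx) -(cell_nd hl cy).
have := ndr x; have := ndr y; lra.
Qed.

Lemma measurable_unfold (B : set (plane R)) : measurable B ->
  measurable [set z : plane R | exists p, B (tr (- lat p) z)].
Proof.
move=> mB; have -> : [set z : plane R | exists p, B (tr (- lat p) z)] = \bigcup_p shift_set (- lat p) B.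
  by apply/seteqP; split => z [p]; [exists p|move=> _ h; exists p].
apply: countable_bigcupT_measurable; first exact: countableP.
by move=> p; exact: measurable_shift_set.
Qed.

(** A small square embeds into the torus without overlap. *)
Lemma torus_area_gt0 : 0 < torus_area l1 l2.
Proof.
have [s s0 sP] := small_box_unfold hl.
have mB := measurable_box (0 : R * R) s.
have c0 (z : plane R) : (0 <= cst (1 : \bar R) z)%E by rewrite lee01.
have H := integral_unfold hl mB (@measurable_cst _ _ _ _ _ 1%E) c0 (fun _ _ _ => erefl)
  (fun p q z => sP 0 s p q z (lexx _)).
rewrite [RHS]integral_cst// mul1e leb2_boxE ?ltW// in H.
have mD := measurable_fund_dom hl.
suff : ((((2 * s) ^+ 2)%:E) <= leb fund_dom)%E.
  rewrite /torus_area -(@fineK _ (leb fund_dom)).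
    by rewrite lee_fin; apply: lt_le_trans; rewrite exprn_gt0// mulr_gt0.
  by rewrite ge0_fin_numE//; exact: fund_dom_lty.
rewrite -H -[leRHS]mul1e -integral_cst//.
apply: ge0_subset_integral => //; apply: measurableI => //.
exact: measurable_unfold.
Qed.

Lemma energy_lower_aux (s : R) : 0 < s ->
  (forall (c : R * R) (r : R) p q (z : plane R),
     r <= s -> box c r (tr (- lat p) z) -> box c r (tr (- lat q) z) -> p = q) ->
  forall X y, distinct X ->
  Num.min (1 / 4) (s / (lR + 1)) ^+ 2 * nd X y ^+ 4 <= quant_energy X.
Proof.
move=> s0 sP; have R1 : 0 < lR + 1 by rewrite ltr_wpDl// lR_ge0.
(* The bound [1 / 4] keeps the box within distance [r / 2] of [y], so [nd] is at least [r / 2] on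
   it; the other bound keeps the box small enough to embed into the torus. Its area [4 k0^2 r^2]
   times [r^2 / 4] is the claim. *)
pose k0 := Num.min (1 / 4) (s / (lR + 1)).
have k00 : 0 < k0 by rewrite lt_min divr_gt0//= divr_gt0.
move=> X y dX; rewrite -/k0; set r := nd X y; have r0 : 0 <= r by exact: nd_ge0.
have rR : r <= lR by exact: nd_leR.
pose rho := k0 * r; have rho0 : 0 <= rho by rewrite mulr_ge0// ltW.
have rhos : rho <= s.
  have h1 : k0 <= s / (lR + 1) by rewrite ge_min lexx orbT.
  apply: (@le_trans _ _ (s / (lR + 1) * (lR + 1))); last by rewrite mulfVK ?gt_eqF.
  by apply: ler_pM => //; [exact: ltW|lra].
have rho4 : rho <= r / 4.
  have h1 : k0 <= 1 / 4 by rewrite ge_min lexx.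
  by rewrite /rho; nra.
pose f (z : plane R) : \bar R := (nd X z ^+ 2)%:E.
have mB := measurable_box y rho.
have mf : measurable_fun [set: plane R] f by apply/measurable_EFinP; exact: measurable_nd2.
have f0 z : (0 <= f z)%E by rewrite lee_fin sqr_ge0.
have pf : Defs.periodic l1 l2 f by move=> z k lk; rewrite /f nd_per.
have H := integral_unfold hl mB mf f0 pf (fun p q z => sP y rho p q z rhos).
have mD := measurable_fund_dom hl.
rewrite quant_energyE// -lee_fin /Rintegral fineK; last first.
  apply: integrable_fin_num => //; apply: (@fund_int _ (lR ^+ 2)); first exact: measurable_nd2.
  exact: nd2_le.
apply: (@le_trans _ _ (\int[leb]_(z in box y rho) f z)%E).
  apply: (@le_trans _ _ (\int[leb]_(z in box y rho) cst ((r / 2) ^+ 2)%:E z)%E).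
    rewrite integral_cst// leb2_boxE// -EFinM lee_fin /rho; lra.
  apply: ge0_le_integral => //.
  - by move=> z _; rewrite lee_fin sqr_ge0.
  - exact: measurable_funTS.
  - move=> z zB; rewrite lee_fin ler_pXn2r// ?nnegrE ?nd_ge0 ?divr_ge0//.
    have := enorm_box zB; have := nd_lip hl X z y; rewrite ler_norml -/r; lra.
rewrite -H; apply: ge0_subset_integral => //.
- apply: measurableI => //.
  exact: measurable_unfold.
- exact: measurable_funTS.
Qed.

(** A quantitative form of [distinct]. The case [i = j] with nonzero [k] also keeps [r] below the
    length of every nonzero lattice vector, so that copies of one generator count as neighbours of
    its polygon. *)
Definition sep (r : R) X : Prop := forall i j k, lattice k -> (i != j \/ k != 0) ->
  r <= enorm (X i - X j - k).

Lemma sep_distinct r X : 0 < r -> sep r X -> distinct X.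
Proof.
move=> r0 sX i j ij lk; have := sX i j _ lk (or_introl ij).
by rewrite subrr enorm0 leNgt r0.
Qed.

Lemma distinct_sep X : distinct X -> exists2 r, 0 < r & sep r X.
Proof.
move=> dX; pose lm := 1 / lK l1 l2.
have lm0 : 0 < lm by rewrite divr_gt0// lK_gt0.
exists (\big[Num.min/lm]_(ij : 'I_N * 'I_N | ij.1 != ij.2) tdist (X ij.1) (X ij.2)).
  apply: (big_ind (fun z : R => 0 < z)) => // [a b a0 b0|ij ij0]; first by rewrite lt_min a0.
  rewrite lt_neqAle tdist_ge0// andbT; apply/eqP => E.
  exact: (dX _ _ ij0 (tdist_eq0 hl (esym E))).
move=> i j k lk; have [->|ij] := eqVneq i j.
  case=> // k0; rewrite subrr sub0r enormN.
  exact: le_trans (bigmin_le_id _ _ _ _) (lattice_min hl lk k0).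
move=> _; apply: le_trans (tdist_le _ _ lk).
exact: (@bigmin_le_cond _ _ _ lm (i, j) (fun ij => ij.1 != ij.2) (fun ij => tdist (X ij.1) (X ij.2)) ij).
Qed.

(** The square of half-side [r / 4] about the generator stays within distance [r / 2] of it, hence
    inside its polygon. *)
Lemma parea_ge (r : R) X i : 0 < r -> sep r X -> r ^+ 2 / 4 <= parea X i.
Proof.
move=> r0 sX; rewrite -lee_fin /parea fineK; last by rewrite ge0_fin_numE// polygon_lty.
apply: (@le_trans _ _ (leb (box (X i) (r / 4)))).
  have r40 : 0 <= r / 4 by rewrite divr_ge0// ltW.
  by rewrite leb2_boxE// lee_fin; lra.
apply: le_measure; rewrite ?inE; [exact: measurable_box|exact: measurable_polygon|].
move=> y /enorm_box yb j k lk; have [jk|jk] := eqVneq (X j + k) (X i).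
  by rewrite -[y - X j - k]addrA -opprD jk.
have h : r <= enorm (X i - X j - k).
  apply: sX => //; have [ij|ij] := eqVneq i j; [right|by left].
  by apply/eqP => k0; move: jk; rewrite k0 addr0 ij eqxx.
have := enorm_triangle y (X i) (X j + k).
rewrite (_ : X i - (X j + k) = X i - X j - k); last by vring.
rewrite (_ : y - (X j + k) = y - X j - k); last by vring.
rewrite (enormB (X i) y); move: (enorm _) (enorm _) (enorm _) yb h => a b c; lra.
Qed.

End Energy.

Lemma energy_lower (R : realType) (l1 l2 : R * R) : linindep l1 l2 ->
  exists2 kap : R, 0 < kap & forall N (X : 'I_N -> R * R) y, (0 < N)%N -> distinct l1 l2 X ->
  kap * nd l1 l2 X y ^+ 4 <= quant_energy l1 l2 X.
Proof.
move=> hl; have [s s0 sP] := small_box_unfold hl.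
exists (Num.min (1 / 4) (s / (lR l1 l2 + 1)) ^+ 2).
  by rewrite exprn_gt0// lt_min divr_gt0//= divr_gt0// ltr_wpDl// lR_ge0.
by move=> N X y N0; apply: energy_lower_aux.
Qed.

(** * Lipschitz dependence of cells on the generators *)

Section Regularity.
Variables (R : realType) (l1 l2 : R * R).
Hypothesis hl : linindep l1 l2.
Variable N : nat.
Hypothesis N0 : (0 < N)%N.
Implicit Types (x y z k e : R * R) (p q : int * int) (X Y : 'I_N -> R * R) (i j : 'I_N).
Notation leb := (leb2 R).
Notation lattice := (lattice l1 l2).
Notation polygon X i := (polygon l1 l2 X i : set (plane R)).
Notation distinct := (distinct l1 l2).
Notation lat := (lat l1 l2).
Notation lR := (lR l1 l2).
Notation cdisp := (cdisp l1 l2).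
Notation parea := (parea l1 l2).
Notation mom := (mom l1 l2).
Notation sep := (sep l1 l2).

Definition dist1 X Y : R := \sum_i enorm (X i - Y i).

Lemma dist1_ge X Y i : enorm (X i - Y i) <= dist1 X Y.
Proof. by rewrite /dist1 (bigD1 i)//= lerDl sumr_ge0// => j _; exact: enorm_ge0. Qed.

Lemma dist1_ge0 X Y : 0 <= dist1 X Y.
Proof. by apply: sumr_ge0 => i _; exact: enorm_ge0. Qed.

Lemma dist1C X Y : dist1 X Y = dist1 Y X.
Proof. by apply: eq_bigr => i _; exact: enormB. Qed.

Lemma dist1_triangle Z X Y : dist1 X Y <= dist1 X Z + dist1 Z Y.
Proof. by rewrite /dist1 -big_split; apply: ler_sum => i _; exact: enorm_triangle. Qed.

Lemma bigU_exists (I : finType) (U : Type) (A : I -> set U) :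
  [set z | exists c, A c z] = \big[setU/set0]_(c : I) A c.
Proof.
apply/seteqP; split => z; first by move=> [c Az]; rewrite (bigD1 c)//; left.
apply: (big_ind (fun V : set U => V z -> exists c, A c z)) => [//|V W hV hW [/hV|/hW]//|c _ Az].
by exists c.
Qed.

Lemma leb2_bigU_le (I : finType) (A : I -> set (plane R)) (c : R) : 0 <= c ->
  (forall a, measurable (A a)) -> (forall a, (leb (A a) <= c%:E)%E) ->
  (leb [set z | exists a, A a z] <= (#|I|%:R * c)%:E)%E.
Proof.
move=> c0 mA Ac; rewrite bigU_exists.
rewrite mulr_natl -sumr_const -sumEFin.
suff : measurable (\big[setU/set0]_(a : I) A a) /\
   (leb (\big[setU/set0]_(a : I) A a) <= \sum_(a in I) c%:E)%E by case.
apply: (big_ind2 (fun (U : set (plane R)) s => measurable U /\ (leb U <= s)%E)) => //.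
- by rewrite measure0.
- move=> U s V t [mU Us] [mV Vt]; split; first exact: measurableU.
  exact: le_trans (measureU2 _ mU mV) (leeD Us Vt).
Qed.

(** Placing the generator at the origin makes the integrands for area and moment the same for all
    configurations, so only the domain varies. *)
Definition cpoly X i : set (plane R) := shift_set (X i) (polygon X i).

Lemma cpolyP X i z : cpoly X i z <-> forall j k, lattice k -> enorm z <= enorm (z + (X i - X j - k)).
Proof.
rewrite /cpoly /shift_set /tr /=; split => h j k lk; have := h j k lk.
  rewrite (_ : (z : R * R) + X i - X i = z); last by vring.
  by rewrite (_ : (z : R * R) + X i - X j - k = z + (X i - X j - k)) //; vring.
rewrite (_ : (z : R * R) + X i - X i = z); last by vring.
by rewrite (_ : (z : R * R) + X i - X j - k = z + (X i - X j - k)) //; vring.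
Qed.

Lemma measurable_cpoly X i : measurable (cpoly X i).
Proof. by apply: measurable_shift_set; exact: measurable_polygon. Qed.

Lemma cpoly_bounded X i z : cpoly X i z -> enorm z <= lR.
Proof.
move=> h; have := polygon_bounded hl h.
by rewrite /tr (_ : (z : R * R) + X i - X i = z) //; vring.
Qed.

(* A point of one translated cell outside the other lies in one of finitely many
   strips along bisectors, of width proportional to [dist1 X Y]. *)
Lemma cpoly_diff (r rho : R) : 0 < r -> 0 <= rho -> exists2 C : R, 0 <= C & forall X Y i,
  sep r X -> (forall i, enorm (X i) <= rho) -> (forall i, enorm (Y i) <= rho) ->
  (leb (cpoly X i `\` cpoly Y i) <= (C * dist1 X Y)%:E)%E.
Proof.
(* Only lattice vectors of at most this length can produce a competing generator for a point of norm
   at most [lR], so finitely many bisectors matter. *)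
move=> r0 rho0; have [m mP] := latbox_exists hl (2 * lR + 2 * rho).
have lR0 := lR_ge0 l1 l2.
pose I := ('I_N * ('I_(2 * m).+1 * 'I_(2 * m).+1))%type.
(* The sum of the bounds [lR] for [z] and [4 * rho + 2 * lR] for the vector between the generators;
   that vector changes by at most [2 * d], which gives the width [2 * B * d]. *)
pose B := 3 * lR + 4 * rho.
have B0 : 0 <= B by rewrite /B; lra.
exists (#|{: I}|%:R * (8 * lR * B / r)).
  by rewrite mulr_ge0 ?ler0n// divr_ge0 ?mulr_ge0// ltW.
move=> X Y i sX Xr Yr; set d := dist1 X Y.
have d0 : 0 <= d by exact: dist1_ge0.
pose e (c : I) := X i - X c.1 - lat (latbox c.2).
pose A (c : I) : set (plane R) := if e c == 0 then set0 else strip lR (e c) (- (enorm (e c) ^+ 2 / 2)) (2 * B * d).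
have mA c : measurable (A c).
  by rewrite /A; case: ifP => // _; exact: measurable_strip.
rewrite -mulrA; apply: (@le_trans _ _ (leb [set z | exists c, A c z])).
  apply: le_measure; rewrite ?inE.
  - by apply: measurableD; exact: measurable_cpoly.
  - by rewrite bigU_exists; exact: bigsetU_measurable.
  move=> z [zX zY]; have zR := cpoly_bounded zX.
  have [j [k [lk kY]]] : exists j k, lattice k /\ enorm (z + (Y i - Y j - k)) < enorm z.
    apply: contrapT => h; apply: zY; apply/cpolyP => j k lk; rewrite leNgt; apply/negP => hh.
    by apply: h; exists j, k.
  have [p pk] : exists p, k = lat p by apply/latticeE.
  have ke : enorm k <= 2 * lR + 2 * rho.
    have := enorm_triangle 0 k (Y i - Y j); rewrite subr0 sub0r enormN => h1.
    have h2 := enorm_triangle 0 (Y i) (Y j); rewrite subr0 sub0r enormN in h2.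
    have h3 : enorm (Y i - Y j - k) <= 2 * lR.
      have := enorm_triangle (- z) (Y i - Y j - k) 0; rewrite !subr0 opprK enormN.
      rewrite (addrC _ (z : R * R)); move: kY zR.
      by move: (enorm (Y i - Y j - k)) (enorm (z + _)) (enorm z) => u v w; lra.
    have h4 : enorm k <= enorm (Y i - Y j - k) + enorm (Y i - Y j).
      have := enorm_triangle 0 (Y i - Y j) (Y i - Y j - k); rewrite subr0 sub0r enormN.
      by rewrite (_ : Y i - Y j - (Y i - Y j - k) = k); [lra|vring].
    by have := Xr i; have := Yr i; have := Yr j; lra.
  have [ij pij] := mP p (eq_ind _ (fun k => enorm k <= _) ke _ pk).
  exists (j, ij); rewrite /A.
  have eE : e (j, ij) = X i - X j - k by rewrite /e /= -pij pk.
  rewrite eE; have zz := proj1 (cpolyP X i z) zX j k lk.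
  have del : enorm (X i - X j - (Y i - Y j)) <= 2 * d.
    rewrite (_ : _ - _ = (X i - Y i) - (X j - Y j)); last by vring.
    apply: le_trans (enormD _ _) _; rewrite enormN.
    by have := dist1_ge X Y i; have := dist1_ge X Y j; rewrite -/d; lra.
  have xb : enorm (X i - X j - k) <= 4 * rho + 2 * lR.
    apply: le_trans (enormD _ _) _; rewrite enormN.
    have := enormD (X i) (- X j); rewrite enormN.
    by have := Xr i; have := Xr j; lra.
  case: eqP => [e0|/eqP e0].
    have ij0 : i = j /\ k = 0.
      have [ij0|ij0] := eqVneq i j; last first.
        by have := sX i j k lk (or_introl ij0); rewrite e0 enorm0 leNgt r0.
      split => //; apply/eqP; apply/negP => /negP k0.
      by have := sX i j k lk (or_intror k0); rewrite e0 enorm0 leNgt r0.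
    by move: kY; case: ij0 => -> ->; rewrite !subrr addr0 ltxx.
  split; first exact: le_trans (enorm_fst _) zR.
    exact: le_trans (enorm_snd _) zR.
  set E := X i - X j - k in zz xb e0 *.
  set dl := X i - X j - (Y i - Y j) in del.
  have YE : Y i - Y j - k = E - dl by rewrite /E /dl; vring.
  have zz2 : enorm z ^+ 2 <= enorm ((z : R * R) + E) ^+ 2.
    by rewrite ler_pXn2r// ?nnegrE ?enorm_ge0.
  have kY2 : enorm ((z : R * R) + (E - dl)) ^+ 2 <= enorm z ^+ 2.
    by rewrite -YE ler_pXn2r// ?nnegrE ?enorm_ge0// ltW.
  have hE := enorm_sqD (z : R * R) E; rewrite hE in zz2.
  have hE2 := enorm_sqD (z : R * R) (E - dl); rewrite hE2 enorm_sqB in kY2.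
  have b1 : `|dotp z dl| <= lR * (2 * d).
    apply: le_trans (dotp_le _ _) _; apply: ler_pM; rewrite ?enorm_ge0//.
  have b2 : `|dotp E dl| <= (4 * rho + 2 * lR) * (2 * d).
    apply: le_trans (dotp_le _ _) _; apply: ler_pM; rewrite ?enorm_ge0//.
  have c1 : dotp E z = dotp z E by rewrite /dotp; ring.
  have c2 : dotp z (E - dl) = dotp z E - dotp z dl by rewrite /dotp /=; ring.
  have c3 : 0 <= enorm dl ^+ 2 by rewrite sqr_ge0.
  rewrite c1; move: b1 b2; rewrite !ler_norml => /andP[_ b1] /andP[b2' b2].
  move: zz2 kY2; rewrite c2 /B; move: (dotp z E) (dotp z dl) (dotp E dl) b1 b2 c3 => u v w b1 b2 c3 zz2 kY2.
  by apply/andP; split; lra.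
have Cge : 0 <= 8 * lR * B / r * d by rewrite mulr_ge0// divr_ge0 ?mulr_ge0// ltW.
apply: leb2_bigU_le => // c; rewrite /A; case: ifP => [_|/negbT e0]; first by rewrite measure0 lee_fin.
apply: le_trans (leb2_strip _ _ _ e0) _; rewrite ?mulr_ge0// lee_fin.
have re : r <= enorm (e c).
  apply: sX; first exact: lat_lattice.
  have [ij|ij] := eqVneq i c.1; last by left.
  right; apply/eqP => k0; move: e0; rewrite /e k0 ij subrr subr0 eqxx//.
have e1 : 0 < enorm (e c) by exact: lt_le_trans re.
rewrite ler_pdivrMr//.
apply: (@le_trans _ _ (8 * lR * B / r * d * r)).
  have -> : 8 * lR * B / r * d * r = 8 * lR * B * d by field; rewrite gt_eqF.
  by rewrite le_eqVlt; apply/orP; left; apply/eqP; ring.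
exact: ler_wpM2l.
Qed.

Lemma integral_cpoly X i (f : plane R -> R) (c : R * R -> R) :
  measurable_fun [set: plane R] f -> (forall z, 0 <= f z) ->
  (forall y, polygon X i y -> f (tr (- X i) y) = c y) ->
  (\int[leb]_(z in cpoly X i) (f z)%:E = \int[leb]_(y in polygon X i) (c y)%:E)%E.
Proof.
move=> mf f0 fc; have mP := measurable_polygon hl X i.
have -> : cpoly X i = shift_set (X i) (polygon X i) by [].
have mg : measurable_fun [set: plane R] (fun y => (f (tr (- X i) y))%:E).
  apply/measurable_EFinP; apply: (measurableT_comp mf); exact: measurable_shift.
have g0 (y : plane R) : (0 <= (f (tr (- X i) y))%:E)%E by rewrite lee_fin.
rewrite [RHS](eq_integral (fun y : plane R => (f (tr (- X i) y))%:E)); last first.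
  by move=> y; rewrite inE => Py; rewrite fc.
rewrite -(ge0_integral_shift (X i) mP mg g0); apply: eq_integral => z _.
by rewrite /tr (_ : (z : R * R) + X i - X i = z) //; vring.
Qed.

(** The integral over one translated cell exceeds that over the other by at most [B] times the area
    of their difference. As [C] is fixed before [f], one constant serves areas and moments in every
    direction. *)
Lemma integral_cpoly_lip (r rho : R) : 0 < r -> 0 <= rho -> exists2 C : R, 0 <= C & forall X Y i
    (f : plane R -> R) (B : R) (c : ('I_N -> R * R) -> R * R -> R),
  sep r X -> (forall i, enorm (X i) <= rho) -> (forall i, enorm (Y i) <= rho) ->
  measurable_fun [set: plane R] f -> (forall z, 0 <= f z) ->
  (forall z, enorm z <= lR -> f z <= B) ->
  (forall X y, polygon X i y -> f (tr (- X i) y) = c X y) ->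
  \int[leb]_(y in polygon X i) c X y <= \int[leb]_(y in polygon Y i) c Y y + B * (C * dist1 X Y).
Proof.
move=> r0 rho0; have [C C0 CP] := cpoly_diff r0 rho0; exists C => // X Y i f B c sX Xr Yr mf f0 fB fc.
have B0 : 0 <= B by apply: le_trans (f0 0) (fB 0 _); rewrite enorm0 lR_ge0.
have mX := measurable_cpoly X i; have mY := measurable_cpoly Y i.
have mfE A : measurable_fun A (EFin \o f) by apply: measurable_funTS; exact/measurable_EFinP.
have fE0 z : (0 <= (EFin \o f) z)%E by rewrite lee_fin.
have fin Z : (\int[leb]_(y in polygon Z i) (c Z y)%:E = (\int[leb]_(y in polygon Z i) c Z y)%:E)%E.
  rewrite /Rintegral fineK// ge0_fin_numE; last first.
    by apply: integral_ge0 => y Py; rewrite lee_fin -fc.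
  rewrite -(integral_cpoly mf f0 (fc Z)).
  apply: (@le_lt_trans _ _ (\int[leb]_(z in cpoly Z i) cst B%:E z)%E).
    apply: ge0_le_integral => //; first exact: measurable_cpoly.
    - by move=> z _; rewrite lee_fin.
    - by move=> z zZ; rewrite lee_fin fB//; exact: cpoly_bounded zZ.
  rewrite integral_cst; last exact: measurable_cpoly.
  apply: lte_mul_pinfty; rewrite ?lee_fin//.
  by rewrite leb2_shift ?polygon_lty//; exact: measurable_polygon.
rewrite -lee_fin EFinD -!fin -(integral_cpoly mf f0 (fc X)) -(integral_cpoly mf f0 (fc Y)).
have mD : measurable (cpoly X i `\` cpoly Y i) by exact: measurableD.
apply: (@le_trans _ _ (\int[leb]_(z in cpoly Y i `|` (cpoly X i `\` cpoly Y i)) (f z)%:E)%E).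
  apply: ge0_subset_integral => //; first exact: measurableU.
    by move=> z _; rewrite lee_fin.
  by move=> z zX; have [zY|zY] := pselect (cpoly Y i z); [left|right].
rewrite ge0_integral_setU//=; last 2 first.
- by move=> z _; rewrite lee_fin.
- by apply/disj_setPS => z [? []].
rewrite leeD2l//; apply: (@le_trans _ _ (\int[leb]_(z in cpoly X i `\` cpoly Y i) cst B%:E z)%E).
  apply: ge0_le_integral => //.
  - by move=> z _; rewrite lee_fin.
  - by move=> z [zX _]; rewrite lee_fin fB//; exact: cpoly_bounded zX.
rewrite integral_cst// EFinM lee_wpmul2l ?lee_fin//; exact: CP.
Qed.

Lemma parea_lip (r rho : R) : 0 < r -> 0 <= rho -> exists2 C : R, 0 <= C & forall X Y i,
  sep r X -> sep r Y -> (forall i, enorm (X i) <= rho) -> (forall i, enorm (Y i) <= rho) ->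
  `|parea X i - parea Y i| <= C * dist1 X Y.
Proof.
move=> r0 rho0; have [C C0 CP] := integral_cpoly_lip r0 rho0; exists C => // X Y i sX sY Xr Yr.
have E Z : parea Z i = \int[leb]_(y in polygon Z i) 1.
  by rewrite Rintegral_cst ?mul1r//; exact: measurable_polygon.
have h1 := CP X Y i (cst 1) 1 (fun _ _ => 1) sX Xr Yr (measurable_cst _) (fun=> ler01) (fun _ _ => lexx _) (fun _ _ _ => erefl).
have h2 := CP Y X i (cst 1) 1 (fun _ _ => 1) sY Yr Xr (measurable_cst _) (fun=> ler01) (fun _ _ => lexx _) (fun _ _ _ => erefl).
by rewrite !E ler_norml; rewrite dist1C in h2; lra.
Qed.

Lemma norm_sub_perturb (a b p q u v : R) : a + p <= b + q + u -> b + q <= a + p + u ->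
  - v <= p - q -> p - q <= v -> `|a - b| <= u + v.
Proof. by rewrite ler_norml; lra. Qed.

Lemma norm_addl_le (a b u v : R) : `|a + b| <= u -> `|b| <= v -> a <= u + v.
Proof. by rewrite !ler_norml; lra. Qed.

Lemma mom_lip (r rho : R) : 0 < r -> 0 <= rho -> exists2 C : R, 0 <= C & forall X Y i e,
  sep r X -> sep r Y -> (forall i, enorm (X i) <= rho) -> (forall i, enorm (Y i) <= rho) ->
  `|dotp e (mom X i) - dotp e (mom Y i)| <= enorm e * (C * dist1 X Y).
Proof.
move=> r0 rho0; have [C C0 CP] := integral_cpoly_lip r0 rho0.
have [C' C'0 CP'] := parea_lip r0 rho0; have lR0 := lR_ge0 l1 l2.
exists (2 * lR * C + lR * C'); first by rewrite addr_ge0 ?mulr_ge0.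
move=> X Y i e sX sY Xr Yr; set M := enorm e * lR.
have M0 : 0 <= M by rewrite mulr_ge0 ?enorm_ge0.
(* [dotp e z + M] is nonnegative on the ball of radius [lR], which contains all translated cells;
   the maximum extends this to the plane. The surplus [M] is removed at the end through the
   Lipschitz bound on the area. *)
pose f (z : plane R) : R := Num.max 0 (dotp e z + M).
pose c Z y : R := dotp e ((y : R * R) - Z i) + M.
have mdot : measurable_fun [set: plane R] (fun z : plane R => dotp e z).
  have := measurable_dot e 0; congr (measurable_fun _ _); apply/funext => z /=.
  by rewrite subr0.
have mf : measurable_fun [set: plane R] f.
  by apply: measurable_maxr; [exact: measurable_cst|exact: measurable_fun_addM].
have f0 z : 0 <= f z by rewrite le_max lexx.
have fB z : enorm z <= lR -> f z <= 2 * M.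
  move=> zR; have := dotp_le e z; rewrite ler_norml => /andP[_ h].
  have : enorm e * enorm z <= M by rewrite ler_wpM2l ?enorm_ge0.
  by move=> h2; rewrite ge_max; apply/andP; split; lra.
have fc Z y : polygon Z i y -> f (tr (- Z i) y) = c Z y.
  move=> Py; apply/max_idPr; have := poly_dot_le hl e Py.
  by rewrite ler_norml -/M /tr; lra.
have E Z : \int[leb]_(y in polygon Z i) c Z y = dotp e (mom Z i) + M * parea Z i.
  have mP := measurable_polygon hl Z i.
  rewrite RintegralD//; first by rewrite Rint_dot// Rintegral_cst.
    exact: (poly_int_dot hl).
  exact: (poly_int_cst hl _ _ M).
have h1 := CP X Y i f (2 * M) c sX Xr Yr mf f0 fB fc.
have h2 := CP Y X i f (2 * M) c sY Yr Xr mf f0 fB fc.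
have h3 := CP' X Y i sX sY Xr Yr; rewrite ler_norml in h3.
have {h3} [h3 h4] : - (M * (C' * dist1 X Y)) <= M * (parea X i - parea Y i) /\
     M * (parea X i - parea Y i) <= M * (C' * dist1 X Y).
  by case/andP: h3 => h3 h4; rewrite -mulrN; split; apply: ler_wpM2l.
rewrite !E in h1 h2; rewrite (dist1C Y) in h2.
have -> : enorm e * ((2 * lR * C + lR * C') * dist1 X Y) = 2 * M * (C * dist1 X Y) + M * (C' * dist1 X Y).
  by rewrite /M; ring.
rewrite mulrBr in h3 h4; move: h1 h2 h3 h4.
exact: norm_sub_perturb.
Qed.

(** Test the difference of the moments against [w], the difference of the displacements: this gives
    [parea X i * |w|^2] up to a term in the difference of the areas, and [parea_ge] keeps the area
    away from 0. *)
Lemma cdisp_lip (r rho : R) : 0 < r -> 0 <= rho -> exists2 C : R, 0 <= C & forall X Y i,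
  sep r X -> sep r Y -> (forall i, enorm (X i) <= rho) -> (forall i, enorm (Y i) <= rho) ->
  enorm (cdisp X i - cdisp Y i) <= C * dist1 X Y.
Proof.
move=> r0 rho0; have [C C0 CP] := mom_lip r0 rho0.
have [C' C'0 CP'] := parea_lip r0 rho0; have lR0 := lR_ge0 l1 l2.
have r24 : 0 < r ^+ 2 / 4 by rewrite divr_gt0// exprn_gt0.
exists ((C + lR * C') / (r ^+ 2 / 4)); first by rewrite divr_ge0 ?addr_ge0 ?mulr_ge0// ltW.
move=> X Y i sX sY Xr Yr; have dX := sep_distinct r0 sX; have dY := sep_distinct r0 sY.
set d := dist1 X Y; have d0 : 0 <= d by exact: dist1_ge0.
have pX := parea_ge hl i r0 sX; have pX0 : 0 < parea X i by exact: lt_le_trans pX.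
have mX Z : distinct Z -> 0 < parea Z i -> mom Z i = scale2 (parea Z i) (cdisp Z i).
  by move=> dZ p0; rewrite cdispE//; apply: pair_ext2 => /=; rewrite mulrA divff ?gt_eqF// mul1r.
have pY := parea_ge hl i r0 sY; have pY0 : 0 < parea Y i by exact: lt_le_trans pY.
set w := cdisp X i - cdisp Y i; have [w0|w0] := eqVneq w 0.
  by rewrite w0 enorm0 mulr_ge0// divr_ge0 ?addr_ge0 ?mulr_ge0// ltW.
have ew := enorm_gt0 w0.
have cY : enorm (cdisp Y i) <= lR.
  by apply: (cdisp_le hl dY) => //; exact: (@polygon_bounded _ _ _ hl _ Y i).
have h1 := CP X Y i w sX sY Xr Yr; have h2 := CP' X Y i sX sY Xr Yr; rewrite -/d in h1 h2.
rewrite (mX X)// (mX Y)// in h1.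
have E : dotp w (scale2 (parea X i) (cdisp X i)) - dotp w (scale2 (parea Y i) (cdisp Y i)) =
   parea X i * enorm w ^+ 2 + (parea X i - parea Y i) * dotp w (cdisp Y i).
  rewrite /w; move: (parea X i) (parea Y i) (cdisp X i) (cdisp Y i) => a b u s.
  by rewrite enorm_sq /dotp /=; ring.
rewrite E in h1; have h3 : `|(parea X i - parea Y i) * dotp w (cdisp Y i)| <= C' * d * (enorm w * lR).
  rewrite normrM; apply: ler_pM => //; apply: le_trans (dotp_le _ _) _.
  by rewrite ler_wpM2l// ltW.
have h4 : parea X i * enorm w ^+ 2 <= enorm w * ((C + lR * C') * d).
  have -> : enorm w * ((C + lR * C') * d) = enorm w * (C * d) + C' * d * (enorm w * lR) by ring.
  exact: norm_addl_le h1 h3.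
rewrite mulrAC ler_pdivlMr// mulrC.
rewrite -(ler_pM2l ew); apply: le_trans h4; rewrite mulrCA -expr2.
exact: (ler_wpM2r (sqr_ge0 _) pX).
Qed.

Notation cfg := (prod_topology (fun _ : 'I_N => (R * R)%type)).

Definition boxes (rho : R) : set cfg :=
  [set X | forall i, (`[- rho, rho] `*` `[- rho, rho])%classic (X i)].

Lemma boxes_compact (rho : R) : compact (boxes rho).
Proof.
apply: (@tychonoff 'I_N (fun=> (R * R)%type) (fun=> (`[- rho, rho] `*` `[- rho, rho])%classic)) => i.
by apply: compact_setX; exact: segment_compact.
Qed.

Lemma nbhs_config (X : cfg) (d : R) : 0 < d -> \forall Y \near X, forall i, enorm (Y i - X i) < d.
Proof.
move=> d0; have FX : Filter (nbhs X) by exact: nbhs_filter.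
suff H i : \forall Y \near X, enorm (Y i - X i) < d by exact: (filter_forall FX H).
have d2 : 0 < d / 2 by rewrite divr_gt0.
have h := @proj_continuous 'I_N (fun=> (R * R)%type) i X.
have /h : nbhs (X i) (ball (X i) (d / 2)) by exact: nbhsx_ballx.
move=> hb; apply: (@filterS _ _ FX _ _ _ hb) => Y /= [b1 b2]; apply: le_lt_trans (enorm_le_sum _) _.
have -> : d = d / 2 + d / 2 by lra.
by rewrite /=; apply: ltrD; rewrite distrC.
Qed.

Lemma enorm_scaleB (p q a b : R) (u w : R * R) :
  enorm (scale2 (p * a) u - scale2 (q * b) w) <=
  `|p - q| * `|a| * enorm u + (`|q| * `|a - b| * enorm u + `|q| * `|b| * enorm (u - w)).
Proof.
have -> : scale2 (p * a) u - scale2 (q * b) w = scale2 ((p - q) * a) u +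
    (scale2 (q * (a - b)) u + scale2 (q * b) (u - w)) by vring.
by apply: le_trans (enormD _ _) _; rewrite -!normrM -!enorm_scale lerD2l; exact: enormD.
Qed.

Variable alpha : ('I_N -> R * R) -> R.
Hypothesis alpha_lip : loc_lipschitz l1 l2 alpha.
Variable abar : R.
Hypothesis alpha_bd : forall X, distinct X -> 0 <= alpha X <= abar.

Lemma sum_tdist_le X Y : \sum_(i < N) tdist l1 l2 (X i) (Y i) <= dist1 X Y.
Proof. by apply: ler_sum => i _; exact: tdist_le_enorm. Qed.

(** Compactness makes the local radius and the local Lipschitz constant uniform over separated
    bounded configurations; one number [n] serves as the constant and as the inverse radius. *)
Lemma alpha_unif (r rho : R) : 0 < r -> exists2 n : R, 0 < n & forall Y, sep r Y ->
  (forall i, enorm (Y i) <= rho) -> forall Z, distinct Z -> dist1 Y Z <= n^-1 ->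
  `|alpha Y - alpha Z| <= n * dist1 Y Z.
Proof.
move=> r0; pose P (n : nat) (Y : cfg) := sep r Y -> forall Z, distinct Z ->
  dist1 Y Z <= n.+1%:R^-1 -> `|alpha Y - alpha Z| <= n.+1%:R * dist1 Y Z.
have /compact_near_coveringP cov := @boxes_compact rho.
have H : \forall n \near \oo, boxes rho `<=` P n.
  apply: cov => X _; have [dX|dX] := pselect (distinct X).
    have [d [K [d0 KP]]] := alpha_lip dX.
    have d2 : 0 < d / 2 by rewrite divr_gt0.
    exists ([set Y | forall i, enorm (Y i - X i) < d / 2], [set n | d / 2 > n.+1%:R^-1 /\ K <= n.+1%:R]).
      split; first exact: nbhs_config.
      near=> n => /=; split.
        rewrite invf_plt ?posrE ?ltr0n//.
        by apply: (@lt_trans _ _ n%:R); [near: n; exact: nbhs_infty_gtr|rewrite ltr_nat].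
      by apply: (@le_trans _ _ n%:R); [near: n; exact: nbhs_infty_ger|rewrite ler_nat].
    move=> [Y n] /= [YX [nd nK]] sY Z dZ dYZ; have dY := sep_distinct r0 sY.
    apply: le_trans (KP Y Z dY dZ _ _) _.
    - by move=> i; apply: le_lt_trans (tdist_le_enorm _ _ _ _) (lt_trans (YX i) _); lra.
    - move=> i; apply: le_lt_trans (tdist_le_enorm _ _ _ _) _.
      apply: le_lt_trans (enorm_triangle (Y i) _ _) _.
      have e1 : enorm (Z i - Y i) <= n.+1%:R^-1 by rewrite enormB; exact: le_trans (dist1_ge Y Z i) dYZ.
      have aux (a b c : R) : a <= c -> c < d / 2 -> b < d / 2 -> a + b < d by lra.
      exact: aux e1 nd (YX i).
    - apply: (@le_trans _ _ (n.+1%:R * \sum_(i < N) tdist l1 l2 (Y i) (Z i))).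
        by apply: ler_wpM2r => //; apply: sumr_ge0 => i _; exact: tdist_ge0.
      by apply: ler_wpM2l; [exact: ler0n|exact: sum_tdist_le].
  (* Close to a configuration in which two generators coincide no configuration is [r]-separated, so
     the claim is vacuous there. *)
  have [i [j [ij lk]]] : exists i j, i != j /\ lattice (X i - X j).
    apply: contrapT => h; apply: dX => i j ij lk; apply: h; by exists i, j.
  exists ([set Y | forall i, enorm (Y i - X i) < r / 2], setT).
    by split; [apply: nbhs_config; rewrite divr_gt0|exact: filterT].
  move=> [Y n] /= [YX _] sY; exfalso.
  have := sY i j _ lk (or_introl ij).
  rewrite (_ : Y i - Y j - (X i - X j) = (Y i - X i) - (Y j - X j)); last by vring.
  apply/negP; rewrite -ltNge; apply: le_lt_trans (enormD _ _) _; rewrite enormN.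
  by have := YX i; have := YX j; lra.
have [n _ nP] := H; exists n.+1%:R; first by rewrite ltr0n.
move=> Y sY Yr; apply: (nP n) => //=; move=> i; split => /=; rewrite in_itv /= -ler_norml.
  exact: le_trans (enorm_fst _) (Yr i).
exact: le_trans (enorm_snd _) (Yr i).
Unshelve. all: by end_near.
Qed.

Lemma alpha_lip_sep (r rho : R) : 0 < r -> exists2 C : R, 0 <= C & forall Y Z, sep r Y -> sep r Z ->
  (forall i, enorm (Y i) <= rho) -> `|alpha Y - alpha Z| <= C * dist1 Y Z.
Proof.
move=> r0; have [n n0 nP] := alpha_unif rho r0.
exists (n * Num.max 1 abar); first by rewrite mulr_ge0 ?ltW// lt_max ltr01.
move=> Y Z sY sZ Yr; have dY := sep_distinct r0 sY; have dZ := sep_distinct r0 sZ.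
have d0 := dist1_ge0 Y Z; have [d1|d1] := leP (dist1 Y Z) n^-1.
  apply: le_trans (nP Y sY Yr Z dZ d1) _; rewrite -mulrA; apply: ler_wpM2l; first exact: ltW.
  by rewrite ler_peMl// le_max lexx.
(* For distant configurations boundedness suffices: both values lie between 0 and [abar], and
   [n * dist1 Y Z] is at least 1. *)
apply: (@le_trans _ _ abar).
  by have := alpha_bd dY; have := alpha_bd dZ; rewrite ler_norml; lra.
have ab0 : 0 <= abar by have /andP[h1 h2] := alpha_bd dY; exact: le_trans h2.
apply: (@le_trans _ _ (n * abar * dist1 Y Z)); last first.
  by apply: ler_wpM2r => //; apply: ler_wpM2l; [exact: ltW|rewrite le_max lexx orbT].
have : 1 <= n * dist1 Y Z by rewrite -(mulfV (lt0r_neq0 n0)) ler_pM2l// ltW.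
by move=> h; rewrite mulrAC mulrC; exact: ler_peMr.
Qed.

Lemma sep_near (r c : R) X Y : sep r X -> dist1 X Y <= c -> sep (r - 2 * c) Y.
Proof.
move=> sX dXY i j k lk h; have := sX i j k lk h.
have := enormD (Y i - Y j - k) ((X i - Y i) - (X j - Y j)).
rewrite (_ : Y i - Y j - k + (X i - Y i - (X j - Y j)) = X i - X j - k); last by vring.
have := enormD (X i - Y i) (- (X j - Y j)); rewrite enormN.
by have := dist1_ge X Y i; have := dist1_ge X Y j; lra.
Qed.

(* Cutting off [alpha * cdisp] away from the configurations that are separated
   by [r] and bounded by [rho] gives a globally Lipschitz field of the same
   form. *)
Lemma clipped_field (r rho : R) X0 : 0 < r -> sep r X0 -> (forall i, enorm (X0 i) <= rho) ->
  exists a : ('I_N -> R * R) -> R,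
  [/\ forall X, 0 <= a X <= abar,
      forall X, a X != 0 -> distinct X,
      forall X, sep r X -> (forall i, enorm (X i) <= rho) -> a X = alpha X &
      exists2 C : R, 0 <= C & forall X Y i,
        enorm (scale2 (a X) (cdisp X i) - scale2 (a Y) (cdisp Y i)) <= C * dist1 X Y].
Proof.
move=> r0 sX0 X0r; have rho0 : 0 <= rho by exact: le_trans (enorm_ge0 _) (X0r (Ordinal N0)).
pose K := [set Z | sep r Z /\ forall i, enorm (Z i) <= rho].
have KX0 : K X0 by [].
pose dK X := inf [set dist1 X Z | Z in K].
have dKlb X : lbound [set dist1 X Z | Z in K] 0 by move=> _ [Z _ <-]; exact: dist1_ge0.
have dKne X : [set dist1 X Z | Z in K] !=set0 by exists (dist1 X X0), X0.
have dKi X : has_inf [set dist1 X Z | Z in K] by split => //; exists 0; exact: dKlb.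
have dK_ge0 X : 0 <= dK X by apply: lb_le_inf; [exact: dKne|exact: dKlb].
have dKle X Z : K Z -> dK X <= dist1 X Z.
  by move=> KZ; apply: ge_inf; [exists 0; exact: dKlb|exists Z].
have dK_lip1 X Y : dK X - dK Y <= dist1 X Y.
  rewrite lerBlDl -lerBlDr; apply: lb_le_inf => // _ [Z KZ <-].
  by have := dKle X Z KZ; have := dist1_triangle Y X Z; lra.
have dK_lip X Y : `|dK X - dK Y| <= dist1 X Y.
  by rewrite ler_norml dK_lip1 andbT lerNl opprB dist1C dK_lip1.
(* A displacement by [c] lowers the separation by at most [2 * c]. The cut-off is thus supported on
   [r / 2]-separated configurations, where [alpha] and [cdisp] are Lipschitz. *)
pose c := r / 4; have c0 : 0 < c by rewrite divr_gt0.
pose psi X := Num.max 0 (1 - dK X / c).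
have psi0 X : 0 <= psi X by rewrite le_max lexx.
have psi1 X : psi X <= 1 by rewrite ge_max ler01/= gerBl divr_ge0// ltW.
have psi_lip X Y : `|psi X - psi Y| <= c^-1 * dist1 X Y.
  apply: (@le_trans _ _ `|dK X / c - dK Y / c|); last first.
    by rewrite -mulrBl normrM mulrC (gtr0_norm (_ : 0 < c^-1)) ?invr_gt0// ler_pM2l// invr_gt0.
  rewrite /psi; move: (dK X / c) (dK Y / c) => u w.
  by rewrite !maxEle; case: ifP; case: ifP; rewrite ?ler_norml => *; have [?|?] := ler0P (u - w); lra.
have psiP X : psi X != 0 -> sep (r / 2) X /\ forall i, enorm (X i) <= rho + r / 4.
  move=> p0; have {}p0 : 0 < psi X by rewrite lt_neqAle eq_sym p0 psi0.
  have dc : dK X < c.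
    move: p0; rewrite /psi lt_max ltxx/= subr_gt0 ltr_pdivrMr// mul1r//.
  have [_ [Z [sZ Zr] <-] dZ] : exists2 d, [set dist1 X Z | Z in K] d & d < c.
    have c1 : 0 < c - dK X by rewrite subr_gt0.
    have [d dZ h] := inf_adherent c1 (dKi X); exists d => //.
    by move: h; rewrite -/(dK X); lra.
  split.
    by rewrite dist1C in dZ; have := sep_near sZ (ltW dZ); congr sep; rewrite /c; lra.
  move=> i; have := enorm_triangle (Z i) (X i) 0; rewrite !subr0.
  by have := dist1_ge X Z i; have := Zr i; rewrite /c in dZ; lra.
have r2 : 0 < r / 2 by rewrite divr_gt0.
have rho4 : 0 <= rho + r / 4 by rewrite addr_ge0// divr_ge0// ltW.
have [C1 C10 C1P] := cdisp_lip r2 rho4.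
have [C2 C20 C2P] := alpha_lip_sep (rho + r / 4) r2.
have ab0 : 0 <= abar by have /andP[h1 h2] := alpha_bd (sep_distinct r0 sX0); exact: le_trans h2.
have lR0 := lR_ge0 l1 l2.
have cdb X i : distinct X -> enorm (cdisp X i) <= lR.
  by move=> dX; apply: (cdisp_le hl dX) => //; exact: (@polygon_bounded _ _ _ hl _ X i).
exists (fun X => psi X * alpha X); split.
- move=> X; have [->|p0] := eqVneq (psi X) 0; first by rewrite mul0r lexx.
  have /andP[h1 h2] := alpha_bd (sep_distinct r2 (psiP X p0).1).
  by rewrite mulr_ge0//=; apply: le_trans h2; exact: ler_piMl.
- move=> X; rewrite mulf_eq0 negb_or => /andP[p0 _].
  exact: sep_distinct r2 (psiP X p0).1.
- move=> X sX Xr; have -> : psi X = 1; last by rewrite mul1r.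
  have KX : K X by [].
  have dK0 : dK X = 0.
    apply/eqP; rewrite eq_le dK_ge0 andbT; apply: le_trans (dKle X X KX) _.
    by rewrite /dist1 big1// => i _; rewrite subrr enorm0.
  by rewrite /psi dK0 mul0r subr0; apply/max_idPr.
- pose C := c^-1 * (abar * lR) + C2 * lR + abar * C1.
  have ci0 : 0 <= c^-1 by rewrite invr_ge0 ltW.
  exists C; first by rewrite !addr_ge0 ?mulr_ge0.
  have key X Y i : psi Y != 0 \/ psi X = 0 -> psi X != 0 ->
     enorm (scale2 (psi X * alpha X) (cdisp X i) - scale2 (psi Y * alpha Y) (cdisp Y i)) <= C * dist1 X Y.
    move=> [pY|->]; last by rewrite eqxx.
    move=> pX; have [sX Xr] := psiP X pX; have [sY Yr] := psiP Y pY.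
    have dX := sep_distinct r2 sX; have dY := sep_distinct r2 sY.
    have /andP[aX0 aX1] := alpha_bd dX; have /andP[aY0 aY1] := alpha_bd dY.
    have h1 := psi_lip X Y; have h2 := C2P X Y sX sY Xr; have h3 := C1P X Y i sX sY Xr Yr.
    have d0 := dist1_ge0 X Y.
    apply: le_trans (enorm_scaleB _ _ _ _ _ _) _; rewrite (ger0_norm aX0) (ger0_norm aY0) (ger0_norm (psi0 Y)).
    rewrite /C !mulrDl -addrA; apply: lerD.
      rewrite (mulrAC c^-1) -[leLHS]mulrA.
      by apply: ler_pM => //; rewrite ?mulr_ge0 ?enorm_ge0//; apply: ler_pM; rewrite ?enorm_ge0//; exact: cdb.
    apply: lerD.
      rewrite (_ : C2 * lR * dist1 X Y = (1 * (C2 * dist1 X Y)) * lR); last by ring.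
      apply: ler_pM; rewrite ?mulr_ge0 ?enorm_ge0//; last exact: cdb.
      by apply: ler_pM.
    rewrite -mulrA -[abar * C1]mul1r -!mulrA; apply: ler_pM; rewrite ?mulr_ge0 ?enorm_ge0//.
    by apply: ler_pM; rewrite ?enorm_ge0.
  (* With [Y] outside the support, [psi X] equals [psi X - psi Y], so the Lipschitz bound of the
     cut-off alone does the work; [alpha] and [cdisp] are uncontrolled at [Y]. *)
  have key0 X Y i : psi Y = 0 -> psi X != 0 ->
     enorm (scale2 (psi X * alpha X) (cdisp X i)) <= C * dist1 X Y.
    move=> pY pX; have [sX Xr] := psiP X pX; have dX := sep_distinct r2 sX.
    have /andP[aX0 aX1] := alpha_bd dX; have h1 := psi_lip X Y; rewrite pY subr0 (ger0_norm (psi0 X)) in h1.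
    have d0 := dist1_ge0 X Y.
    rewrite enorm_scale ger0_norm ?mulr_ge0//.
    apply: (@le_trans _ _ (c^-1 * (abar * lR) * dist1 X Y)); last first.
      by apply: ler_wpM2r => //; rewrite /C -addrA lerDl addr_ge0// mulr_ge0.
    rewrite (mulrAC c^-1) -[leLHS]mulrA.
    by apply: ler_pM => //; rewrite ?mulr_ge0 ?enorm_ge0//; apply: ler_pM; rewrite ?enorm_ge0//; exact: cdb.
  move=> X Y i; have s0 w : scale2 0 w = (0 : R * R) by apply: pair_ext2 => /=; rewrite mul0r.
  have [pX|pX] := eqVneq (psi X) 0; have [pY|pY] := eqVneq (psi Y) 0.
  + rewrite pX pY !mul0r !s0 subrr enorm0 mulr_ge0 ?dist1_ge0// !addr_ge0 ?mulr_ge0//.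
  + rewrite pX mul0r s0 sub0r enormN dist1C; exact: key0.
  + rewrite pY (mul0r (alpha Y)) s0 subr0; exact: key0.
  + by apply: key => //; left.
Qed.
End Regularity.

(** * Bochner integrable velocities *)

Section NonMeasurableIntegral.
Import HBNNSimple.
Context d (T : measurableType d) (R : realType) (mu : {measure set T -> \bar R}).

(* No measurability is assumed: the integral of a nonnegative function is the
   supremum of the integrals of the simple functions below it. *)
Lemma ge0_integral_ae (D N : set T) (f g : T -> \bar R) : measurable N -> mu N = 0%E ->
  (forall x, D x -> 0 <= f x)%E -> (forall x, D x -> 0 <= g x)%E ->
  (forall x, D x -> ~ N x -> f x = g x) ->
  (\int[mu]_(x in D) f x = \int[mu]_(x in D) g x)%E.
Proof.
move=> mN N0; suff H (u w : T -> \bar R) : (forall x, 0 <= u x)%E -> (forall x, 0 <= w x)%E ->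
    (forall x, ~ N x -> u x = w x) -> (\int[mu]_x u x <= \int[mu]_x w x)%E.
  move=> f0 g0 fg; rewrite integral_mkcond [RHS]integral_mkcond; apply/eqP; rewrite eq_le.
  have p0 (u : T -> \bar R) : (forall x, D x -> 0 <= u x)%E -> forall x, (0 <= (u \_ D) x)%E.
    by move=> u0 x; rewrite patchE; case: ifPn => // /[!inE]; exact: u0.
  have pe x : ~ N x -> (f \_ D) x = (g \_ D) x.
    by move=> Nx; rewrite !patchE; case: ifPn => // /[!inE] Dx; exact: fg.
  by rewrite !H//; try exact: p0; move=> x /pe.
move=> u0 w0 uw; rewrite (ge0_integralTE _ u0) (ge0_integralTE _ w0).
apply: ge_ereal_sup => _ [h hu <-].
have mNc : measurable (~` N) by exact: measurableC.
(* Killing the simple function on the null set keeps its integral and puts it below [w]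
   everywhere. *)
pose h' := mul_nnsfun h (indic_nnsfun R mNc).
have -> : sintegral mu h = sintegral mu h'.
  rewrite -!integralT_nnsfun; apply: ae_eq_integral => //; try by apply/measurable_EFinP.
  exists N; split => // x /= hx; apply: contrapT => Nx; apply: hx => _.
  by rewrite /mindic indicE mem_set// mulr1.
apply: ereal_sup_ubound; exists h' => //= x.
rewrite /mindic indicE; case: (pselect (N x)) => [Nx|Nx].
  by rewrite memNset ?mulr0//; exact.
by rewrite mem_set// mulr1 -uw.
Qed.

End NonMeasurableIntegral.

(** * The norm of bounded Lipschitz vector fields *)

Section LipschitzNorm.
Variables (R : realType) (l1 l2 : R * R).
Hypothesis hl : linindep l1 l2.
Notation tdist := (tdist l1 l2).
Notation C01 := (C01 l1 l2).
Notation C01_norm := (C01_norm l1 l2).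
Implicit Types f g : R * R -> R * R.

Lemma sup_le (A : set R) (b : R) : 0 <= b -> (forall x, A x -> x <= b) -> sup A <= b.
Proof.
move=> b0 Ab; have [->|A0] := eqVneq A set0; first by rewrite sup0.
by apply: ge_sup => //; exact/set0P.
Qed.

Lemma sup_ge0 (A : set R) (b : R) : (forall x, A x -> 0 <= x <= b) -> 0 <= sup A.
Proof.
move=> Ab; have [->|/set0P[x Ax]] := eqVneq A set0; first by rewrite sup0.
have /andP[x0 _] := Ab _ Ax; apply: le_trans x0 _; apply: sup_ubound => //.
by exists b => y /Ab /andP[].
Qed.

Let S0 f := [set enorm (f x) | x in [set: R * R]].
Let S1 f := [set r | exists x y, 0 < tdist x y /\ r = enorm (f x - f y) / tdist x y].

Lemma C01_bounds f : C01 f -> exists2 K : R, forall r, S0 f r -> 0 <= r <= K &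
  forall r, S1 f r -> 0 <= r <= K.
Proof.
move=> [_ [K [K1 K2]]]; exists K => r.
  by move=> [x _ <-]; rewrite enorm_ge0 K1.
move=> [x [y [d0 ->]]]; rewrite divr_ge0 ?enorm_ge0 ?tdist_ge0//=.
by rewrite ler_pdivrMr.
Qed.

Lemma C01_norm_ge0 f : C01 f -> 0 <= C01_norm f.
Proof. by move=> /C01_bounds[K K1 K2]; apply: addr_ge0; [exact: (sup_ge0 K1)|exact: (sup_ge0 K2)]. Qed.

Lemma C01_norm_le f x : C01 f -> enorm (f x) <= C01_norm f.
Proof.
move=> /C01_bounds[K K1 K2]; apply: (@le_trans _ _ (sup (S0 f))).
  by apply: sup_ubound; [exists K => y /K1/andP[]|exists x].
by rewrite /Defs.C01_norm lerDl; exact: (sup_ge0 K2).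
Qed.

Lemma C01_norm_lip f x y : C01 f -> enorm (f x - f y) <= C01_norm f * tdist x y.
Proof.
move=> Cf; have [K K1 K2] := C01_bounds Cf.
have [d0|d0] := eqVneq (tdist x y) 0.
  have := proj1 Cf y _ (tdist_eq0 hl d0); rewrite (_ : y + (x - y) = x); last by vring.
  by move=> ->; rewrite subrr enorm0 d0 mulr0.
have {}d0 : 0 < tdist x y by rewrite lt_neqAle eq_sym d0 tdist_ge0.
rewrite -ler_pdivrMr//; apply: (@le_trans _ _ (sup (S1 f))).
  by apply: sup_ubound; [exists K => z /K2/andP[]|exists x, y].
by rewrite /Defs.C01_norm lerDr; exact: (sup_ge0 K1).
Qed.

Lemma C01_norm_ub f (a b : R) : 0 <= a -> 0 <= b -> (forall x, enorm (f x) <= a) ->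
  (forall x y, enorm (f x - f y) <= b * tdist x y) -> C01_norm f <= a + b.
Proof.
move=> a0 b0 fa fb; apply: lerD; first by apply: sup_le => // _ [x _ <-].
by apply: sup_le => // _ [x [y [d0 ->]]]; rewrite ler_pdivrMr.
Qed.

Lemma C01_add f g : C01 f -> C01 g -> C01 (fun x => f x + g x).
Proof.
move=> [pf [K [K1 K2]]] [pg [K' [K1' K2']]]; split.
  by move=> x k lk; rewrite pf// pg.
exists (K + K'); split=> [x|x y]; first by apply: le_trans (enormD _ _) _; exact: lerD.
rewrite (_ : f x + g x - (f y + g y) = (f x - f y) + (g x - g y)); last by vring.
by apply: le_trans (enormD _ _) _; rewrite mulrDl; exact: lerD.
Qed.

Lemma C01_opp f : C01 f -> C01 (fun x => - f x).
Proof.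
move=> [pf [K [K1 K2]]]; split; first by move=> x k lk; rewrite pf.
by exists K; split=> [x|x y]; rewrite -?opprD enormN.
Qed.

Lemma C01_0 : C01 (fun=> 0).
Proof. by split=> //; exists 0; split=> [x|x y]; rewrite ?subrr enorm0 ?mul0r. Qed.

Lemma C01_sub f g : C01 f -> C01 g -> C01 (fun x => f x - g x).
Proof. by move=> Cf Cg; apply: C01_add => //; exact: C01_opp. Qed.

Lemma C01_sum (I : finType) (g : I -> R * R -> R * R) : (forall i, C01 (g i)) ->
  C01 (fun x => \sum_i g i x).
Proof.
move=> Cg; elim: (index_enum I) => [|i s IH].
  by under eq_fun do rewrite big_nil; exact: C01_0.
by under eq_fun do rewrite big_cons; exact: C01_add.
Qed.

Lemma C01_norm_triangle f g : C01 f -> C01 g ->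
  C01_norm f <= C01_norm g + C01_norm (fun x => f x - g x).
Proof.
move=> Cf Cg; pose d x := f x - g x; have Cd : C01 d by exact: C01_sub.
have [Kg Kg1 Kg2] := C01_bounds Cg; have [Kd Kd1 Kd2] := C01_bounds Cd.
have b0 h K : (forall r, S0 h r -> 0 <= r <= K) -> forall x, enorm (h x) <= sup (S0 h).
  by move=> hK x; apply: sup_ubound; [exists K => y /hK/andP[]|exists x].
have b1 h K : C01 h -> (forall r, S1 h r -> 0 <= r <= K) ->
    forall x y, enorm (h x - h y) <= sup (S1 h) * tdist x y.
  move=> Ch hK x y; have [d0|d0] := eqVneq (tdist x y) 0.
    have := C01_norm_lip x y Ch; rewrite d0 !mulr0 => /le_trans; exact.
  have {}d0 : 0 < tdist x y by rewrite lt_neqAle eq_sym d0 tdist_ge0.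
  rewrite -ler_pdivrMr//.
  by apply: sup_ubound; [exists K => z /hK/andP[]|exists x, y].
rewrite /(Defs.C01_norm _ _ g) /(Defs.C01_norm _ _ d) addrACA.
have s0g := sup_ge0 Kg1; have s1g := sup_ge0 Kg2; have s0d := sup_ge0 Kd1; have s1d := sup_ge0 Kd2.
have fE x : f x = g x + d x by rewrite /d; vring.
apply: C01_norm_ub => [||x|x y]; [exact: addr_ge0|exact: addr_ge0| |].
  by rewrite fE; apply: le_trans (enormD _ _) _; apply: lerD; [exact: b0 Kg1 x|exact: b0 Kd1 x].
rewrite !fE (_ : g x + d x - (g y + d y) = (g x - g y) + (d x - d y)); last by vring.
apply: le_trans (enormD _ _) _; rewrite mulrDl.
by apply: lerD; [exact: (b1 g Kg)|exact: (b1 d Kd)].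
Qed.

Lemma C01_norm_sub f g : C01 f -> C01 g ->
  `|C01_norm f - C01_norm g| <= C01_norm (fun x => f x - g x).
Proof.
move=> Cf Cg; have h1 := C01_norm_triangle Cf Cg; have h2 := C01_norm_triangle Cg Cf.
have h3 : C01_norm (fun x => g x - f x) <= C01_norm (fun x => f x - g x).
  have CN := C01_sub Cf Cg; have [K K1 K2] := C01_bounds CN.
  apply: lerD.
    apply: sup_le => [|_ [x _ <-]]; first exact: sup_ge0 K1.
    by rewrite enormB; apply: sup_ubound; [exists K => y /K1/andP[]|exists x].
  apply: sup_le => [|_ [x [y [d0 ->]]]]; first exact: sup_ge0 K2.
  apply: sup_ubound; first by exists K => z /K2/andP[].
  exists x, y; split=> //; congr (_ / _).
  by rewrite -enormN; congr enorm; vring.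
by rewrite ler_norml; lra.
Qed.

End LipschitzNorm.

(** * A representative of the velocity that is controlled at every time *)

Section Velocity.
Variables (R : realType) (l1 l2 : R * R).
Hypothesis hl : linindep l1 l2.
Notation mu := (@lebesgue_measure R).
Notation intg f := (mu.-integrable [set: R] (EFin \o f)).
Notation tdist := (tdist l1 l2).
Notation C01 := (C01 l1 l2).
Notation C01_norm := (C01_norm l1 l2).

Lemma measurable_if_in (A : set R) (f g : R -> R) : measurable A ->
  measurable_fun [set: R] f -> measurable_fun [set: R] g ->
  measurable_fun [set: R] (fun t => if t \in A then f t else g t).
Proof.
move=> mA mf mg; apply: measurable_fun_ifT => //.
apply: (measurable_fun_bool true); rewrite setTI.
suff -> : (in_mem^~ (mem A)) @^-1` [set true] = A by [].
by apply/seteqP; split => t /=; [move/set_mem|move/mem_set].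
Qed.

Lemma finite_valued_measurable (J : finType) (b : R -> J) (H : J -> R) :
  (forall j, measurable [set t | b t = j]) -> measurable_fun [set: R] (H \o b).
Proof.
move=> mb; have -> : H \o b = fun t => \sum_(j : J) (if t \in [set t | b t = j] then H j else 0).
  apply/funext => t /=; rewrite (bigD1 (b t))//= mem_set// big1 ?addr0// => j jb.
  by rewrite memNset//= => E; rewrite E eqxx in jb.
apply: measurable_sum => j; apply: measurable_if_in => //; exact: measurable_cst.
Qed.

Lemma C01_simple_C01 (s : R -> R * R -> R * R) t : C01_simple l1 l2 s -> C01 (s t).
Proof.
move=> [m [A [g [mA Cg sE]]]].
have -> : s t = fun x => \sum_(i < m) (if t \in A i then g i x else 0).
  by apply/funext => x; exact: sE.
apply: (@C01_sum _ _ _ _ (fun i x => if t \in A i then g i x else 0)) => i; case: (t \in A i); [exact: Cg|exact: C01_0].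
Qed.

(** The norm depends on [t] only through the vector of memberships in the sets [A i], which takes
    finitely many values, each on a measurable set. *)
Lemma measurable_C01_simple_norm (s : R -> R * R -> R * R) : C01_simple l1 l2 s ->
  measurable_fun [set: R] (fun t => C01_norm (s t)).
Proof.
move=> [m [A [g [mA Cg sE]]]].
pose b (t : R) : {ffun 'I_m -> bool} := [ffun i => t \in A i].
pose H (c : {ffun 'I_m -> bool}) := C01_norm (fun x => \sum_(i < m) (if c i then g i x else 0)).
have -> : (fun t => C01_norm (s t)) = H \o b.
  apply/funext => t; rewrite /= /H; congr (C01_norm _); apply/funext => x.
  by rewrite sE; apply: eq_bigr => i _; rewrite ffunE.
apply: finite_valued_measurable => c.
have -> : [set t | b t = c] = \bigcap_i (if c i then A i else ~` A i).
  apply/seteqP; split => t /=.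
    by move=> <- i _; rewrite ffunE; case: ifPn; rewrite ?notin_setE ?inE.
  move=> h; apply/ffunP => i; rewrite ffunE; have := h i Logic.I.
  by case: (c i) => ?; [rewrite mem_set|rewrite memNset].
apply: fin_bigcap_measurable => [|i _]; first exact: finite_finset.
 by case: ifP => _ //; exact: measurableC.
Qed.

Lemma continuous_measurableR (f : R -> R) : continuous f -> measurable_fun [set: R] f.
Proof. exact: continuous_measurable_fun. Qed.

Lemma C01_curve_continuous (g : R * R -> R * R) (x : R -> R * R) : C01 g ->
  continuous (fun t => (x t).1) -> continuous (fun t => (x t).2) ->
  continuous (fun t => (g (x t)).1) /\ continuous (fun t => (g (x t)).2).
Proof.
move=> Cg /continuous_eps c1 /continuous_eps c2.
have K0 := C01_norm_ge0 Cg; set K := C01_norm g in K0.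
have key t (e : R) : 0 < e -> exists2 d : R, 0 < d &
     forall s : R, `|s - t| < d -> enorm (g (x s) - g (x t)) <= e.
  move=> e0; have e2 : 0 < e / (2 * (K + 1)) by rewrite divr_gt0// mulr_gt0// ltr_wpDl.
  have [d1 d10 h1] := c1 t _ e2; have [d2 d20 h2] := c2 t _ e2.
  exists (Num.min d1 d2); first by rewrite lt_min d10.
  move=> s; rewrite lt_min => /andP[s1 s2].
  apply: le_trans (C01_norm_lip hl _ _ Cg) _.
  apply: (@le_trans _ _ (K * (e / (K + 1)))).
    apply: ler_wpM2l => //; apply: le_trans (tdist_le_enorm _ _ _ _) _.
    apply: le_trans (enorm_le_sum _) _.
    have -> : e / (K + 1) = e / (2 * (K + 1)) + e / (2 * (K + 1)).
      by field; rewrite gt_eqF// ltr_wpDl.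
    by apply: lerD; [exact: h1|exact: h2].
  by rewrite mulrA ler_pdivrMr ?ltr_wpDl// mulrDr mulr1 mulrC lerDl ltW.
split; apply/continuous_eps => t e e0; have [d d0 h] := key t e e0; exists d => // s /h.
  exact: le_trans (enorm_fst (g (x s) - g (x t))).
exact: le_trans (enorm_snd (g (x s) - g (x t))).
Qed.

Lemma measurable_C01_simple_curve (s : R -> R * R -> R * R) (x : R -> R * R) : C01_simple l1 l2 s ->
  continuous (fun t => (x t).1) -> continuous (fun t => (x t).2) ->
  measurable_fun [set: R] (fun t => (s t (x t)).1) /\ measurable_fun [set: R] (fun t => (s t (x t)).2).
Proof.
move=> [m [A [g [mA Cg sE]]]] c1 c2.
have E1 : (fun t => (s t (x t)).1) = fun t => \sum_(i < m) (if t \in A i then (g i (x t)).1 else 0).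
  apply/funext => t; rewrite sE (big_morph fst (id1 := 0) (op1 := +%R))//.
  by apply: eq_bigr => i _; case: ifP.
have E2 : (fun t => (s t (x t)).2) = fun t => \sum_(i < m) (if t \in A i then (g i (x t)).2 else 0).
  apply/funext => t; rewrite sE (big_morph snd (id1 := 0) (op1 := +%R))//.
  by apply: eq_bigr => i _; case: ifP.
rewrite E1 E2; split; apply: measurable_sum => i; apply: measurable_if_in => //;
  try exact: measurable_cst;
  by apply: continuous_measurableR; have [] := C01_curve_continuous (Cg i) c1 c2.
Qed.

Lemma cvg_norm_squeeze (u e : nat -> R) (a : R) : e @ \oo --> (0 : R) ->
  (forall n, `|u n - a| <= e n) -> u @ \oo --> a.
Proof.
move=> e0 ue; apply/cvgrPdist_le => d d0.
have /cvgrPdist_le /(_ d d0) := e0; apply: filterS => n; rewrite sub0r normrN => h.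
rewrite distrC; apply: le_trans (ue n) _; exact: le_trans (ler_norm _) h.
Qed.

(** The interface through which the velocity is used from here on: almost every time becomes every
    time, and [L] is a measurable bound that vanishes off the open time interval. [rv_curve]
    provides the measurability along continuous curves that Picard iteration needs. *)
Record regular_velocity (T : R) (v w : R -> R * R -> R * R) (L : R -> R) : Prop := {
  rv_ae : {ae mu, forall t : R, 0 < t < T -> forall x, w t x = v t x};
  rv_out : forall t : R, ~~ (0 < t < T) -> L t = 0;
  rv_ge0 : forall t, 0 <= L t;
  rv_int : intg L;
  rv_per : forall t, Defs.periodic l1 l2 (w t);
  rv_le : forall t x, enorm (w t x) <= L t;
  rv_lip : forall t x y, enorm (w t x - w t y) <= L t * tdist x y;
  rv_curve : forall x : R -> R * R, continuous (fun t => (x t).1) -> continuous (fun t => (x t).2) ->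
    measurable_fun [set: R] (fun t => (w t (x t)).1) /\
    measurable_fun [set: R] (fun t => (w t (x t)).2);
  rv_Lambda : forall t : R, 0 <= t <= T -> Lambda l1 l2 v t = prim L t }.

(** Keep [v] on the full-measure set of times at which the simple functions converge and put 0
    elsewhere. Norms, and values along continuous curves, are then pointwise limits of measurable
    functions. *)
Lemma bochner_regular (T : R) (v : R -> R * R -> R * R) : bochner_L1_C01 l1 l2 T v ->
  exists w L, regular_velocity T v w L.
Proof.
move=> [Cv [s [Cs scv]] vint].
have [Nl [mN N0 hN]] := scv.
pose D : set R := `]0, T[ `\` Nl.
have mD : measurable D by exact: measurableD.
have DI t : D t -> 0 < t < T by case=> /=; rewrite in_itv.
have Dcv t : D t -> (fun n => C01_norm (fun x => s n t x - v t x)) @ \oo --> (0 : R).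
  move=> Dt; have /= t0 := DI t Dt; apply: contrapT => h.
  by case: Dt => _; apply; apply: hN => /= /(_ t0).
pose w t := if t \in D then v t else fun=> 0.
pose L t := if t \in D then C01_norm (v t) else 0.
have Cw t : C01 (w t).
  by rewrite /w; case: ifPn => [/[!inE] /DI/Cv//|_]; exact: C01_0.
have N00 : C01_norm (fun=> 0) = 0.
  apply/eqP; rewrite eq_le C01_norm_ge0 ?andbT; last exact: C01_0.
  apply: le_trans (C01_norm_ub (lexx 0) (lexx 0) _ _) _; rewrite ?addr0//.
    by move=> x; rewrite enorm0.
  by move=> x y; rewrite subrr enorm0 mul0r.
have Lw t : L t = C01_norm (w t) by rewrite /L /w; case: ifP.
have L0 t : 0 <= L t by rewrite Lw; exact: C01_norm_ge0.
have Lout t : ~~ (0 < t < T) -> L t = 0.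
  by move=> ht; rewrite /L memNset// => /DI h; rewrite h in ht.
have mL : measurable_fun [set: R] L.
  apply: (@measurable_fun_cvg _ _ _ _ (fun n t => if t \in D then C01_norm (s n t) else 0)).
    by move=> n; apply: measurable_if_in => //; exact: measurable_C01_simple_norm.
  move=> t _; rewrite /L; case: ifPn => [/[!inE] Dt|_]; last exact: cvg_cst.
  apply: (cvg_norm_squeeze (Dcv t Dt)) => n.
  by apply: C01_norm_sub => //; [exact: C01_simple_C01|exact/Cv/DI].
have mLE : measurable_fun [set: R] (fun x => (L x)%:E) by exact/measurable_EFinP.
(* Measurability is established for [L], not for the norm of [v]; the two integrals are therefore
   compared by [ge0_integral_ae], which asks only for agreement off a measurable null set. *)
have LE t : t <= T -> (\int[mu]_(x in `[0%R, t]) (L x)%:E = \int[mu]_(x in `]0%R, t[) (C01_norm (v x))%:E)%E.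
  move=> tT; transitivity (\int[mu]_(x in `]0%R, t[) (L x)%:E)%E.
    rewrite [LHS]integral_mkcond [RHS]integral_mkcond.
    apply: ae_eq_integral => //.
    - apply: (proj1 (measurable_restrictT _ _)); [exact: measurable_itv|exact: (measurable_funTS mLE)].
    - apply: (proj1 (measurable_restrictT _ _)); [exact: measurable_itv|exact: (measurable_funTS mLE)].
    exists [set t]; split; [exact: measurable_set1|exact: lebesgue_measure_set1|].
    move=> x /= h; apply: contrapT => xt; apply: h => _; rewrite !patchE.
    have [h1|h1] := boolP (0 < x < t).
      by rewrite !mem_set//= in_itv/=; lra.
    rewrite [in RHS]memNset; last by rewrite /= in_itv/=; exact/negP.
    case: ifPn => // /[!inE]/=; rewrite in_itv/= => /andP[x0 xt'].
    rewrite Lout//; apply: contra h1 => /andP[-> _]/=.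
    by rewrite lt_neqAle xt' andbT; exact/eqP.
  apply: (ge0_integral_ae mN N0) => x; rewrite ?lee_fin//=.
    by rewrite in_itv/= => h; apply: C01_norm_ge0; apply: Cv; lra.
  by rewrite in_itv/= => h Nx; rewrite /L mem_set//; split => //=; rewrite in_itv/=; lra.
exists w, L; split => //.
- exists (Nl); split => // t /= h; apply: contrapT => Nt; apply: h => t0 x.
  by rewrite /w mem_set//; split => //=; rewrite in_itv.
- apply/integrableP; split; first exact/measurable_EFinP.
  under eq_integral do rewrite /= ger0_norm//.
  rewrite (_ : (\int[mu]_x (L x)%:E)%E = \int[mu]_(x in `[0%R, T]) (L x)%:E)%E; first by rewrite LE.
  rewrite [RHS]integral_mkcond; apply: eq_integral => x _; rewrite patchE.
  case: ifPn => //; rewrite notin_setE /= in_itv/= => /negP h.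
  by rewrite Lout//; apply: contra h => /andP[h1 h2]; rewrite !ltW.
- by move=> t; exact: (proj1 (Cw t)).
- by move=> t x; rewrite Lw; exact: C01_norm_le.
- by move=> t x y; rewrite Lw; exact: C01_norm_lip.
- move=> x c1 c2.
  have key (p : R * R -> R) : (forall a b, p (a - b) = p a - p b) -> (forall a, `|p a| <= enorm a) ->
      (forall n, measurable_fun [set: R] (fun t => p (s n t (x t)))) ->
      measurable_fun [set: R] (fun t => p (w t (x t))).
    move=> pB pe ms.
    have p0 : p 0 = 0 by have := pB 0 0; rewrite !subrr.
    apply: (@measurable_fun_cvg _ _ _ _ (fun n t => if t \in D then p (s n t (x t)) else 0)).
      by move=> n; apply: measurable_if_in => //; exact: ms.
    move=> t _; rewrite /w; case: ifPn => [/[!inE] Dt|_]; last by rewrite p0; exact: cvg_cst.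
    apply: (cvg_norm_squeeze (Dcv t Dt)) => n; rewrite -pB; apply: le_trans (pe _) _.
    apply: (@C01_norm_le _ _ _ (fun x => s n t x - v t x)).
    by apply: C01_sub; [exact: C01_simple_C01|exact/Cv/DI].
  split.
    apply: (key fst) => // [a|n]; first exact: enorm_fst.
    by have [] := measurable_C01_simple_curve (Cs n) c1 c2.
  apply: (key snd) => // [a|n]; first exact: enorm_snd.
  by have [] := measurable_C01_simple_curve (Cs n) c1 c2.
- by move=> t /andP[t0 tT]; rewrite /Lambda /prim /Rintegral LE.
Qed.

End Velocity.

(** * Existence and uniqueness of the dynamics *)

Section AbsolutelyContinuousCurves.
Variable R : realType.
Notation mu := (@lebesgue_measure R).
Implicit Types (x y : R -> R * R) (T t : R).

Lemma ac_cst T (c : R) : ac T (fun=> c).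
Proof.
move=> e e0; exists 1 => // n a b _ _ _.
by under eq_bigr do rewrite subrr normr0; rewrite big1.
Qed.

Lemma ac_sum (I : finType) T (f : I -> R -> R) : (forall i, ac T (f i)) ->
  ac T (fun t => \sum_i f i t).
Proof.
move=> af; apply: (@ac_dom _ I f 1) => // s t _ _; rewrite mul1r -sumrB.
exact: ler_norm_sum.
Qed.

Lemma abs_continuous_ac T x : abs_continuous T x ->
  ac T (fun t => (x t).1) /\ ac T (fun t => (x t).2).
Proof.
move=> ax; split => e e0; have [d d0 h] := ax e e0; exists d => // n a b h1 h2 h3;
  apply: le_lt_trans (h n a b h1 h2 h3); apply: ler_sum => i _.
  exact: enorm_fst (x (b i) - x (a i)).
exact: enorm_snd (x (b i) - x (a i)).
Qed.

Lemma ac_abs_continuous T x : ac T (fun t => (x t).1) -> ac T (fun t => (x t).2) ->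
  abs_continuous T x.
Proof.
move=> a1 a2 e e0; have e2 : 0 < e / 2 by rewrite divr_gt0.
have [d1 d10 h1] := a1 _ e2; have [d2 d20 h2] := a2 _ e2.
exists (Num.min d1 d2); first by rewrite lt_min d10.
move=> n a b ab dis; rewrite lt_min => /andP[s1 s2].
have k1 := h1 n a b ab dis s1; have k2 := h2 n a b ab dis s2.
apply: (@le_lt_trans _ _ (\sum_(i < n) (`|(x (b i)).1 - (x (a i)).1| + `|(x (b i)).2 - (x (a i)).2|))).
  by apply: ler_sum => i _; exact: enorm_le_sum.
by rewrite big_split /=; lra.
Qed.

Lemma ac_sq_dist T x y k : abs_continuous T x -> abs_continuous T y ->
  ac T (fun t => enorm (x t - y t - k) ^+ 2).
Proof.
move=> /abs_continuous_ac[x1 x2] /abs_continuous_ac[y1 y2].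
have c1 := ac_sub (ac_sub x1 y1) (ac_cst T k.1).
have c2 := ac_sub (ac_sub x2 y2) (ac_cst T k.2).
have := ac_sub (ac_mulM c1 c1) (ac_sub (ac_cst T 0) (ac_mulM c2 c2)).
congr (ac T _); apply/funext => t; rewrite enorm_sq /= !expr2; ring.
Qed.

Lemma ac_opp T (f : R -> R) : ac T f -> ac T (fun t => - f t).
Proof.
by move=> af; have := ac_sub (ac_cst T 0) af; congr (ac T _); apply/funext => t; rewrite sub0r.
Qed.

Lemma is_derive_sq_dist x y k t p q : has_velocity x t p -> has_velocity y t q ->
  is_derive t 1 (fun s => enorm (x s - y s - k) ^+ 2) (2 * dotp (x t - y t - k) (p - q)).
Proof.
move=> [x1 x2] [y1 y2].
pose u1 s := (x s).1 - (y s).1 - k.1; pose u2 s := (x s).2 - (y s).2 - k.2.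
have -> : (fun s => enorm (x s - y s - k) ^+ 2) = u1 * u1 + u2 * u2.
  by apply/funext => s; rewrite enorm_sq !expr2.
have d1 : is_derive t 1 u1 (p.1 - q.1) by apply: is_derive_eq; rewrite subr0.
have d2 : is_derive t 1 u2 (p.2 - q.2) by apply: is_derive_eq; rewrite subr0.
apply: (is_derive_eq (is_deriveD (is_deriveM d1 d1) (is_deriveM d2 d2))).
by rewrite /dotp /GRing.scale /u1 /u2 /=; ring.
Qed.

End AbsolutelyContinuousCurves.

Section Dynamics.
Variables (R : realType) (l1 l2 : R * R).
Hypothesis hl : linindep l1 l2.
Variable N : nat.
Hypothesis N0 : (0 < N)%N.
Variables (T : R) (v w : R -> R * R -> R * R) (L : R -> R).
Hypothesis T0 : 0 < T.
Hypothesis rv : regular_velocity l1 l2 T v w L.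
Variables (alpha : ('I_N -> R * R) -> R) (abar : R).
Hypothesis alpha_lip : loc_lipschitz l1 l2 alpha.
Hypothesis abar0 : 0 <= abar.
Hypothesis alpha_bd : forall X, distinct l1 l2 X -> 0 <= alpha X <= abar.
Notation mu := (@lebesgue_measure R).
Notation intg f := (mu.-integrable [set: R] (EFin \o f)).
Notation lattice := (lattice l1 l2).
Notation distinct := (distinct l1 l2).
Notation lR := (lR l1 l2).
Notation cdisp := (cdisp l1 l2).
Notation sep := (sep l1 l2).

Definition on_time (c : R) (t : R) : R := if t \in `[0, T]%classic then c else 0.

Lemma intg_on_time (c : R) : intg (on_time c).
Proof.
have -> : EFin \o on_time c = (EFin \o cst c) \_ `[0, T]%classic.
  by apply/funext => t; rewrite /on_time patchE /=; case: ifP.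
apply: (proj1 (integrable_mkcond _ _)); first exact: measurable_itv.
apply: measurable_bounded_integrable => //.
  by rewrite /= lebesgue_measure_itv/= lte_fin T0 oppr0 adde0 ltry.
by exists `|c|; split => // x cx y _ /=; exact: ltW.
Qed.

Lemma on_timeE (c t : R) : 0 <= t <= T -> on_time c t = c.
Proof. by move=> h; rewrite /on_time mem_set//= in_itv. Qed.

Lemma on_time_ge0 (c t : R) : 0 <= c -> 0 <= on_time c t.
Proof. by rewrite /on_time; case: ifP. Qed.

Definition rate (c t : R) : R := L t + on_time c t.

Lemma intg_rate c : intg (rate c).
Proof. by have := integrableD measurableT (rv_int rv) (intg_on_time c); apply. Qed.

Lemma rate_ge0 c t : 0 <= c -> 0 <= rate c t.
Proof. by move=> c0; rewrite addr_ge0 ?(rv_ge0 rv)// on_time_ge0. Qed.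

Lemma intgZ (k : R) f : intg f -> intg (fun t => k * f t).
Proof. by move=> jf; have := integrableZl measurableT k jf; apply. Qed.

Lemma intg0 : intg (fun=> 0 : R).
Proof. exact: integrable0. Qed.

Lemma prim_cst0 t : prim (fun=> 0 : R) t = 0.
Proof. by rewrite /prim /Rintegral integral0. Qed.

Lemma dotp_drift (e p q c d : R * R) (b : R) :
  dotp e (p + scale2 b c - (q + scale2 b d)) = dotp e (p - q) + b * dotp e c - b * dotp e d.
Proof. by rewrite /dotp /=; ring. Qed.

(* Both the velocity and the relaxation drift change the vector [e] joining two
   lifted generators at a rate at most proportional to [|e|]: the barycentre of a
   Voronoi cell lies on its own side of every bisector. *)
Lemma separation (X : R -> 'I_N -> R * R) (a : R -> R) :
  (forall i, abs_continuous T (fun t => X t i)) ->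
  (forall t, 0 <= a t <= abar) ->
  {ae mu, forall t : R, 0 < t < T -> (a t = 0 \/ distinct (X t)) /\
     forall i, has_velocity (fun s => X s i) t (w t (X t i) + scale2 (a t) (cdisp (X t) i))} ->
  forall t i j k, 0 <= t <= T -> lattice k ->
  enorm (X 0 i - X 0 j - k) * expR (- prim (rate abar) T) <= enorm (X t i - X t j - k).
Proof.
move=> aX a01 dX t i j k tT lk; pose e s := X s i - X s j - k.
have l0 s : 0 <= rate abar s by exact: rate_ge0.
(* Gronwall's inequality bounds [- |e|^2] from above, that is, [|e|] from below; hence the negative
   rate. *)
pose l s := (- 2) * rate abar s; have jl : intg l by apply: intgZ; exact: intg_rate.
have lE s : prim l s = - 2 * prim (rate abar) s by rewrite /l primZ//; exact: intg_rate.
have key := @gronwall R T (fun s => - enorm (e s) ^+ 2) l (fun=> 0) _ jl intg0 _ _ t tT.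
have {key} h : - enorm (e t) ^+ 2 * expR (- prim l t) <= - enorm (e 0) ^+ 2 + prim (fun=> 0) t.
  apply: key.
  - exact/ac_opp/ac_sq_dist.
  - by move=> s _; rewrite mulr0.
  apply: ae_sub dX => s h st; have [dX vX] := h st.
  have := is_derive_sq_dist k (vX i) (vX j); rewrite -/(e s) => dr.
  apply: incr_dini; first exact: is_derive_incr (is_deriveN dr).
  rewrite addr0 /l (_ : rate abar s = L s + abar); last first.
    by rewrite /rate on_timeE//; move/andP: st => [s1 s2]; rewrite !ltW.
  have [a0 a1] := andP (a01 s).
  have wL : - dotp (e s) (w s (X s i) - w s (X s j)) <= L s * enorm (e s) ^+ 2.
    have := dotp_le (e s) (w s (X s i) - w s (X s j)); rewrite ler_norml => /andP[h1 _].
    have h2 := rv_lip rv s (X s i) (X s j).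
    have h3 : tdist l1 l2 (X s i) (X s j) <= enorm (e s) by exact: tdist_le.
    have h4 : enorm (w s (X s i) - w s (X s j)) <= L s * enorm (e s).
      by apply: le_trans h2 _; apply: ler_wpM2l => //; exact: (rv_ge0 rv).
    have h5 := ler_wpM2l (enorm_ge0 (e s)) h4; rewrite mulrCA -expr2 in h5.
    by rewrite lerNl; apply: le_trans h1; rewrite lerN2.
  (* Each of the two centroids loses at most half of [abar |e|^2] against the common bisector;
     together this is the share of [abar] in the rate. *)
  have ai : - (a s * dotp (e s) (cdisp (X s) i)) <= abar * (enorm (e s) ^+ 2 / 2) /\
            a s * dotp (e s) (cdisp (X s) j) <= abar * (enorm (e s) ^+ 2 / 2).
    have e2 : 0 <= enorm (e s) ^+ 2 / 2 by rewrite divr_ge0// sqr_ge0.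
    have [->|dXs] := dX; first by rewrite !mul0r oppr0 mulr_ge0.
    have h1 := cdisp_sep hl i j dXs lk; rewrite -/(e s) in h1.
    have h2 := cdisp_sep hl j i dXs (latticeN lk).
    have ee : X s j - X s i - - k = - e s by rewrite /e; vring.
    rewrite ee enormN in h2.
    have h3 : dotp (- e s) (cdisp (X s) j) = - dotp (e s) (cdisp (X s) j) by rewrite /dotp /=; ring.
    rewrite h3 lerN2 in h2; rewrite lerNl in h1.
    split; last by apply: le_trans (ler_wpM2l a0 h2) _; exact: ler_wpM2r.
    by rewrite -mulrN; apply: le_trans (ler_wpM2l a0 h1) _; exact: ler_wpM2r.
  case: ai => ai aj.
  rewrite dotp_drift.
  have aux (p q r u c d : R) : - p <= c * u -> - q <= d * (u / 2) -> r <= d * (u / 2) ->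
    - (2 * (p + q - r)) <= -2 * (c + d) * - u by lra.
  exact: aux.
rewrite prim_cst0 addr0 lE in h.
rewrite (_ : - (-2 * prim (rate abar) t) = 2 * prim (rate abar) t) in h; last by ring.
rewrite mulNr lerN2 in h.
have p0 : 0 <= prim (rate abar) t by exact: prim_ge0.
have pT : prim (rate abar) t <= prim (rate abar) T.
  by apply: prim_mono => //; [exact: intg_rate|case/andP: tT].
apply: (@le_trans _ _ (enorm (e 0) * expR (- prim (rate abar) t))).
  by apply: ler_wpM2l; [exact: enorm_ge0|rewrite ler_expR lerN2].
rewrite -(@ler_pXn2r _ 2)// ?nnegrE ?mulr_ge0 ?enorm_ge0 ?expR_ge0//.
rewrite exprMn; apply: le_trans (ler_wpM2r (sqr_ge0 _) h) _.
rewrite -mulrA -expRM_natl -expRD (_ : _ + _ = 0) ?expR0 ?mulr1//.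
by rewrite -mulr_natl; ring.
Qed.

Lemma continuous_dom (I : finType) (f : I -> R -> R) (C : R) (g : R -> R) : 0 <= C ->
  (forall b, continuous (f b)) -> (forall s t, `|g s - g t| <= C * \sum_b `|f b s - f b t|) ->
  continuous g.
Proof.
move=> C0 cf gf t; apply/cvgrPdist_le => e e0.
pose n : R := #|I|%:R; have n0 : 0 <= n by exact: ler0n.
have c0 : 0 < C * n + 1 by rewrite ltr_wpDl// mulr_ge0.
have d0 : 0 < e / (C * n + 1) by rewrite divr_gt0.
have : \forall s \near t, forall b, `|f b t - f b s| <= e / (C * n + 1).
  have Ft : Filter (nbhs t) by exact: nbhs_filter.
  suff H b : \forall s \near t, `|f b t - f b s| <= e / (C * n + 1) by exact: (filter_forall Ft H).
  by have /cvgrPdist_le := cf b t; exact.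
apply: filterS => s hs; apply: le_trans (gf t s) _.
apply: (@le_trans _ _ (C * (n * (e / (C * n + 1))))).
  apply: ler_wpM2l => //; apply: le_trans (ler_sum _ (fun b _ => hs b)) _.
  by rewrite sumr_const mulr_natl.
rewrite !mulrA ler_pdivrMr// mulrDr mulr1 mulrC lerDl; exact: ltW.
Qed.

Lemma ae_forall_fin (I : finType) (P : I -> R -> Prop) :
  (forall i, {ae mu, forall t, P i t}) -> {ae mu, forall t, forall i, P i t}.
Proof. by move=> h; apply: filter_forall. Qed.

Lemma ac_add_cst (c : R) f : ac T f -> ac T (fun t => c + f t).
Proof.
move=> af e e0; have [d d0 h] := af e e0; exists d => // n a b h1 h2 h3.
under eq_bigr do rewrite opprD addrACA subrr add0r; exact: h h1 h2 h3.
Qed.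

Lemma config_bounded (Y : R -> 'I_N -> R * R) : (forall i, abs_continuous T (fun t => Y t i)) ->
  exists M : R, forall t, 0 <= t <= T -> forall i, enorm (Y t i) <= M.
Proof.
move=> aY; have aE i : ac T (fun t => enorm (Y t i)).
  have [a1 a2] := abs_continuous_ac (aY i).
  apply: (@ac_dom _ bool (fun b t => if b then (Y t i).1 else (Y t i).2) 1); first by case.
  move=> s t _ _; rewrite mul1r big_bool /=; apply: le_trans (enorm_sub_le _ _) _.
  exact: enorm_le_sum (Y s i - Y t i).
have [M hM] := ac_bounded (ac_sum aE); exists M => t /hM.
rewrite ger0_norm ?sumr_ge0// => [h i|i _]; last exact: enorm_ge0.
by apply: le_trans h; rewrite (bigD1 i)//= lerDl sumr_ge0// => j _; exact: enorm_ge0.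
Qed.

Lemma prim_zero_after (f : R -> R) t : intg f -> T <= t -> (forall s, T < s -> f s = 0) ->
  prim f t = prim f T.
Proof.
move=> jf Tt f0; apply/eqP; rewrite -subr_eq0; apply/eqP.
rewrite prim_sub//; last exact: ltW.
rewrite /Rintegral (eq_integral (cst 0%E)) ?integral0// => s.
by rewrite inE /= in_itv/= => /andP[h _]; rewrite f0.
Qed.

(** [caratheodory] concerns finite families of scalars, so a configuration is coded by its
    coordinates, indexed by ['I_N * bool]. *)
Definition pr (b : bool) (z : R * R) : R := if b then z.2 else z.1.
Definition unpack (x : 'I_N * bool -> R) (i : 'I_N) : R * R := (x (i, false), x (i, true)).

Lemma pr_le b z : `|pr b z| <= enorm z.
Proof. by case: b; [exact: enorm_snd|exact: enorm_fst]. Qed.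

Lemma prB b z z' : pr b (z - z') = pr b z - pr b z'. Proof. by case: b. Qed.
Lemma prD b z z' : pr b (z + z') = pr b z + pr b z'. Proof. by case: b. Qed.

Lemma dist1_unpack (x y : 'I_N * bool -> R) : dist1 (unpack x) (unpack y) <= \sum_b `|x b - y b|.
Proof.
have -> : \sum_b `|x b - y b| = \sum_i \sum_b `|x (i, b) - y (i, b)|.
  by rewrite pair_bigA; apply: eq_bigr => -[].
apply: ler_sum => i _; rewrite big_bool /= addrC; exact: enorm_le_sum (unpack x i - unpack y i).
Qed.

(** The field is clipped exactly at the separation and the size that its own trajectory is bound to
    keep: [separation] needs only [abar], which also bounds the clipped coefficient, and the speed
    is at most [l]. The clipped solution thus stays where the clipped and the original field
    agree. *)
Lemma flow_exists (X0 : 'I_N -> R * R) : distinct X0 -> exists X (r rho : R),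
  [/\ 0 < r, X 0 = X0,
      forall i, continuous (fun t => (X t i).1) /\ continuous (fun t => (X t i).2),
      forall t, sep r (X t) /\ forall i, enorm (X t i) <= rho &
      is_solution l1 l2 T v alpha X0 X].
Proof.
move=> dX0; have [r0 r00 sX0] := distinct_sep hl dX0.
pose r := r0 * expR (- prim (rate abar) T).
have r_gt0 : 0 < r by rewrite mulr_gt0 ?expR_gt0.
have rr0 : r <= r0.
  apply: ler_piMr; first exact: ltW.
  by rewrite -[leRHS]expR0 ler_expR oppr_le0; apply: prim_ge0 => s; exact: rate_ge0.
have lR0 := lR_ge0 l1 l2; pose l := rate (abar * lR).
have al0 : 0 <= abar * lR by exact: mulr_ge0.
have jl : intg l by exact: intg_rate.
have l_ge0 s : 0 <= l s by exact: rate_ge0.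
(* Each of the two coordinates of a generator moves by at most the integral of [l]. *)
pose rho := \sum_i enorm (X0 i) + 2 * \int[mu]_s l s.
have X0rho i : enorm (X0 i) + 2 * \int[mu]_s l s <= rho.
  by rewrite lerD2r (bigD1 i)//= lerDl sumr_ge0// => j _; exact: enorm_ge0.
have il0 : 0 <= \int[mu]_s l s by apply: Rintegral_ge0 => s _.
have sX0r : sep r X0 by move=> i j k lk h; apply: le_trans rr0 (sX0 i j k lk h).
have X0b i : enorm (X0 i) <= rho by apply: le_trans (X0rho i); rewrite lerDl mulr_ge0.
have [a [a01 adist aE [C C0 CP]]] := clipped_field hl N0 alpha_lip alpha_bd r_gt0 sX0r X0b.
have cdb X i : distinct X -> enorm (cdisp X i) <= lR.
  by move=> dX; apply: (cdisp_le hl dX) => //; exact: (@polygon_bounded _ _ _ hl _ X i).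
have ac_le X i : enorm (scale2 (a X) (cdisp X i)) <= abar * lR.
  have [a0 a1] := andP (a01 X); rewrite enorm_scale ger0_norm//.
  have [aX0|aX0] := eqVneq (a X) 0; first by rewrite aX0 mul0r.
  by apply: ler_pM => //; rewrite ?enorm_ge0//; apply: cdb; exact: adist.
pose W x i := scale2 (a (unpack x)) (cdisp (unpack x) i).
pose f t x (c : 'I_N * bool) : R :=
  if t \in `]0, T[%classic then pr c.2 (w t (unpack x c.1) + W x c.1) else 0.
have inT t : t \in `]0, T[%classic = (0 < t < T).
  by apply/idP/idP => [/set_mem|h]; [rewrite /= in_itv|apply/mem_set; rewrite /= in_itv].
have lT t c : 0 < t < T -> rate c t = L t + c.
  by move=> /andP[t0 tT]; rewrite /rate on_timeE// !ltW.
have Wlip x y i : enorm (W x i - W y i) <= C * \sum_b `|x b - y b|.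
  by apply: le_trans (CP _ _ _) _; apply: ler_wpM2l => //; exact: dist1_unpack.
have mf c (x : R -> 'I_N * bool -> R) : (forall b, continuous (x^~ b)) ->
    measurable_fun [set: R] (fun t => f t (x t) c).
  move=> cx; apply: measurable_if_in; [exact: measurable_itv| |exact: measurable_cst].
  case: c => i b /=.
  have -> : (fun t => pr b (w t (unpack (x t) i) + W (x t) i)) =
            (fun t => pr b (w t (unpack (x t) i)) + pr b (W (x t) i)).
    by apply/funext => t; rewrite prD.
  apply: measurable_funD.
    have [m1 m2] := rv_curve rv (x := fun t => unpack (x t) i) (cx (i, false)) (cx (i, true)).
    by rewrite /pr; case: b.
  apply: continuous_measurableR; apply: (@continuous_dom _ (fun b t => x t b) C) => // s t.
  by rewrite -prB; apply: le_trans (pr_le _ _) (Wlip _ _ _).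
have fl t x c : `|f t x c| <= l t.
  rewrite /f inT; case: ifP => [t0|_]; last by rewrite normr0.
  apply: le_trans (pr_le _ _) _; apply: le_trans (enormD _ _) _.
  by rewrite /l lT//; apply: lerD; [exact: rv_le rv _ _|exact: ac_le].
have flip t x y c : `|f t x c - f t y c| <= (l t + rate C t) * \sum_b `|x b - y b|.
  have S0 : 0 <= \sum_b `|x b - y b| by apply: sumr_ge0.
  have rC : 0 <= rate C t by exact: rate_ge0.
  rewrite /f inT; case: ifP => [t0|_]; last by rewrite subrr normr0 mulr_ge0// addr_ge0.
  rewrite -prB; apply: le_trans (pr_le _ _) _.
  set i := c.1.
  rewrite opprD addrACA; apply: le_trans (enormD _ _) _.
  rewrite mulrDl; apply: lerD; last first.
    by apply: le_trans (Wlip _ _ _) _; rewrite ler_wpM2r// lT// lerDr (rv_ge0 rv).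
  apply: le_trans (rv_lip rv _ _ _) _; apply: ler_pM; rewrite ?(rv_ge0 rv) ?tdist_ge0//.
    by rewrite /l lT// lerDl.
  apply: le_trans (tdist_le_enorm _ _ _ _) _; apply: le_trans (dist1_unpack _ _).
  exact: dist1_ge.
have jl2 : intg (fun t => l t + rate C t).
  by have := integrableD measurableT jl (intg_rate C); apply.
have fl2 t x c : `|f t x c| <= l t + rate C t.
  by apply: le_trans (fl _ _ _) _; rewrite lerDl rate_ge0.
pose x0 (c : 'I_N * bool) := pr c.2 (X0 c.1).
have [x [cx xE]] := caratheodory x0 jl2 mf fl2 flip.
have jf c : intg (fun s => f s (x s) c) by apply: intg_dom jl; [exact: mf|].
pose X t i := unpack (x t) i.
have X00 : X 0 = X0.
  by apply/funext => i; apply: pair_ext2; rewrite /X /= xE prim0 addr0.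
have Xac i : abs_continuous T (fun t => X t i).
  by apply: ac_abs_continuous => /=;
    under eq_fun do rewrite xE; apply: ac_add_cst; exact: prim_ac.
have xb t c : `|x t c - x0 c| <= \int[mu]_s l s.
  rewrite xE addrAC subrr add0r; apply: le_trans (prim_norm_le _ (jf c)) _.
  apply: (@le_trans _ _ (prim l t)); last exact: prim_le_total.
  apply: prim_le => //; by have := integrable_norm (jf c); apply.
have Xb t i : enorm (X t i) <= rho.
  apply: le_trans (X0rho i); rewrite -lerBlDl.
  apply: (@le_trans _ _ (enorm (X t i - X0 i))).
    by have := enorm_sub_le (X t i) (X0 i); rewrite ler_norml => /andP[].
  apply: le_trans (enorm_le_sum _) _.
  by rewrite [leRHS]mulr_natl mulr2n; apply: lerD; [exact: (xb t (i, false))|exact: (xb t (i, true))].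
have Xv : {ae mu, forall t : R, 0 < t < T -> forall i,
    has_velocity (fun s => X s i) t (w t (X t i) + scale2 (a (X t)) (cdisp (X t) i))}.
  have : {ae mu, forall t : R, forall c, 0 < t -> is_derive t 1 (prim (fun s => f s (x s) c)) (f t (x t) c)}.
    by apply: ae_forall_fin => c; exact: prim_derive.
  apply: ae_sub => t h tT i; have [t0 _] := andP tT.
  have key b : is_derive t 1 (fun s => x s (i, b)) (pr b (w t (X t i) + scale2 (a (X t)) (cdisp (X t) i))).
    have -> : (fun s => x s (i, b)) = cst (x0 (i, b)) + prim (fun s => f s (x s) (i, b)).
      by apply/funext => s; rewrite xE.
    apply: (is_derive_eq (is_deriveD (is_derive_cst _ _ _) (h (i, b) t0))).
    by rewrite add0r /f inT tT.
  by split; [exact: (key false)|exact: (key true)].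
have sXT t : 0 <= t <= T -> sep r (X t).
  move=> tT i j k lk ijk.
  have h := @separation X (fun t => a (X t)) Xac (fun t => a01 (X t)) _ t i j k tT lk.
  apply: le_trans (h _); last first.
    apply: ae_sub Xv => s hs sT; split; last exact: hs.
    by have [->|a0] := eqVneq (a (X s)) 0; [left|right; exact: adist].
  by rewrite X00 ler_wpM2r ?expR_ge0// sX0.
have T00 : 0 <= T by exact: ltW.
(* The field vanishes outside the open time interval and [prim] before time 0, so the curve is
   constant there and the separation extends to all real times. *)
have sX t : sep r (X t).
  have [t0|t0] := ltP t 0.
    suff -> : X t = X 0 by apply: sXT; rewrite lexx.
    by apply/funext => i; apply: pair_ext2; rewrite /X /= !xE prim0 prim_lt0.
  have [tT|/ltW tT] := leP t T; first by apply: sXT; rewrite t0.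
  suff -> : X t = X T by apply: sXT; rewrite T00 lexx.
  have z c s : T < s -> f s (x s) c = 0.
    by move=> Ts; rewrite /f inT (ltNge s T) (ltW Ts) andbF.
  by apply/funext => i; apply: pair_ext2; rewrite /X /= !xE (prim_zero_after (jf _) tT (z _)).
exists X, r, rho; split => //; first by move=> i; split; [exact: (cx (i, false))|exact: (cx (i, true))].
split => //; apply: ae_sub (ae_and Xv (rv_ae rv)) => t [h1 h2] tT.
split; first exact: sep_distinct r_gt0 (sX t).
by move=> i; rewrite -h2// -(aE _ (sX t) (Xb t)); exact: h1.
Qed.

Lemma solution_sep X0 (Y : R -> 'I_N -> R * R) : is_solution l1 l2 T v alpha X0 Y -> distinct X0 ->
  exists2 r : R, 0 < r & forall t, 0 <= t <= T -> sep r (Y t).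
Proof.
move=> [Y0 aY vY] dX0; have [r0 r00 sX0] := distinct_sep hl dX0.
exists (r0 * expR (- prim (rate abar) T)); first by rewrite mulr_gt0 ?expR_gt0.
move=> t tT i j k lk ijk.
(* A solution has distinct generators almost everywhere by definition; the value 0 at the remaining
   times keeps the coefficient within [abar] throughout. *)
pose a t := if pselect (distinct (Y t)) then alpha (Y t) else 0.
apply: le_trans (@separation Y a aY _ _ t i j k tT lk).
- by rewrite Y0 ler_wpM2r ?expR_ge0// sX0.
- by move=> s; rewrite /a; case: (pselect (distinct (Y s))) => [d|nd]; [exact: alpha_bd|rewrite lexx].
apply: ae_sub (ae_and vY (rv_ae rv)) => s [h1 h2] sT.
have [dYs h] := h1 sT; split; first by right.
by move=> i'; rewrite /a; case: (pselect (distinct (Y s))) => // d; rewrite h2.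
Qed.

Lemma sum_sum_add (u : 'I_N -> R) :
  \sum_(i < N) \sum_(j < N) (u i + u j) = 2 * (N%:R * \sum_(i < N) u i).
Proof.
under eq_bigr do rewrite big_split /= sumr_const card_ord.
by rewrite big_split /= sumr_const card_ord sumrMnl -(mulr_natl _ N); ring.
Qed.

(** Both solutions stay in one separated bounded set, so the same clipped, globally Lipschitz field
    drives both. Gronwall's inequality is applied to the sum of squared distances. *)
Lemma solution_unique X0 (X Y : R -> 'I_N -> R * R) : distinct X0 ->
  is_solution l1 l2 T v alpha X0 X -> is_solution l1 l2 T v alpha X0 Y ->
  forall t, 0 <= t <= T -> Y t = X t.
Proof.
move=> dX0 sX sY; have [rX rX0 hX] := solution_sep sX dX0; have [rY rY0 hY] := solution_sep sY dX0.
case: sX => X0E aX vX; case: sY => Y0E aY vY.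
have [MX bX] := config_bounded aX; have [MY bY] := config_bounded aY.
pose r := Num.min rX rY; pose M := Num.max MX MY.
have r0 : 0 < r by rewrite lt_min rX0.
have T00 : 0 <= T by exact: ltW.
have tX t : 0 <= t <= T -> sep r (X t) /\ forall i, enorm (X t i) <= M.
  move=> tT; split=> [i j k lk h|i]; last by apply: le_trans (bX t tT i) _; rewrite le_max lexx.
  by apply: le_trans (hX t tT i j k lk h); rewrite ge_min lexx.
have tY t : 0 <= t <= T -> sep r (Y t) /\ forall i, enorm (Y t i) <= M.
  move=> tT; split=> [i j k lk h|i]; last by apply: le_trans (bY t tT i) _; rewrite le_max lexx orbT.
  by apply: le_trans (hY t tT i j k lk h); rewrite ge_min lexx orbT.
have z0 : 0 <= (0 : R) <= T by rewrite lexx.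
have [a [a01 adist aE [C C0 CP]]] := clipped_field hl N0 alpha_lip alpha_bd r0 (tX 0 z0).1 (tX 0 z0).2.
pose g t := \sum_(i < N) enorm (X t i - Y t i - 0) ^+ 2.
have g0 t : 0 <= g t by apply: sumr_ge0 => i _; exact: sqr_ge0.
pose l t := 2 * rate (C * N%:R) t.
have CN : 0 <= C * N%:R by rewrite mulr_ge0.
have jl : intg l by apply: intgZ; exact: intg_rate.
have ag : ac T g by apply: ac_sum => i; exact: ac_sq_dist.
have dg : {ae mu, forall t : R, 0 < t < T -> dini_le g t (l t * g t + 0)}.
  apply: ae_sub (ae_and (ae_and vX vY) (rv_ae rv)) => t [[h1 h2] h3] tT.
  have [_ {}h1] := h1 tT; have [_ {}h2] := h2 tT; have {}h3 := h3 tT.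
  have tT' : 0 <= t <= T by move/andP: tT => [? ?]; rewrite !ltW.
  have d i := is_derive_sq_dist 0 (h1 i) (h2 i).
  have gE : g = \sum_(i < N) (fun s => enorm (X s i - Y s i - 0) ^+ 2).
    by apply/funext => s; rewrite /g fct_sumE.
  have := is_derive_sum d; rewrite -gE => /is_derive_incr/incr_dini; apply.
  pose e i := X t i - Y t i - 0.
  have eE i : enorm (e i) = enorm (X t i - Y t i) by rewrite /e subr0.
  apply: (@le_trans _ _ (\sum_(i < N) (2 * L t * enorm (e i) ^+ 2 +
      C * \sum_(j < N) (enorm (e i) ^+ 2 + enorm (e j) ^+ 2)))).
    apply: ler_sum => i _; rewrite -/(e i).
    rewrite -(aE _ (tX t tT').1 (tX t tT').2) -(aE _ (tY t tT').1 (tY t tT').2) -!h3.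
    rewrite opprD addrACA.
    set D := (_ - _) + (_ - _).
    have D1 : enorm D <= L t * enorm (e i) + C * \sum_(j < N) enorm (e j).
      apply: le_trans (enormD _ _) _; apply: lerD.
        apply: le_trans (rv_lip rv _ _ _) _; rewrite ler_wpM2l ?(rv_ge0 rv)// eE.
        exact: tdist_le_enorm.
      by apply: le_trans (CP _ _ _) _; rewrite ler_wpM2l// /dist1; under [leRHS]eq_bigr do rewrite eE.
    apply: (@le_trans _ _ (2 * (enorm (e i) * enorm D))).
      by rewrite ler_wpM2l//; apply: le_trans (ler_norm _) (dotp_le _ _).
    apply: (@le_trans _ _ (2 * (enorm (e i) * (L t * enorm (e i) + C * \sum_(j < N) enorm (e j))))).
      by rewrite ler_wpM2l// ler_wpM2l ?enorm_ge0.
    have -> : 2 * (enorm (e i) * (L t * enorm (e i) + C * \sum_(j < N) enorm (e j))) =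
       2 * L t * enorm (e i) ^+ 2 + C * (\sum_(j < N) (2 * enorm (e i) * enorm (e j))).
      by rewrite -mulr_sumr; ring.
    (* The mixed products are split by [2 a b <= a^2 + b^2]; summing over both indices gives the
       factor [2 * N] in the rate. *)
    rewrite lerD2l ler_wpM2l//; apply: ler_sum => j _.
    have := sqr_ge0 (enorm (e i) - enorm (e j)); rewrite sqrrB; lra.
  rewrite addr0 big_split /= -mulr_sumr -/(g t) -mulr_sumr.
  have -> : \sum_(i < N) \sum_(j < N) (enorm (e i) ^+ 2 + enorm (e j) ^+ 2) = 2 * (N%:R * g t).
    exact: sum_sum_add.
  rewrite /l /rate on_timeE// le_eqVlt; apply/orP; left; apply/eqP; ring.
have e0 t : 0 <= t <= T -> expR (- prim l t) * 0 <= (0 : R) by rewrite mulr0.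
have h := gronwall ag jl intg0 e0 dg.
move=> t tT; have := h t tT; rewrite prim_cst0 addr0.
have -> : g 0 = 0.
  by rewrite /g big1// => i _; rewrite X0E Y0E subrr subr0 enorm0 expr0n.
rewrite pmulr_lle0 ?expR_gt0// => gt0.
have gt : g t = 0 by apply/eqP; rewrite eq_le gt0 g0.
apply/funext => i; have /eqP := gt; rewrite psumr_eq0 => [/allP/(_ i)|j _]; last exact: sqr_ge0.
rewrite mem_index_enum /= => /(_ isT); rewrite expf_eq0 /= => /eqP/enorm_eq0.
by rewrite subr0 => /eqP; rewrite subr_eq0 => /eqP.
Qed.

End Dynamics.

(** * Energy estimates *)

Section EnergyEstimates.
Variables (R : realType) (l1 l2 : R * R).
Hypothesis hl : linindep l1 l2.
Variable N : nat.
Hypothesis N0 : (0 < N)%N.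
Variables (T : R) (v w : R -> R * R -> R * R) (L : R -> R).
Hypothesis T0 : 0 < T.
Hypothesis rv : regular_velocity l1 l2 T v w L.
Variables (alpha : ('I_N -> R * R) -> R) (abar : R).
Hypothesis alpha_lip : loc_lipschitz l1 l2 alpha.
Hypothesis alpha_bd : forall X, distinct l1 l2 X -> 0 <= alpha X <= abar.
Variables (X0 : 'I_N -> R * R) (X : R -> 'I_N -> R * R) (r rho : R).
Hypothesis r0 : 0 < r.
Hypothesis Xcont : forall i, continuous (fun t => (X t i).1) /\ continuous (fun t => (X t i).2).
Hypothesis XK : forall t, sep l1 l2 r (X t) /\ forall i, enorm (X t i) <= rho.
Hypothesis Xsol : is_solution l1 l2 T v alpha X0 X.
Notation mu := (@lebesgue_measure R).
Notation intg f := (mu.-integrable [set: R] (EFin \o f)).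
Notation distinct := (distinct l1 l2).
Notation lR := (lR l1 l2).
Notation cdisp := (cdisp l1 l2).
Notation sep := (sep l1 l2).
Notation parea := (parea l1 l2).
Notation mom := (mom l1 l2).
Notation F := (quant_energy l1 l2).
Notation G := (centroid_defect l1 l2).
Notation A := (torus_area l1 l2).

Lemma rho_ge0 : 0 <= rho.
Proof. exact: le_trans (enorm_ge0 _) ((XK 0).2 (Ordinal N0)). Qed.

Lemma X_distinct t : distinct (X t).
Proof. exact: sep_distinct r0 (XK t).1. Qed.
Arguments X_distinct : clear implicits.

Lemma config_continuous (phi : ('I_N -> R * R) -> R) (C : R) : 0 <= C ->
  (forall Y Z, sep r Y -> sep r Z -> (forall i, enorm (Y i) <= rho) -> (forall i, enorm (Z i) <= rho) ->
     `|phi Y - phi Z| <= C * dist1 Y Z) -> continuous (fun t => phi (X t)).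
Proof.
move=> C0 h; apply: (@continuous_dom _ _ (fun (b : 'I_N * bool) t => pr b.2 (X t b.1)) C) => //.
  by move=> [i []] /=; have [] := Xcont i.
move=> s t; have [s1 s2] := XK s; have [t1 t2] := XK t.
apply: le_trans (h _ _ s1 t1 s2 t2) _; apply: ler_wpM2l => //.
have -> : X s = unpack (fun b => pr b.2 (X s b.1)) by apply/funext => i; apply: pair_ext2.
have -> : X t = unpack (fun b => pr b.2 (X t b.1)) by apply/funext => i; apply: pair_ext2.
exact: dist1_unpack.
Qed.

Lemma alpha_continuous : continuous (fun t => alpha (X t)).
Proof.
have [C C0 CP] := alpha_lip_sep alpha_lip alpha_bd rho r0.
by apply: (config_continuous C0) => Y Z *; exact: CP.
Qed.

Lemma parea_continuous i : continuous (fun t => parea (X t) i).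
Proof.
have [C C0 CP] := parea_lip hl N r0 rho_ge0.
by apply: (config_continuous (phi := fun Y => parea Y i) C0) => Y Z *; exact: CP.
Qed.

Lemma cdisp_norm_continuous i : continuous (fun t => enorm (cdisp (X t) i)).
Proof.
have [C C0 CP] := cdisp_lip hl N r0 rho_ge0.
apply: (config_continuous (phi := fun Y => enorm (cdisp Y i)) C0) => Y Z *.
by apply: le_trans (enorm_sub_le _ _) _; exact: CP.
Qed.

Lemma continuous_mul (f g : R -> R) : continuous f -> continuous g -> continuous (fun t => f t * g t).
Proof. by move=> cf cg t; apply: cvgM; [exact: cf|exact: cg]. Qed.

Lemma continuous_sum (I : finType) (f : I -> R -> R) : (forall i, continuous (f i)) ->
  continuous (fun t => \sum_i f i t).
Proof.
move=> cf; apply: (@continuous_dom _ _ f 1) => // s t; rewrite mul1r -sumrB; exact: ler_norm_sum.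
Qed.

Lemma defect_continuous : continuous (fun t => G (X t)).
Proof.
have -> : (fun t => G (X t)) = (fun t => \sum_(i < N) parea (X t) i * (enorm (cdisp (X t) i) * enorm (cdisp (X t) i))).
  apply/funext => t; apply: eq_bigr => i _; by rewrite (cell_areaE hl i (X_distinct t)) expr2.
apply: continuous_sum => i; apply: continuous_mul; first exact: parea_continuous.
by apply: continuous_mul; exact: cdisp_norm_continuous.
Qed.

Lemma parea_le (Y : 'I_N -> R * R) i : distinct Y -> parea Y i <= A.
Proof.
move=> dY; rewrite -(sum_parea hl N0 dY) (bigD1 i)//= lerDl sumr_ge0// => j _; exact: parea_ge0.
Qed.

Lemma mom_le_area (Y : 'I_N -> R * R) i : distinct Y -> enorm (mom Y i) <= lR * A.
Proof.
move=> dY; apply: le_trans (mom_le hl (r := lR) _) _.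
  by move=> y; exact: (@polygon_bounded _ _ _ hl _ Y i).
by rewrite ler_wpM2l ?lR_ge0// parea_le.
Qed.

(** The semiconcavity inequality, used in both directions, is two-sided; on bounded configurations
    its quadratic term is dominated by a linear one. *)
Lemma energy_lip : exists2 C : R, 0 <= C & forall Y Z : 'I_N -> R * R, distinct Y -> distinct Z ->
  (forall i, enorm (Y i) <= rho) -> (forall i, enorm (Z i) <= rho) -> `|F Y - F Z| <= C * dist1 Y Z.
Proof.
have A0 : 0 <= A by exact: fine_ge0.
have lR0 := lR_ge0 l1 l2; have rho0 := rho_ge0.
exists (2 * (lR * A) + A * (2 * rho)); first by rewrite addr_ge0 ?mulr_ge0.
suff H (Y Z : 'I_N -> R * R) : distinct Y -> distinct Z -> (forall i, enorm (Y i) <= rho) -> (forall i, enorm (Z i) <= rho) ->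
    F Z - F Y <= (2 * (lR * A) + A * (2 * rho)) * dist1 Y Z.
  move=> Y Z dY dZ Yr Zr; rewrite ler_norml lerNl opprB; apply/andP; split; first exact: H.
  by rewrite dist1C; exact: H.
move=> dY dZ Yr Zr; have h : F Z - F Y <= - (2 * \sum_i dotp (Z i - Y i) (mom Y i)) + \sum_i parea Y i * enorm (Z i - Y i) ^+ 2.
  by rewrite lerBlDl addrA; exact: quant_energy_semiconcave.
apply: (le_trans h); rewrite [leRHS]mulrDl; apply: lerD.
  rewrite -mulrN -mulrA ler_wpM2l// -sumrN /dist1 mulr_sumr; apply: ler_sum => i _.
  apply: le_trans (ler_norm _) _; rewrite normrN; apply: le_trans (dotp_le _ _) _.
  by rewrite enormB mulrC ler_wpM2r ?enorm_ge0// mom_le_area.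
rewrite /dist1 mulr_sumr; apply: ler_sum => i _; rewrite -mulrA.
apply: ler_pM; [exact: parea_ge0|exact: sqr_ge0|exact: parea_le|].
rewrite enormB expr2 ler_wpM2r ?enorm_ge0// mulr_natl mulr2n.
by apply: le_trans (enormD _ _) _; rewrite enormN; exact: lerD.
Qed.

Lemma energy_ac : ac T (fun t => F (X t)).
Proof.
have [C C0 CP] := energy_lip; have [_ aX _] := Xsol.
apply: (@ac_dom _ ('I_N * bool)%type (fun b t => pr b.2 (X t b.1)) C).
  by move=> [i []] /=; have [] := abs_continuous_ac (aX i).
move=> s t _ _; have [s1 s2] := XK s; have [t1 t2] := XK t.
apply: le_trans (CP _ _ (X_distinct s) (X_distinct t) s2 t2) _; apply: ler_wpM2l => //.
have -> : X s = unpack (fun b => pr b.2 (X s b.1)) by apply/funext => i; apply: pair_ext2.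
have -> : X t = unpack (fun b => pr b.2 (X t b.1)) by apply/funext => i; apply: pair_ext2.
exact: dist1_unpack.
Qed.

Lemma has_velocity_cst (c : R * R) t : has_velocity (fun=> c) t 0.
Proof. by split; exact: is_derive_cst. Qed.

Lemma is_derive_dotp (x : R -> R * R) t p c : has_velocity x t p ->
  is_derive t 1 (fun s => dotp (x s) c) (dotp p c).
Proof.
move=> [x1 x2]; pose u1 s := (x s).1; pose u2 s := (x s).2.
have -> : (fun s => dotp (x s) c) = (cst c.1 * u1 + cst c.2 * u2).
  by apply/funext => s; rewrite /dotp mulrC (mulrC _ c.2).
have d1 : is_derive t 1 u1 p.1 by [].
have d2 : is_derive t 1 u2 p.2 by [].
apply: (is_derive_eq (is_deriveD (is_deriveM (is_derive_cst c.1 t 1) d1) (is_deriveM (is_derive_cst c.2 t 1) d2))).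
by rewrite !scaler0 !addr0 /dotp /GRing.scale /= mulrC (mulrC c.2).
Qed.

Lemma is_deriveZc (f : R -> R) (t c df : R) : is_derive t 1 f df -> is_derive t 1 (fun s => c * f s) (c * df).
Proof.
move=> hf; have -> : (fun s => c * f s) = cst c * f by [].
by apply: (is_derive_eq (is_deriveM (is_derive_cst c t 1) hf)); rewrite scaler0 addr0.
Qed.

(** The semiconcavity inequality based at [X t] gives a differentiable majorant of the increments of
    the energy, with equality at time [t]. Its quadratic part has zero derivative there, so only the
    pairing of the velocity with the moments remains. *)
Lemma energy_dini : {ae mu, forall t : R, 0 < t < T ->
  dini_le (fun t => F (X t)) t (4 * L t * F (X t) - 2 * (alpha (X t) * G (X t)))}.
Proof.
have [_ _ vX] := Xsol; apply: ae_sub (ae_and vX (rv_ae rv)) => t [h1 h2] tT.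
have [_ {}h1] := h1 tT; have {}h2 := h2 tT; have dX := X_distinct t.
pose V i := w t (X t i) + scale2 (alpha (X t)) (cdisp (X t) i).
have hV i : has_velocity (fun s => X s i) t (V i) by have := h1 i; rewrite -h2.
pose psi i s := (-2) * dotp (X s i) (mom (X t) i) + parea (X t) i * enorm (X s i - X t i - 0) ^+ 2.
have dpsi i : is_derive t 1 (psi i) ((-2) * dotp (V i) (mom (X t) i)).
  have e1 := is_derive_dotp (mom (X t) i) (hV i).
  have e2 := is_derive_sq_dist 0 (hV i) (has_velocity_cst (X t i) t).
  apply: (is_derive_eq (is_deriveD (is_deriveZc (-2) e1) (is_deriveZc (parea (X t) i) e2))).
  by rewrite subrr subr0 (_ : dotp 0 _ = 0) ?mulr0 ?addr0// /dotp /= !mul0r addr0.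
have := is_derive_sum dpsi => /is_derive_incr/incr_dini hd.
have bound : \sum_(i < N) (-2) * dotp (V i) (mom (X t) i) <=
    4 * L t * F (X t) - 2 * (alpha (X t) * G (X t)).
  have -> : 2 * (alpha (X t) * G (X t)) =
      \sum_(i < N) 2 * (alpha (X t) * dotp (cdisp (X t) i) (mom (X t) i)).
    by rewrite centroid_defectE// mulr_sumr mulr_sumr.
  have := @drift_bound _ _ _ hl _ N0 (X t) (w t) (L t) (L t) dX (rv_ge0 rv t) (rv_per rv t) (rv_le rv t).
  have wl y z : enorm (w t y - w t z) <= L t * enorm (y - z).
    by apply: le_trans (rv_lip rv _ _ _) _; rewrite ler_wpM2l ?(rv_ge0 rv)// tdist_le_enorm.
  move=> /(_ wl) db.
  have -> : \sum_(i < N) (-2) * dotp (V i) (mom (X t) i) =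
      2 * - (\sum_i dotp (w t (X t i)) (mom (X t) i)) -
      \sum_(i < N) 2 * (alpha (X t) * dotp (cdisp (X t) i) (mom (X t) i)).
    rewrite -sumrN mulr_sumr -sumrB; apply: eq_bigr => i _.
    by rewrite /V /dotp /=; ring.
  by rewrite lerD2r; move: db; move: (\sum_i _) => p; lra.
have {}hd := hd _ bound; move=> e e0; have [d d0 hd'] := hd e e0; exists d => // k kd.
apply: le_trans (hd' k kd).
have := quant_energy_semiconcave hl N0 dX (X_distinct (t + k)).
move=> h; apply: (@le_trans _ _ (- (2 * \sum_i dotp (X (t + k) i - X t i) (mom (X t) i)) +
    \sum_i parea (X t) i * enorm (X (t + k) i - X t i) ^+ 2)).
  by rewrite lerBlDl addrA.
rewrite !fct_sumE -sumrB mulr_sumr -sumrN -big_split /=; apply: ler_sum => i _.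
rewrite /psi subrr !subr0 enorm0 expr0n mulr0 addr0.
have -> : dotp (X (t + k) i - X t i) (mom (X t) i) = dotp (X (t + k) i) (mom (X t) i) - dotp (X t i) (mom (X t) i).
  by rewrite /dotp /=; ring.
rewrite le_eqVlt; apply/orP; left; apply/eqP.
by move: (dotp _ _) (dotp _ _) => a b; ring.
Qed.

(** Gronwall's inequality takes rates integrable on the whole line; the extension by 0 makes
    continuous functions on the time interval such rates. *)
Definition clip_time (f : R -> R) (t : R) : R := if t \in `[0, T]%classic then f t else 0.

Lemma clip_timeE f t : 0 <= t <= T -> clip_time f t = f t.
Proof. by move=> tT; rewrite /clip_time mem_set//= in_itv. Qed.

Lemma intg_clip_time f : continuous f -> intg (clip_time f).
Proof.
move=> cf; have -> : EFin \o clip_time f = (EFin \o f) \_ `[0, T]%classic.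
  by apply/funext => t; rewrite /clip_time patchE /=; case: ifP.
apply: (proj1 (integrable_mkcond _ _)); first exact: measurable_itv.
apply: continuous_compact_integrable; first exact: segment_compact.
exact: continuous_subspaceT.
Qed.

Lemma integral_clip_time f : continuous f -> (\int[mu]_(t in `[0%R, T]) (f t)%:E = (prim (clip_time f) T)%:E)%E.
Proof.
move=> cf; rewrite /prim /Rintegral fineK; last first.
  apply: integrable_fin_num => //; apply: integrableS (intg_clip_time cf) => //.
by apply: eq_integral => t /[!inE]/= /[!in_itv]/= tT; rewrite clip_timeE.
Qed.

Lemma alphaG_continuous : continuous (fun t => alpha (X t) * G (X t)).
Proof. by apply: continuous_mul; [exact: alpha_continuous|exact: defect_continuous]. Qed.

Lemma alphaG_ge0 t : 0 <= clip_time (fun t => alpha (X t) * G (X t)) t.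
Proof.
rewrite /clip_time; case: ifP => // _; apply: mulr_ge0; last exact: centroid_defect_ge0.
by case/andP: (alpha_bd (X_distinct t)).
Qed.

Lemma energy_estimate t : 0 <= t <= T ->
  F (X t) + 2 * prim (clip_time (fun t => alpha (X t) * G (X t))) t <= F X0 * expR (4 * prim L T).
Proof.
move=> tT; set q := clip_time _.
have jq : intg q by apply: intg_clip_time; exact: alphaG_continuous.
have q0 s : 0 <= q s by exact: alphaG_ge0.
(* Adding twice the accumulated dissipation cancels the term [- 2 alpha G], and the added amount is
   nonnegative, so [4 L F <= 4 L g]. The double minus fits [dini_sub]. *)
pose g s := F (X s) - (-2) * prim q s.
have jl : intg (fun s => 4 * L s) by apply: intgZ; exact: rv_int rv.
have ag : ac T g.
  apply: ac_sub; first exact: energy_ac.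
  apply: (@ac_dom _ unit (fun=> prim q) 2); first by move=> _; exact: prim_ac.
  move=> s s' _ _; rewrite (_ : \sum_i _ = `|prim q s - prim q s'|); last by rewrite big_const card_unit /= addr0.
  have n2 : `|-2| = 2 :> R by rewrite normrN gtr0_norm.
  by rewrite -mulrBr normrM n2.
have dg : {ae mu, forall t : R, 0 < t < T -> dini_le g t (4 * L t * g t + 0)}.
  apply: ae_sub (ae_and energy_dini (prim_derive jq)) => s [h1 h2] sT.
  have {}h1 := h1 sT; have {}h2 := h2 (proj1 (andP sT)).
  have h3 := dini_sub h1 (is_derive_incr (is_deriveZc (-2) h2)).
  have sT' : 0 <= s <= T by move/andP: sT => [? ?]; rewrite !ltW.
  move=> e e0; have [d d0 hd] := h3 e e0; exists d => // k kd.
  apply: le_trans (hd k kd) _; rewrite ler_pM2r; last by case/andP: kd.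
  rewrite lerD2r {1}/q clip_timeE// addr0 /g.
  have := mulr_ge0 (rv_ge0 rv s) (prim_ge0 s q0); rewrite mulNr opprK.
  by move: (alpha _ * _) (L s) (F _) (prim q s) => a b c p h; nra.
have e0 s : 0 <= s <= T -> expR (- prim (fun s => 4 * L s) s) * 0 <= (0 : R) by rewrite mulr0.
have pE s : prim (fun s => 4 * L s) s = 4 * prim L s by apply: primZ; exact: rv_int rv.
have := gronwall ag jl (intg0 R) e0 dg tT.
have [X00 _ _] := Xsol.
have g0 : g 0 = F X0 by rewrite /g prim0 mulr0 subr0 X00.
rewrite prim_cst0 addr0 pE g0 => h.
rewrite (_ : F (X t) + 2 * prim q t = F (X t) - -2 * prim q t); last by rewrite mulNr opprK.
have -> : F (X t) - -2 * prim q t = (F (X t) - -2 * prim q t) * expR (- (4 * prim L t)) * expR (4 * prim L t).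
  by rewrite -mulrA -expRD addNr expR0 mulr1.
apply: ler_pM; rewrite ?expR_ge0//; last first.
  by rewrite ler_expR ler_wpM2l// prim_mono//; [exact: rv_int rv|exact: rv_ge0 rv|case/andP: tT].
rewrite mulr_ge0 ?expR_ge0// mulNr opprK addr_ge0 ?quant_energy_ge0// mulr_ge0//.
exact: prim_ge0.
Qed.

(** * Bounds in powers of [s], the fourth root of [h] *)

Variables (C1 h s kap : R).
Hypothesis s0 : 0 < s.
Hypothesis hE : h = s ^+ 4.
Hypothesis FX0 : F X0 <= C1 * h ^+ 2.
Hypothesis alpha_defect : forall Y, distinct Y -> alpha Y <= G Y / s ^+ 10.
Hypothesis kap0 : 0 < kap.
Hypothesis kap_energy : forall (Y : 'I_N -> R * R) y, distinct Y -> kap * nd l1 l2 Y y ^+ 4 <= F Y.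

Let c : R := Num.max C1 0 * expR (4 * prim L T).
Let q : R -> R := clip_time (fun t => alpha (X t) * G (X t)).

Let s_ge0 : 0 <= s. Proof. exact: ltW. Qed.

Let c0 : 0 <= c. Proof. by rewrite mulr_ge0 ?expR_ge0// le_max lexx orbT. Qed.

Let jq : intg q. Proof. by apply: intg_clip_time; exact: alphaG_continuous. Qed.

Let primq0 t : 0 <= prim q t. Proof. by apply: prim_ge0 => u; exact: alphaG_ge0. Qed.

Lemma energy_bound t : 0 <= t <= T -> F (X t) + 2 * prim q t <= c * s ^+ 8.
Proof.
move=> tT; apply: le_trans (energy_estimate tT) _; rewrite /c mulrAC.
apply: ler_wpM2r; first exact: expR_ge0.
apply: le_trans FX0 _; rewrite hE -exprM; apply: ler_wpM2r; first by rewrite exprn_ge0// ltW.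
by rewrite le_max lexx.
Qed.

Lemma energy_sup_bound : (ereal_sup [set (F (X t))%:E | t in `[0%R, T]]
  + \int[mu]_(t in `[0%R, T]) (alpha (X t) * G (X t))%:E <= (2 * c * h ^+ 2)%:E)%E.
Proof.
have TT : 0 <= T <= T by rewrite lexx ltW.
rewrite (integral_clip_time alphaG_continuous) -/q hE -exprM mulrAC -mulrA (mulrC 2) mulr_natr mulr2n EFinD.
have c8 : 0 <= c * s ^+ 8 by rewrite mulr_ge0// exprn_ge0// ltW.
apply: leeD.
  apply: ge_ereal_sup => _ [t /= tT <-]; rewrite in_itv/= in tT; rewrite lee_fin mulrC.
  by have := energy_bound tT; have := primq0 t; move: (prim q t) (F _) => a b; lra.
rewrite lee_fin mulrC; have := energy_bound TT; have := primq0 T.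
by have := quant_energy_ge0 l1 l2 (X T); move: (prim q T) (F _) (c * _) => a b d; lra.
Qed.

(** The fourth power of [nd] is at most [c / kap * s^8]; with [x = c / kap], the inequality
    [x <= (x + 1)^4] avoids a fourth root in the constant. *)
Lemma nd_bound t y : 0 <= t <= T -> nd l1 l2 (X t) y <= (c / kap + 1) * s ^+ 2.
Proof.
move=> tT; have ck0 : 0 <= c / kap by rewrite divr_ge0// ltW.
have s2 : 0 <= s ^+ 2 by rewrite exprn_ge0// ltW.
rewrite -(@ler_pXn2r _ 4)// ?nnegrE ?nd_ge0 ?mulr_ge0 ?addr_ge0//.
apply: (@le_trans _ _ (c / kap * s ^+ 8)).
  rewrite mulrAC ler_pdivlMr// mulrC; apply: le_trans (kap_energy _ (X_distinct t)) _.
  by have := energy_bound tT; have := primq0 t; move: (prim q t) (F _) (c * _) => a b d; lra.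
rewrite exprMn -exprM; apply: ler_wpM2r; first exact: exprn_ge0.
by move: (c / kap) ck0 => x x0; nra.
Qed.

Lemma cdisp_bound t i : 0 <= t <= T -> enorm (cdisp (X t) i) <= (c / kap + 1) * s ^+ 2.
Proof.
move=> tT; apply: (cdisp_le hl (X_distinct t)).
  by apply: mulr_ge0; [rewrite addr_ge0// divr_ge0// ltW|exact: exprn_ge0].
by move=> y Py; rewrite -(polygon_nd hl Py); exact: nd_bound.
Qed.

Lemma diam_sup_bound : (ereal_sup [set (max_diam l1 l2 (X t))%:E | t in `[0%R, T]]
  <= (2 * (c / kap + 1) * s ^+ 2)%:E)%E.
Proof.
apply: ge_ereal_sup => _ [t /= tT <-]; rewrite in_itv/= in tT; rewrite lee_fin -mulrA.
by apply: (max_diam_le hl (X_distinct t)) => y; exact: nd_bound.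
Qed.

Lemma prim_on_time (k : R) : prim (on_time T k) T = k * T.
Proof.
rewrite /prim (@eq_Rintegral _ _ _ mu _ (cst k)); last first.
  by move=> t /[!inE]/= /[!in_itv]/= tT; rewrite on_timeE.
rewrite Rintegral_cst//= lebesgue_measure_itv/= lte_fin T0 /=; congr (k * _).
by rewrite subr0.
Qed.

(** The weights of Young's inequality make both halves of order [1/s]:
    [2 alpha s^9 <= s^8 + alpha^2 s^10], where [alpha s^10 <= G], and the integral of [alpha G] is
    at most [c s^8 / 2]. *)
Lemma alpha_integral_bound : prim (clip_time (fun t => alpha (X t))) T <= (T / 2 + c / 4) * s^-1.
Proof.
have TT : 0 <= T <= T by rewrite lexx ltW.
have jo := @intg_on_time R T T0 (s^-1 / 2).
have jk := intgZ (s ^- 9 / 2) jq.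
have js : intg (fun t => on_time T (s^-1 / 2) t + s ^- 9 / 2 * q t).
  by have := integrableD measurableT jo jk; apply.
have ja := intg_clip_time alpha_continuous.
have le1 t : clip_time (fun t => alpha (X t)) t <= on_time T (s^-1 / 2) t + s ^- 9 / 2 * q t.
  rewrite /clip_time /q /on_time /clip_time; case: ifP => _; last by rewrite mulr0 addr0.
  have /andP[a0 _] := alpha_bd (X_distinct t).
  have := alpha_defect (X_distinct t); rewrite ler_pdivlMr ?exprn_gt0// => ag.
  have h1 : alpha (X t) * (alpha (X t) * s ^+ 10) <= alpha (X t) * G (X t) by rewrite ler_wpM2l.
  have s9 : 0 < s ^+ 9 by rewrite exprn_gt0.
  rewrite -(ler_pM2r s9).
  have -> : (s^-1 / 2 + s ^- 9 / 2 * (alpha (X t) * G (X t))) * s ^+ 9 =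
      (s ^+ 8 + alpha (X t) * G (X t)) / 2 by field; rewrite gt_eqF.
  rewrite ler_pdivlMr//; apply: (@le_trans _ _ (s ^+ 8 + alpha (X t) * (alpha (X t) * s ^+ 10))).
    rewrite -subr_ge0 (_ : _ - _ = (s ^+ 4 - alpha (X t) * s ^+ 5) ^+ 2) ?sqr_ge0//; ring.
  by rewrite lerD2l.
apply: le_trans (prim_le T ja js le1) _.
have -> : prim (fun t => on_time T (s^-1 / 2) t + s ^- 9 / 2 * q t) T =
    prim (on_time T (s^-1 / 2)) T + prim (fun t => s ^- 9 / 2 * q t) T.
  by rewrite /prim RintegralD//; apply: integrableS (_ : measurable setT) _ _ _ => //.
rewrite prim_on_time primZ// [leRHS]mulrDl; apply: lerD.
  by rewrite le_eqVlt; apply/orP; left; apply/eqP; ring.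
rewrite (_ : c / 4 * s^-1 = s ^- 9 / 2 * (c * s ^+ 8 / 2)); last by field; rewrite gt_eqF.
apply: ler_wpM2l; first by rewrite divr_ge0// invr_ge0 exprn_ge0// ltW.
have := energy_bound TT; have := quant_energy_ge0 l1 l2 (X T).
by move: (prim q T) (F _) (c * _) => a b d; lra.
Qed.

Lemma alpha_ge0_bound : (\int[mu]_(t in `[0%R, T]) (alpha (X t))%:E <= ((T / 2 + c / 4) * s^-1)%:E)%E.
Proof. by rewrite (integral_clip_time alpha_continuous) lee_fin; exact: alpha_integral_bound. Qed.

(** With [alpha = G / s^10] and [h = s^4], the squared ratio equals [s^-6 alpha G], so the
    dissipation bound applies directly. *)
Lemma defect_sq_bound : (forall Y, distinct Y -> alpha Y = G Y / s ^+ 10) ->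
  (\int[mu]_(t in `[0%R, T]) ((G (X t) / h ^+ 2) ^+ 2)%:E <= (c / 2 * s ^+ 2)%:E)%E.
Proof.
move=> aE; have TT : 0 <= T <= T by rewrite lexx ltW.
have -> : (fun t => ((G (X t) / h ^+ 2) ^+ 2)%:E) = fun t => (s ^- 6 * (alpha (X t) * G (X t)))%:E.
  apply/funext => t; congr (_%:E); rewrite (aE _ (X_distinct t)) hE; field.
  by rewrite gt_eqF.
have cont : continuous (fun t => s ^- 6 * (alpha (X t) * G (X t))).
  by apply: continuous_mul; [move=> t; exact: cvg_cst|exact: alphaG_continuous].
rewrite (integral_clip_time cont) lee_fin.
have -> : clip_time (fun t => s ^- 6 * (alpha (X t) * G (X t))) = fun t => s ^- 6 * q t.
  by apply/funext => t; rewrite /q /clip_time; case: ifP; rewrite ?mulr0.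
rewrite primZ// (_ : c / 2 * s ^+ 2 = s ^- 6 * (c * s ^+ 8 / 2)); last by field; rewrite gt_eqF.
apply: ler_wpM2l; first by rewrite invr_ge0 exprn_ge0// ltW.
have := energy_bound TT; have := quant_energy_ge0 l1 l2 (X T).
by move: (prim q T) (F _) (c * _) => a b d; lra.
Qed.

End EnergyEstimates.

(** * Couplings and the Wasserstein distance *)

Section WeightedPushforward.
Context d1 d2 (T1 : measurableType d1) (T2 : measurableType d2) (R : realType).
Variables (mu : {measure set T1 -> \bar R}) (f : T1 -> \bar R) (phi : T1 -> T2).

(** The image under [phi] of the measure with density [f]. The proofs are carried in the term so
    that a measure structure can be attached to it. *)
Definition wpush (mf : measurable_fun [set: T1] f) (f0 : forall x, (0 <= f x)%E)
  (mphi : measurable_fun [set: T1] phi) (E : set T2) : \bar R :=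
  (\int[mu]_(x in phi @^-1` E) f x)%E.

Variables (mf : measurable_fun [set: T1] f) (f0 : forall x, (0 <= f x)%E).
Variable mphi : measurable_fun [set: T1] phi.
Notation pi := (wpush mf f0 mphi).

Let pi0 : pi set0 = 0%E.
Proof. by rewrite /wpush preimage_set0 integral_set0. Qed.

Let pi_ge0 E : (0 <= pi E)%E.
Proof. by apply: integral_ge0 => x _; exact: f0. Qed.

Let pi_sigma : semi_sigma_additive pi.
Proof.
move=> F mF tF mUF; rewrite /wpush preimage_bigcup.
have mpF k : measurable (phi @^-1` (F k)) by rewrite -[X in measurable X]setTI; exact: mphi.
rewrite ge0_integral_bigcup//.
- apply: is_cvg_ereal_nneg_natsum => k _; exact: pi_ge0.
- exact: measurable_funTS.
- apply/trivIsetP => i j _ _ ij; rewrite -preimage_setI.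
  by move/trivIsetP : tF => -> //; rewrite preimage_set0.
Qed.

HB.instance Definition _ := isMeasure.Build _ _ _ pi pi0 pi_ge0 pi_sigma.

(** The set where [g] exceeds [K] is reached by [phi] only from points of density 0, so it is null
    for the image measure. *)
Lemma wpush_ge0_integral_le (g : T2 -> R) (K : R) : measurable_fun [set: T2] g ->
  (forall y, 0 <= g y) -> 0 <= K -> (forall x, f x != 0%E -> g (phi x) <= K) ->
  (\int[pi]_y (g y)%:E <= K%:E * pi setT)%E.
Proof.
move=> mg g0 K0 gK; pose B := [set y | g y <= K].
have mB : measurable B.
  have -> : B = g @^-1` `]-oo, K]%classic by apply/seteqP; split => y /=; rewrite in_itv.
  by rewrite -[X in measurable X]setTI; exact: mg.
have piN : pi (~` B) = 0%E.
  rewrite /= /wpush (eq_integral (cst 0%E)) ?integral0// => x; rewrite inE /= => hB.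
  by apply/eqP; apply: contrapT => /negP fx; apply: hB; exact: gK.
have mgE : measurable_fun [set: T2] (EFin \o g) by exact/measurable_EFinP.
have := @ge0_negligible_integral _ _ _ pi setT (~` B) (EFin \o g) (measurableC mB) measurableT mgE
  (fun y _ => g0 y) piN.
rewrite setTD setCK => ->.
apply: (@le_trans _ _ (\int[pi]_(y in B) cst K%:E y)%E).
  apply: ge0_le_integral => //.
  - by move=> y _; rewrite /= lee_fin.
  - exact: measurable_funTS.
rewrite integral_cst//; apply: lee_wpmul2l; first by rewrite lee_fin.
by apply: le_measure; rewrite ?inE.
Qed.

End WeightedPushforward.

Section TorusMeasurability.
Variables (R : realType) (l1 l2 : R * R).
Hypothesis hl : linindep l1 l2.
Notation torus := (torus l1 l2).
Notation tdist := (tdist l1 l2).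
Notation leb := (leb2 R).

Lemma measurable_to_torus d (T : measurableType d) (f : T -> R * R) :
  measurable_fun [set: T] (f : T -> plane R) -> measurable_fun [set: T] (f : T -> torus).
Proof.
move=> mf.
apply: (@measurability _ _ T torus setT f
  [set A : set (R * R) | measurable (A : set (plane R)) /\ Defs.periodic l1 l2 A]) => //.
by move=> _ [A [mA _] <-]; exact: mf.
Qed.

Lemma torus_set_plane (A : set torus) : measurable A -> measurable (A : set (plane R)).
Proof.
move=> mA; have := @measurable_to_torus _ (plane R) id (@measurable_id _ _ _) measurableT A mA.
by rewrite setTI.
Qed.

Lemma measurable_tdist_torus q : measurable_fun [set: torus] (fun z : torus => tdist z q).
Proof.
move=> _ B mB; rewrite setTI; apply: sub_gen_smallest; split.
  have := measurable_tdist hl q measurableT mB; rewrite setTI; exact.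
by move=> x k lk; rewrite /preimage /= tdistDl.
Qed.

(** Joint measurability for the product of two torus sigma-algebras: the distance is the infimum,
    over rational points, of the sum of the distances of the two arguments to that point. *)
Lemma measurable_tdist2 : measurable_fun [set: torus * torus] (fun z => tdist z.1 z.2).
Proof.
pose h n (z : torus * torus) := tdist z.1 (qpt R n) + tdist z.2 (qpt R n).
apply: (@measurable_inf_seq _ _ _ h).
- move=> n; apply: measurable_funD.
    exact: (measurableT_comp (measurable_tdist_torus (qpt R n)) measurable_fst).
  exact: (measurableT_comp (measurable_tdist_torus (qpt R n)) measurable_snd).
- move=> n z; rewrite /h (tdistC hl z.2); exact: tdist_triangle.
- move=> z e e0; have e2 : 0 < e / 2 by rewrite divr_gt0.
  have [n qn] := qpt_dense z.2 e2; exists n; rewrite /h.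
  have h1 := tdist_le_enorm l1 l2 z.2 (qpt R n).
  have h2 := tdist_triangle hl z.2 z.1 (qpt R n).
  by move: (tdist z.1 _) (tdist z.2 _) (tdist z.1 z.2) (enorm _) h1 h2 qn => a b c u; lra.
Qed.

(* [leb2] is bundled as a bare measure; Tonelli's theorem needs it as a
   sigma-finite one. *)
Definition lebp (A : set (plane R)) : \bar R := leb A.

Let lebp0 : lebp set0 = 0%E. Proof. exact: measure0. Qed.
Let lebp_ge0 A : (0 <= lebp A)%E. Proof. exact: measure_ge0. Qed.
Let lebp_sigma : semi_sigma_additive lebp. Proof. exact: measure_semi_sigma_additive. Qed.

HB.instance Definition _ := isMeasure.Build _ _ _ lebp lebp0 lebp_ge0 lebp_sigma.

Let lebp_sigma_finite : sigma_finite setT lebp.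
Proof.
exists (fun n => box (0 : R * R) n%:R); last first.
  by move=> n; split; [exact: measurable_box|rewrite /lebp leb2_boxE// ltry].
apply/seteqP; split => // z _; have [n _ hn] := nbhs_infty_ger (enorm z).
by exists n => //; apply: box_enorm; rewrite subr0; exact: (hn n (leqnn n)).
Qed.

HB.instance Definition _ := Measure_isSigmaFinite.Build _ _ _ lebp lebp_sigma_finite.

Lemma integral_product (g rho : plane R -> R) :
  measurable_fun [set: plane R] g -> measurable_fun [set: plane R] rho ->
  (forall y, 0 <= g y) -> (forall z, 0 <= rho z) ->
  (\int[lebp \x lebp]_p (g p.1 * rho p.2)%:E = (\int[leb]_y (g y)%:E) * (\int[leb]_z (rho z)%:E))%E.
Proof.
move=> mg mr g0 r0.
rewrite fubini_tonelli1/=; last 2 first.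
- apply/measurable_EFinP; apply: measurable_funM.
    exact: (measurableT_comp mg measurable_fst).
  exact: (measurableT_comp mr measurable_snd).
- by move=> p; rewrite lee_fin mulr_ge0.
transitivity (\int[lebp]_y ((g y)%:E * \int[lebp]_z (rho z)%:E))%E.
  apply: eq_integral => y _; rewrite /fubini_F /=; under eq_integral do rewrite EFinM.
  apply: ge0_integralZl => //; first exact/measurable_EFinP.
    by move=> z _; rewrite lee_fin.
  by rewrite lee_fin.
apply: ge0_integralZr => //; first exact/measurable_EFinP.
- by move=> y _; rewrite lee_fin.
- by apply: integral_ge0 => z _; rewrite lee_fin.
Qed.

Section Coupling.
Variables (I : finType) (g rho : I -> plane R -> R) (Psi : R * R -> R * R).
Hypotheses (mg : forall i, measurable_fun [set: plane R] (g i))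
  (mrho : forall i, measurable_fun [set: plane R] (rho i))
  (g0 : forall i y, 0 <= g i y) (rho0 : forall i z, 0 <= rho i z)
  (mPsi : measurable_fun [set: plane R] (Psi : plane R -> plane R)).

Lemma measurable_restrict0 (f : plane R -> R) (A : set (plane R)) : measurable A ->
  measurable_fun [set: plane R] f -> measurable_fun [set: plane R] (f \_ A).
Proof.
by move=> mA mf; apply: (proj1 (measurable_restrictT _ _)) => //; exact: measurable_funTS.
Qed.

Lemma restrict0_ge0 (f : plane R -> R) (A : set (plane R)) z : (forall z, 0 <= f z) -> 0 <= (f \_ A) z.
Proof. by move=> f0; rewrite patchE; case: ifP. Qed.

Lemma integral_restrict0 (f : plane R -> R) (A : set (plane R)) :
  (\int[leb]_z ((f \_ A) z)%:E = \int[leb]_(z in A) (f z)%:E)%E.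
Proof.
rewrite [RHS]integral_mkcond; apply: eq_integral => z _; rewrite !patchE; by case: ifP.
Qed.

Lemma coupling_exists : exists pi : {measure set (torus * torus) -> \bar R},
  [/\ forall A : set torus, measurable A ->
        pi (A `*` setT) = (\sum_i (\int[leb]_(y in (A : set (plane R))) (g i y)%:E) * (\int[leb]_z (rho i z)%:E))%E,
      forall A : set torus, measurable A ->
        pi (setT `*` A) = (\sum_i (\int[leb]_y (g i y)%:E) *
          (\int[leb]_(z in (Psi @^-1` A : set (plane R))) (rho i z)%:E))%E &
      forall K : R, 0 <= K ->
        (forall i y z, g i y != 0 -> rho i z != 0 -> tdist y (Psi z) <= K) ->
        (\int[pi]_z (tdist z.1 z.2)%:E <= K%:E * pi setT)%E].
Proof.
pose f (p : plane R * plane R) : \bar R := (\sum_i g i p.1 * rho i p.2)%:E.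
have mf : measurable_fun [set: plane R * plane R] f.
  apply/measurable_EFinP; apply: measurable_sum => i; apply: measurable_funM.
    exact: (measurableT_comp (mg i) measurable_fst).
  exact: (measurableT_comp (mrho i) measurable_snd).
have f0 p : (0 <= f p)%E by rewrite lee_fin sumr_ge0// => i _; rewrite mulr_ge0.
pose phi (p : plane R * plane R) : torus * torus := ((p.1 : R * R) : torus, Psi p.2 : torus).
have mphi : measurable_fun [set: plane R * plane R] phi.
  apply: measurable_fun_pair; apply: measurable_to_torus; first exact: measurable_fst.
  exact: (measurableT_comp mPsi measurable_snd).
pose P := (lebp \x lebp)%E.
have key (A B : set (plane R)) : measurable A -> measurable B ->
    (\int[lebp \x lebp]_(p in [set p | A p.1 /\ B p.2]) f p =
     \sum_i (\int[leb]_(y in A) (g i y)%:E) * (\int[leb]_(z in B) (rho i z)%:E))%E.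
  move=> mA mB; rewrite integral_mkcond.
  transitivity (\int[lebp \x lebp]_p \sum_i ((g i \_ A) p.1 * (rho i \_ B) p.2)%:E)%E.
    apply: eq_integral => p _; rewrite /f sumEFin !patchE.
    case: ifPn => [/[!inE] -[pA pB]|pn].
      by congr (_%:E); apply: eq_bigr => i _; rewrite !patchE !mem_set.
    rewrite big1// => i _; rewrite !patchE; case: ifPn => pA; last by rewrite mul0r.
    case: ifPn => pB; last by rewrite mulr0.
    by rewrite !inE in pA pB; move: pn; rewrite notin_setE /=; case.
  rewrite ge0_integral_sum//; last 2 first.
  - move=> i; apply/measurable_EFinP; apply: measurable_funM.
      exact: (measurableT_comp (measurable_restrict0 mA (mg i)) measurable_fst).
    exact: (measurableT_comp (measurable_restrict0 mB (mrho i)) measurable_snd).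
  - by move=> i p _; rewrite lee_fin mulr_ge0// restrict0_ge0.
  apply: eq_bigr => i _; rewrite integral_product ?integral_restrict0//.
  - exact: measurable_restrict0.
  - exact: measurable_restrict0.
  - by move=> y; exact: restrict0_ge0.
  - by move=> y; exact: restrict0_ge0.
exists (@wpush _ _ _ _ _ (lebp \x lebp)%E f phi mf f0 mphi); split.
- move=> A mA; rewrite /= /wpush -(key _ setT)//; last exact: torus_set_plane.
- move=> A mA; rewrite /= /wpush -(key setT)//.
  have := mPsi measurableT (torus_set_plane mA); rewrite setTI; exact.
- move=> K K0 gK; apply: wpush_ge0_integral_le => //; first exact: measurable_tdist2.
    by move=> z; exact: tdist_ge0.
  move=> p fp; have [i gr] : exists i, g i p.1 * rho i p.2 != 0.
    apply: contrapT => h; move/eqP: fp; apply; congr (_%:E); apply: big1 => i _.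
    by apply/eqP; apply: contrapT => /negP hi; apply: h; exists i.
  by move: gr; rewrite mulf_eq0 negb_or => /andP[gi ri]; exact: (gK i).
Qed.

End Coupling.
End TorusMeasurability.

(** * Stability of curves driven by the velocity *)

Section Stability.
Variables (R : realType) (l1 l2 : R * R).
Hypothesis hl : linindep l1 l2.
Variables (T : R) (v w : R -> R * R -> R * R) (L : R -> R).
Hypothesis T0 : 0 < T.
Hypothesis rv : regular_velocity l1 l2 T v w L.
Notation mu := (@lebesgue_measure R).
Notation intg f := (mu.-integrable [set: R] (EFin \o f)).

(** The reverse triangle inequality bounds the increment of the norm by the norm of the increment,
    so the estimate also holds where the difference vanishes. *)
Lemma norm_dini (x y : R -> R * R) k t p q : has_velocity x t p -> has_velocity y t q ->
  dini_le (fun s => enorm (x s - y s - k)) t (enorm (p - q)).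
Proof.
move=> [x1 x2] [y1 y2] e e0; pose u1 s := (x s).1 - (y s).1; pose u2 s := (x s).2 - (y s).2.
have d1 : is_derive t 1 u1 (p.1 - q.1) by exact: is_deriveB.
have d2 : is_derive t 1 u2 (p.2 - q.2) by exact: is_deriveB.
have e2 : 0 < e / 2 by rewrite divr_gt0.
have [a1 a10 h1] := is_derive_incr d1 e2; have [a2 a20 h2] := is_derive_incr d2 e2.
exists (Num.min a1 a2); first by rewrite lt_min a10.
move=> h /andP[h0]; rewrite lt_min => /andP[ha1 ha2].
have hn : `|h| = h by rewrite gtr0_norm.
have {}h1 := h1 h; have {}h2 := h2 h; rewrite hn in h1 h2; have {}h1 := h1 ha1; have {}h2 := h2 ha2.
pose D := (x (t + h) - y (t + h) - k) - (x t - y t - k).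
apply: (@le_trans _ _ (enorm D)).
  by have := enorm_sub_le (x (t + h) - y (t + h) - k) (x t - y t - k); rewrite ler_norml => /andP[].
apply: (@le_trans _ _ (enorm (scale2 h (p - q)) + enorm (D - scale2 h (p - q)))).
  by apply: le_trans (enormD _ _); rewrite addrC subrK.
rewrite mulrDl enorm_scale hn mulrC lerD2l; apply: le_trans (enorm_le_sum _) _.
have -> : e * h = e / 2 * h + e / 2 * h by rewrite -mulrDl -splitr.
apply: lerD.
  rewrite (_ : (D - scale2 h (p - q)).1 = u1 (t + h) - u1 t - (p.1 - q.1) * h)//.
  by rewrite /D /u1 /=; ring.
rewrite (_ : (D - scale2 h (p - q)).2 = u2 (t + h) - u2 t - (p.2 - q.2) * h)//.
by rewrite /D /u2 /=; ring.
Qed.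

Lemma ac_norm_diff (x y : R -> R * R) k : abs_continuous T x -> abs_continuous T y ->
  ac T (fun s => enorm (x s - y s - k)).
Proof.
move=> ax ay; have [x1 x2] := abs_continuous_ac ax; have [y1 y2] := abs_continuous_ac ay.
apply: (@ac_dom _ bool (fun b s => if b then (x s).1 - (y s).1 else (x s).2 - (y s).2) 1).
  by case; exact: ac_sub.
move=> s t _ _; rewrite mul1r big_bool /=; apply: le_trans (enorm_sub_le _ _) _.
apply: le_trans (enorm_le_sum _) _; rewrite /=.
have E (a b c d e : R) : a - b - c - (d - e - c) = a - b - (d - e) by ring.
by rewrite !E.
Qed.

(** Here [b] measures by how much the two curves fail to follow the same field. The lattice vector
    [k] can stay fixed in time because the lifts are continuous. *)
Lemma curve_stability (x y : R -> R * R) (b : R -> R) k :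
  abs_continuous T x -> abs_continuous T y -> intg b -> (forall t, 0 <= b t) ->
  {ae mu, forall t : R, 0 < t < T -> exists p q, [/\ has_velocity x t p, has_velocity y t q &
     enorm (p - q) <= L t * enorm (x t - y t - k) + b t]} ->
  forall t, 0 <= t <= T ->
  enorm (x t - y t - k) <= (enorm (x 0 - y 0 - k) + prim b T) * expR (prim L T).
Proof.
move=> ax ay jb b0 hv t tT.
have L0 := rv_ge0 rv; have jL := rv_int rv.
have eq s : 0 <= s <= T -> expR (- prim L s) * b s <= b s.
  move=> _; apply: ler_piMl => //.
  by rewrite -[leRHS]expR0 ler_expR oppr_le0; exact: prim_ge0.
have dg : {ae mu, forall s : R, 0 < s < T ->
    dini_le (fun s => enorm (x s - y s - k)) s (L s * enorm (x s - y s - k) + b s)}.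
  apply: ae_sub hv => s hs sT; have [p [q [hx hy pq]]] := hs sT.
  move=> e e0; have [d d0 hd] := norm_dini k hx hy e0; exists d => // h hh.
  apply: le_trans (hd h hh) _; rewrite ler_pM2r ?lerD2r//; by case/andP: hh.
have h := gronwall (ac_norm_diff k ax ay) jL jb eq dg tT.
have -> : enorm (x t - y t - k) = enorm (x t - y t - k) * expR (- prim L t) * expR (prim L t).
  by rewrite -mulrA -expRD addNr expR0 mulr1.
have tT2 : t <= T by case/andP: tT.
apply: ler_pM; rewrite ?expR_ge0 ?mulr_ge0 ?enorm_ge0//.
  by apply: le_trans h _; rewrite lerD2l; exact: prim_mono.
by rewrite ler_expR; exact: prim_mono.
Qed.

Lemma w_lip_enorm t x y k : lattice l1 l2 k -> enorm (w t x - w t y) <= L t * enorm (x - y - k).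
Proof.
move=> lk; apply: le_trans (rv_lip rv _ _ _) _; apply: ler_wpM2l; first exact: (rv_ge0 rv).
exact: tdist_le.
Qed.

(** Two flow lines have no defect. The resulting Lipschitz bound is also what makes [Phi t]
    measurable, as the push-forward requires. *)
Lemma flow_lip (Phi : R -> R * R -> R * R) : is_flow T v Phi ->
  forall t z z', 0 <= t <= T -> enorm (Phi t z - Phi t z') <= expR (prim L T) * enorm (z - z').
Proof.
move=> fl t z z' tT; have [z0 az vz] := fl z; have [z0' az' vz'] := fl z'.
have h := @curve_stability (fun t => Phi t z) (fun t => Phi t z') (fun=> 0) 0 az az' (intg0 R)
  (fun=> lexx 0) _ t tT.
have {h} := h _; rewrite !subr0 z0 z0' prim_cst0 addr0 mulrC; apply.
apply: ae_sub (ae_and (ae_and vz vz') (rv_ae rv)) => s [[h1 h2] h3] sT.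
exists (v s (Phi s z)), (v s (Phi s z')); split; [exact: h1|exact: h2|].
by rewrite addr0 -!h3//; apply: w_lip_enorm; exact: lattice0.
Qed.

Lemma measurable_flow (Phi : R -> R * R -> R * R) t : is_flow T v Phi -> 0 <= t <= T ->
  measurable_fun [set: plane R] (Phi t : plane R -> plane R).
Proof.
move=> fl tT; have -> : Phi t = fun z => ((Phi t z).1, (Phi t z).2).
  by apply/funext => z; apply: pair_ext2.
apply: measurable_plane_pair; apply: (@measurable_lip _ (expR (prim L T))) => z z'.
  exact: le_trans (enorm_fst (Phi t z - Phi t z')) (flow_lip fl z z' tT).
exact: le_trans (enorm_snd (Phi t z - Phi t z')) (flow_lip fl z z' tT).
Qed.

End Stability.

(** * Transport of the cell masses *)

Section Transport.
Variables (R : realType) (l1 l2 : R * R).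
Hypothesis hl : linindep l1 l2.
Variable N : nat.
Hypothesis N0 : (0 < N)%N.
Variables (T : R) (v w : R -> R * R -> R * R) (L : R -> R).
Hypothesis T0 : 0 < T.
Hypothesis rv : regular_velocity l1 l2 T v w L.
Variables (alpha : ('I_N -> R * R) -> R) (abar : R).
Hypothesis alpha_lip : loc_lipschitz l1 l2 alpha.
Hypothesis alpha_bd : forall X, distinct l1 l2 X -> 0 <= alpha X <= abar.
Variables (X0 : 'I_N -> R * R) (X : R -> 'I_N -> R * R) (r rho : R).
Hypothesis r0 : 0 < r.
Hypothesis Xcont : forall i, continuous (fun t => (X t i).1) /\ continuous (fun t => (X t i).2).
Hypothesis XK : forall t, sep l1 l2 r (X t) /\ forall i, enorm (X t i) <= rho.
Hypothesis Xsol : is_solution l1 l2 T v alpha X0 X.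
Variable D : R.
Hypothesis D0 : 0 <= D.
Hypothesis ndD : forall t y, 0 <= t <= T -> nd l1 l2 (X t) y <= D.
Hypothesis cdD : forall t i, 0 <= t <= T -> enorm (cdisp l1 l2 (X t) i) <= D.
Variable rho0 : R * R -> R.
Hypothesis hrho : L1_nonneg l1 l2 rho0.
Notation mu := (@lebesgue_measure R).
Notation intg f := (mu.-integrable [set: R] (EFin \o f)).
Notation leb := (leb2 R).
Notation distinct := (distinct l1 l2).
Notation cdisp := (cdisp l1 l2).
Notation tdist := (tdist l1 l2).
Notation fund_dom := (fund_dom l1 l2 : set (plane R)).
Notation cell X i := (cell l1 l2 X i : set (plane R)).
Notation torus := (torus l1 l2).
Notation M := (cell_mass l1 l2 rho0 X0).
Notation alpha_int := (prim (clip_time T (fun t => alpha (X t))) T).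

Let X00 : X 0 = X0. Proof. by case: Xsol. Qed.
Let dX t : distinct (X t). Proof. exact: sep_distinct r0 (XK t).1. Qed.
Arguments dX : clear implicits.
Let dX0 : distinct X0. Proof. by rewrite -X00; exact: dX. Qed.
Let mfund : measurable fund_dom. Proof. exact: measurable_fund_dom. Qed.

(** A generator follows the velocity up to the relaxation drift, of size at most [D * alpha]. The
    lattice vector realizing the distance at time 0 is kept for all later times. *)
Lemma generator_flow_dist (Phi : R -> R * R -> R * R) t i z : is_flow T v Phi -> 0 <= t <= T ->
  tdist (X t i) (Phi t z) <= (tdist (X0 i) z + D * alpha_int) * expR (prim L T).
Proof.
move=> fl tT; have [k lk kE] := tdist_ex hl (X0 i) z.
apply: le_trans (tdist_le _ _ lk) _.
have [_ aX vX] := Xsol; have [z0 az vz] := fl z.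
have ca := alpha_continuous alpha_lip alpha_bd r0 Xcont XK.
have jA := intg_clip_time T ca.
pose b s := D * clip_time T (fun t => alpha (X t)) s.
have jb : intg b by exact: intgZ.
have b0 s : 0 <= b s.
  by rewrite mulr_ge0// /clip_time; case: ifP => // _; case/andP: (alpha_bd (dX s)).
have h := @curve_stability _ _ _ _ _ _ _ rv (fun t => X t i) (fun t => Phi t z) b k (aX i) az jb b0 _ t tT.
have {h} := h _; rewrite X00 z0 -kE (_ : prim b T = D * alpha_int); last exact: primZ.
apply; apply: ae_sub (ae_and (ae_and vX vz) (rv_ae rv)) => s [[h1 h2] h3] sT.
have [_ {}h1] := h1 sT; exists (v s (X s i) + scale2 (alpha (X s)) (cdisp (X s) i)), (v s (Phi s z)).
split; [exact: h1|exact: h2|].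
have sT' : 0 <= s <= T by move/andP: sT => [? ?]; rewrite !ltW.
rewrite addrAC; apply: le_trans (enormD _ _) _; apply: lerD.
  by rewrite -!h3//; exact: (w_lip_enorm rv).
have /andP[a0 _] := alpha_bd (dX s).
rewrite /b clip_timeE// enorm_scale ger0_norm// mulrC; apply: ler_wpM2r => //; exact: cdD.
Qed.

Let rho_ge0 z : 0 <= rho0 z. Proof. by case: hrho. Qed.

Let measurable_rho : measurable_fun fund_dom rho0.
Proof. by case: hrho => _ _ /measurable_int/measurable_EFinP. Qed.

Lemma measurable_rho_restrict (A : set (plane R)) : measurable A ->
  measurable_fun [set: plane R] ((rho0 : plane R -> R) \_ (A `&` fund_dom)).
Proof.
move=> mA; apply: (proj1 (measurable_restrictT _ _)); first exact: measurableI.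
by apply: (measurable_funS mfund) => // z [].
Qed.

Lemma integral_rho_lty (A : set (plane R)) : measurable A ->
  (\int[leb]_(z in A `&` fund_dom) (rho0 z)%:E < +oo)%E.
Proof.
move=> mA; have [_ _ jr] := hrho.
apply: le_lt_trans (_ : (\int[leb]_(z in fund_dom) (rho0 z)%:E < +oo)%E); last first.
  have := (integrableP _ _ _ jr).2; congr (_ < _)%E; apply: eq_integral => z _ /=.
  by rewrite ger0_norm.
apply: ge0_subset_integral => //; first exact: measurableI.
  exact/measurable_EFinP.
by move=> z _; rewrite lee_fin.
Qed.

Lemma cell_massE i : (\int[leb]_(z in cell X0 i `&` fund_dom) (rho0 z)%:E = (M i)%:E)%E.
Proof.
rewrite /cell_mass /Rintegral fineK// ge0_fin_numE; last first.
  by apply: integral_ge0 => z _; rewrite lee_fin.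
by apply: integral_rho_lty; exact: measurable_cell.
Qed.

Lemma cell_mass_ge0 i : 0 <= M i.
Proof. by apply: Rintegral_ge0 => z _. Qed.

Lemma integral_rho_cells (B : set (plane R)) : measurable B ->
  (\int[leb]_(z in B `&` fund_dom) (rho0 z)%:E =
   \sum_i \int[leb]_(z in B) (((rho0 : plane R -> R) \_ (cell X0 i `&` fund_dom)) z)%:E)%E.
Proof.
move=> mB; pose f (z : plane R) := (((rho0 : plane R -> R) \_ (B `&` fund_dom)) z)%:E.
have mf : measurable_fun [set: plane R] f by apply/measurable_EFinP; exact: measurable_rho_restrict.
have f0 z : (0 <= f z)%E by rewrite lee_fin patchE; case: ifP.
have := ge0_integral_cells hl N0 dX0 mf f0.
have -> : (\int[leb]_(z in fund_dom) f z = \int[leb]_(z in B `&` fund_dom) (rho0 z)%:E)%E.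
  rewrite integral_mkcond [RHS]integral_mkcond; apply: eq_integral => z _.
  by rewrite /f !patchE in_setI; case: (z \in fund_dom); case: (z \in B).
move=> ->; apply: eq_bigr => i _.
rewrite integral_mkcond [RHS]integral_mkcond; apply: eq_integral => z _.
rewrite /f !patchE !in_setI.
by case: (z \in fund_dom); case: (z \in B); case: (z \in cell X0 i).
Qed.

Lemma sum_cell_mass : \sum_i M i = L1_norm l1 l2 rho0.
Proof.
have [_ _ jr] := hrho.
have := integral_rho_cells measurableT; rewrite setTI.
rewrite (eq_bigr (fun i => (M i)%:E)) => [h|i _]; last first.
  by rewrite (integral_restrict0 rho0) cell_massE.
rewrite /L1_norm (@eq_Rintegral _ _ _ leb _ rho0) => [|z _]; last by rewrite ger0_norm.
by rewrite /Rintegral h sumEFin.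
Qed.

Lemma cell_area_gt0 t i : 0 < cell_area l1 l2 (X t) i.
Proof.
rewrite cell_areaE//; apply: lt_le_trans (parea_ge hl i r0 (XK t).1).
by rewrite divr_gt0// exprn_gt0.
Qed.

(** [g i] is the uniform probability on the current cell and [rh i] the initial density on the
    initial cell. A coupled pair costs [D] from [y] to the current generator, plus the distance from
    that generator to the flow line of [z], which started within [D] of it. *)
Lemma transport_bound (Phi : R -> R * R -> R * R) t : is_flow T v Phi -> 0 <= t <= T ->
  (W1 (density (histogram l1 l2 M (X t)))
      (pushforward (density rho0) (Phi t : torus -> torus)) <=
   ((D + (D + D * alpha_int) * expR (prim L T)) * L1_norm l1 l2 rho0)%:E)%E.
Proof.
move=> fl tT; pose area i := cell_area l1 l2 (X t) i.
have area0 i : 0 < area i by exact: cell_area_gt0.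
pose g i (y : plane R) : R := (area i)^-1 * \1_(cell (X t) i `&` fund_dom) y.
pose rh i : plane R -> R := (rho0 : plane R -> R) \_ (cell X0 i `&` fund_dom).
have mcell Y i : measurable (cell Y i) by exact: measurable_cell.
have mg i : measurable_fun [set: plane R] (g i).
  apply: measurable_funM; first exact: measurable_cst.
  by apply: measurable_indic; exact: measurableI.
have mrh i : measurable_fun [set: plane R] (rh i) by exact: measurable_rho_restrict.
have g0 i y : 0 <= g i y by rewrite mulr_ge0// invr_ge0 ltW.
have rh0 i z : 0 <= rh i z by rewrite /rh patchE; case: ifP.
have mPhi := measurable_flow rv fl tT.
have [pi [pi1 pi2 piK]] := coupling_exists hl mg mrh g0 rh0 mPhi.
have irh i : (\int[leb]_z (rh i z)%:E = (M i)%:E)%E by rewrite (integral_restrict0 rho0) cell_massE.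
have ig i : (\int[leb]_y (g i y)%:E = 1)%E.
  under eq_integral do rewrite EFinM.
  rewrite ge0_integralZl//; last 2 first.
  - by apply/measurable_EFinP; apply: measurable_indic; exact: measurableI.
  - by rewrite lee_fin invr_ge0 ltW.
  rewrite integral_indic ?setIT//; last exact: measurableI.
  rewrite -(@fineK _ (leb (cell (X t) i `&` fund_dom))); last first.
    by rewrite ge0_fin_numE// cell_fund_lty.
  by rewrite -EFinM mulVf ?gt_eqF.
have piT : pi setT = (L1_norm l1 l2 rho0)%:E.
  rewrite -setXTT pi2// (eq_bigr (fun i => (M i)%:E)) ?sumEFin ?sum_cell_mass// => i _.
  by rewrite ig mul1e preimage_setT irh.
apply: (@le_trans _ _ (\int[pi]_z (tdist z.1 z.2)%:E)%E).
  apply: ereal_inf_lbound; exists pi => // A mA; split.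
    rewrite pi1// /density /histogram.
    transitivity (\int[leb]_(x in (A : set (plane R)) `&` fund_dom)
        \sum_i (M i / area i * \1_(cell (X t) i) x)%:E)%E; last first.
      by apply: eq_integral => x _; rewrite sumEFin.
    have mA' := torus_set_plane mA.
    rewrite ge0_integral_sum//; last 3 first.
    - exact: measurableI.
    - move=> i; apply/measurable_EFinP; apply: measurable_funM; first exact: measurable_cst.
      by apply: measurable_funTS; exact: measurable_indic.
    - by move=> i x _; rewrite lee_fin mulr_ge0// divr_ge0 ?cell_mass_ge0// ltW.
    apply: eq_bigr => i _; rewrite irh -ge0_integralZr//; last 3 first.
    - exact/measurable_EFinP/measurable_funTS.
    - by move=> x _; rewrite lee_fin.
    - by rewrite lee_fin cell_mass_ge0.
    rewrite integral_mkcond [RHS]integral_mkcond; apply: eq_integral => x _.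
    rewrite !patchE in_setI; case: (x \in A) => //=; rewrite /g !indicE in_setI.
    case: (x \in fund_dom); rewrite ?andbT ?andbF -EFinM; last by rewrite mulr0 mul0r.
    by congr (_%:E); ring.
  rewrite pi2// /pushforward /density integral_rho_cells; last first.
    by have := mPhi measurableT _ (torus_set_plane mA); rewrite setTI.
  by apply: eq_bigr => i _; rewrite ig mul1e.
have A0 : 0 <= alpha_int.
  by apply: prim_ge0 => s; rewrite /clip_time; case: ifP => // _; case/andP: (alpha_bd (dX s)).
rewrite EFinM -piT; apply: piK.
  by rewrite addr_ge0// mulr_ge0 ?expR_ge0// addr_ge0// mulr_ge0.
move=> i y z giy rhz.
have yc : cell (X t) i y.
  move: giy; rewrite mulf_eq0 negb_or indicE => /andP[_].
  by case: (boolP (y \in _)) => [/[!inE] -[]//|_]; rewrite eqxx.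
have zc : cell X0 i z.
  by move: rhz; rewrite /rh patchE; case: ifPn => [/[!inE] -[]//|_]; rewrite eqxx.
apply: le_trans (tdist_triangle hl (X t i) _ _) _; apply: lerD.
  by rewrite -(cell_nd hl yc); exact: ndD.
apply: le_trans (generator_flow_dist i z fl tT) _; apply: ler_wpM2r; first exact: expR_ge0.
rewrite lerD2r (tdistC hl) -(cell_nd hl zc) -X00; apply: ndD.
by rewrite lexx ltW.
Qed.

(** The displacements are at most [D], the masses add up to the norm of [rho0], and the exponential
    is largest at time 0. *)
Lemma drift_work_bound : (\int[mu]_(s in `[0%R, T])
    (expR (Lambda l1 l2 v T - Lambda l1 l2 v s) * alpha (X s) *
     \sum_(i < N) M i * enorm (cdisp (X s) i))%:E
  <= (expR (prim L T) * (D * alpha_int) * L1_norm l1 l2 rho0)%:E)%E.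
Proof.
have TT : 0 <= T <= T by rewrite lexx ltW.
have jL := rv_int rv; have L0 := rv_ge0 rv.
have ca := alpha_continuous alpha_lip alpha_bd r0 Xcont XK.
pose K := expR (prim L T) * D * L1_norm l1 l2 rho0.
have M0 : 0 <= L1_norm l1 l2 rho0 by rewrite -sum_cell_mass sumr_ge0// => i _; exact: cell_mass_ge0.
pose f s := expR (prim L T - prim L s) * alpha (X s) * \sum_(i < N) M i * enorm (cdisp (X s) i).
have cf : continuous f.
  apply: continuous_mul.
    apply: continuous_mul => // s; apply: continuous_comp; last exact: continuous_expR.
    apply: cvgB; [exact: cvg_cst|exact: prim_continuous].
  apply: continuous_sum => i; apply: continuous_mul; first by move=> s; exact: cvg_cst.
  exact: (cdisp_norm_continuous hl N0 r0 Xcont XK).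
rewrite (_ : (\int[mu]_(s in `[0%R, T]) _)%E = (\int[mu]_(s in `[0%R, T]) (f s)%:E)%E); last first.
  apply: eq_integral => s; rewrite inE /= in_itv/= => sT.
  by rewrite !(rv_Lambda rv).
rewrite (integral_clip_time T cf) lee_fin.
have -> : expR (prim L T) * (D * alpha_int) * L1_norm l1 l2 rho0 =
    prim (fun s => K * clip_time T (fun t => alpha (X t)) s) T.
  by rewrite primZ; [rewrite /K; ring|exact: intg_clip_time].
apply: prim_le.
- exact: intg_clip_time.
- by apply: intgZ; exact: intg_clip_time.
move=> s; rewrite /clip_time; case: ifPn => [|_]; last by rewrite mulr0.
rewrite inE /= in_itv/= => sT; have /andP[a0 _] := alpha_bd (dX s).
have -> : K * alpha (X s) = expR (prim L T) * alpha (X s) * (D * L1_norm l1 l2 rho0) by rewrite /K; ring.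
apply: ler_pM.
- by rewrite mulr_ge0// expR_ge0.
- by apply: sumr_ge0 => i _; rewrite mulr_ge0 ?enorm_ge0// cell_mass_ge0.
- apply: ler_wpM2r => //; rewrite ler_expR lerBlDr lerDl; exact: prim_ge0.
rewrite -sum_cell_mass mulr_sumr; apply: ler_sum => i _; rewrite mulrC.
by apply: ler_wpM2r; [exact: cell_mass_ge0|exact: cdD].
Qed.

End Transport.

Lemma powR_quarter (R : realType) (h : R) (n : nat) : 0 < h ->
  h `^ (n%:R / 4) = (h `^ (1 / 4)) ^+ n.
Proof.
move=> h0; rewrite -powR_mulrn ?powR_ge0// -powRrM; congr (_ `^ _).
by rewrite mulrC mul1r.
Qed.

Theorem theorem4p1 (R : realType) (l1 l2 : R * R) (T C1 Lam : R)
    (hl : linindep l1 l2) (hT : 0 < T) :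
  exists C2 : R,
  forall (v : R -> R * R -> R * R),
  bochner_L1_C01 l1 l2 T v ->
  Lambda l1 l2 v T = Lam ->
  forall N : nat, (2 <= N)%N ->
  let h := mesh l1 l2 N in
  forall X0 : 'I_N -> R * R,
  distinct l1 l2 X0 ->
  quant_energy l1 l2 X0 <= C1 * h ^+ 2 ->
  forall alpha : ('I_N -> R * R) -> R,
  config_periodic l1 l2 alpha ->
  loc_lipschitz l1 l2 alpha ->
  (forall X, distinct l1 l2 X ->
     0 <= alpha X <= centroid_defect l1 l2 X / h `^ (5 / 2)) ->
  exists X : R -> 'I_N -> R * R,
  [/\ is_solution l1 l2 T v alpha X0 X,
      (forall Y, is_solution l1 l2 T v alpha X0 Y ->
         forall t, 0 <= t <= T -> Y t = X t),
      (forall t, 0 <= t <= T -> distinct l1 l2 (X t)) &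
      (exists K : R, forall t, 0 <= t <= T -> 0 <= alpha (X t) <= K)] /\
  [/\ (ereal_sup [set (quant_energy l1 l2 (X t))%:E | t in `[0%R, T]]
       + \int[@lebesgue_measure R]_(t in `[0%R, T])
           (alpha (X t) * centroid_defect l1 l2 (X t))%:E
       <= (C2 * h ^+ 2)%:E)%E,
      (ereal_sup [set (max_diam l1 l2 (X t))%:E | t in `[0%R, T]]
       <= (C2 * h `^ (1 / 2))%:E)%E,
      (\int[@lebesgue_measure R]_(t in `[0%R, T]) (alpha (X t))%:E
       <= (C2 * h `^ (- (1 / 4)))%:E)%E,
      ((forall Y, distinct l1 l2 Y ->
          alpha Y = centroid_defect l1 l2 Y / h `^ (5 / 2)) ->
       (\int[@lebesgue_measure R]_(t in `[0%R, T])
          ((centroid_defect l1 l2 (X t) / h ^+ 2) ^+ 2)%:E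
        <= (C2 * h `^ (1 / 2))%:E)%E) &
      forall (Phi : R -> R * R -> R * R) (rho0 : R * R -> R),
      is_flow T v Phi -> L1_nonneg l1 l2 rho0 -> h <= 1 ->
      let M := cell_mass l1 l2 rho0 X0 in
      (\int[@lebesgue_measure R]_(s in `[0%R, T])
         (expR (Lambda l1 l2 v T - Lambda l1 l2 v s) * alpha (X s) *
          \sum_(i < N) M i * enorm (cdisp l1 l2 (X s) i))%:E
       + ereal_sup
           [set W1 (density (histogram l1 l2 M (X t)))
                   (pushforward (density rho0)
                      (Phi t : torus l1 l2 -> torus l1 l2)) | t in `[0%R, T]]
       <= (C2 * L1_norm l1 l2 rho0 * h `^ (1 / 4))%:E)%E].
Proof.
have [kap kap0 kapP] := energy_lower hl.
(* These constants involve only [C1], [T], the lattice and [Lam]. In units of powers of [s], [c]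
   bounds the energy, [D1] the cell radius and [Ca] the integral of [alpha]. *)
pose c : R := Num.max C1 0 * expR (4 * Lam).
have c0 : 0 <= c by rewrite mulr_ge0 ?expR_ge0// le_max lexx orbT.
pose D1 := c / kap + 1; have D10 : 0 <= D1 by rewrite addr_ge0// divr_ge0// ltW.
pose Ca := T / 2 + c / 4.
have Ca0 : 0 <= Ca by rewrite addr_ge0// divr_ge0// ltW.
pose E := expR Lam; have E0 : 0 <= E by exact: expR_ge0.
(* The first summand belongs to the work of the drift, the second to the coupling; both carry one
   factor [s]. *)
pose K5 := E * (D1 * Ca) + (D1 + (D1 + D1 * Ca) * E).
pose C2 := Num.max (2 * c) (Num.max (2 * D1) (Num.max Ca (Num.max (c / 2) K5))).
have b1 : 2 * c <= C2 by rewrite le_max lexx.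
have b2 : 2 * D1 <= C2 by rewrite !le_max lexx orbT.
have b3 : Ca <= C2 by rewrite !le_max lexx !orbT.
have b4 : c / 2 <= C2 by rewrite !le_max lexx !orbT.
have b5 : K5 <= C2 by rewrite !le_max lexx !orbT.
exists C2 => v bv vLam N N2 h X0 dX0 FX0 alpha _ alip abd.
have N0 : (0 < N)%N by exact: leq_trans N2.
have [w [L rv]] := bochner_regular hl bv.
have TT : 0 <= T <= T by rewrite lexx ltW.
have LT : prim L T = Lam by rewrite -(rv_Lambda rv TT).
have h0 : 0 < h by rewrite sqrtr_gt0 divr_gt0 ?ltr0n// torus_area_gt0.
pose s := h `^ (1 / 4); have s0 : 0 < s by exact: powR_gt0.
have s_ge0 := ltW s0.
have hs n : h `^ (n%:R / 4) = s ^+ n by exact: powR_quarter.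
have hE : h = s ^+ 4 by rewrite -hs divff// powRr1// ltW.
have h52 : h `^ (5 / 2) = s ^+ 10 by rewrite -hs; congr (_ `^ _); field.
have h12 : h `^ (1 / 2) = s ^+ 2 by rewrite -hs; congr (_ `^ _); field.
have hN14 : h `^ (- (1 / 4)) = s^-1 by rewrite powRN.
have {}abd X : distinct l1 l2 X -> 0 <= alpha X /\ alpha X <= centroid_defect l1 l2 X / s ^+ 10.
  by move=> /abd; rewrite h52 => /andP.
(* This bound depends on [h]. It makes the problem well posed and [alpha] continuous along the
   solution, but appears in none of the estimates for [C2]. *)
pose abar := lR l1 l2 ^+ 2 * torus_area l1 l2 / s ^+ 10.
have abar_bd X : distinct l1 l2 X -> 0 <= alpha X <= abar.
  move=> dX; have [a0 a1] := abd X dX; rewrite a0 /=; apply: le_trans a1 _.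
  apply: ler_wpM2r; first by rewrite invr_ge0 exprn_ge0.
  exact: centroid_defect_le.
have abar0 : 0 <= abar by have /andP[a0 a1] := abar_bd X0 dX0; exact: le_trans a1.
have ad X : distinct l1 l2 X -> alpha X <= centroid_defect l1 l2 X / s ^+ 10 by move=> /abd[].
have [X [r [rho [r0 X00 Xc XK Xsol]]]] := flow_exists hl N0 hT rv alip abar0 abar_bd dX0.
have dX t : distinct l1 l2 (X t) by exact: sep_distinct r0 (XK t).1.
have kapN (Y : 'I_N -> R * R) y : distinct l1 l2 Y -> kap * nd l1 l2 Y y ^+ 4 <= quant_energy l1 l2 Y.
  by move=> dY; exact: kapP.
have cE : Num.max C1 0 * expR (4 * prim L T) = c by rewrite LT.
exists X; split.
  split=> //.
  - move=> Y Ysol t tT.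
    exact: (solution_unique hl N0 hT rv alip abar0 abar_bd dX0 Xsol Ysol tT).
  - by exists abar => t _; exact: abar_bd.
have sup1 := energy_sup_bound hl N0 hT rv alip abar_bd r0 Xc XK Xsol s0 hE FX0.
have sup2 := diam_sup_bound hl N0 rv alip abar_bd r0 Xc XK Xsol s0 hE FX0 kap0 kapN.
have sup3 := alpha_ge0_bound hl N0 hT rv alip abar_bd r0 Xc XK Xsol s0 hE FX0 ad.
have sup4 := defect_sq_bound hl N0 hT rv alip abar_bd r0 Xc XK Xsol s0 hE FX0.
rewrite cE in sup1 sup2 sup3 sup4; split.
- apply: le_trans sup1 _; rewrite lee_fin; apply: ler_wpM2r => //; exact: sqr_ge0.
- by apply: le_trans sup2 _; rewrite h12 lee_fin; apply: ler_wpM2r => //; exact: sqr_ge0.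
- by apply: le_trans sup3 _; rewrite hN14 lee_fin; apply: ler_wpM2r => //; rewrite invr_ge0.
- move=> aE; have aE' Y : distinct l1 l2 Y -> alpha Y = centroid_defect l1 l2 Y / s ^+ 10.
    by move=> dY; rewrite -h52; exact: aE.
  by apply: le_trans (sup4 aE') _; rewrite h12 lee_fin; apply: ler_wpM2r => //; exact: sqr_ge0.
move=> Phi rho0 fl hrho h1; cbv zeta; set M := cell_mass l1 l2 rho0 X0; pose D := D1 * s ^+ 2.
have D0 : 0 <= D by rewrite mulr_ge0// sqr_ge0.
have ndD t y : 0 <= t <= T -> nd l1 l2 (X t) y <= D.
  move=> tT; have := nd_bound hl N0 rv alip abar_bd r0 Xc XK Xsol s0 hE FX0 kap0 kapN y tT.
  by rewrite cE.
have cdD t i : 0 <= t <= T -> enorm (cdisp l1 l2 (X t) i) <= D.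
  move=> tT; have := cdisp_bound hl N0 rv alip abar_bd r0 Xc XK Xsol s0 hE FX0 kap0 kapN i tT.
  by rewrite cE.
pose Aa := prim (clip_time T (fun t => alpha (X t))) T.
have Aa_le : Aa <= Ca * s^-1.
  by have := alpha_integral_bound hl N0 hT rv alip abar_bd r0 Xc XK Xsol s0 hE FX0 ad; rewrite cE.
have m0 : 0 <= L1_norm l1 l2 rho0 by apply: Rintegral_ge0 => x _.
have s1 : s <= 1.
  by rewrite -(@ler_pXn2r _ 4)// ?nnegrE// expr1n -hE.
(* Here the exponents combine: a radius of order [s^2] times an integral of order [1/s]. *)
have DA : D * Aa <= D1 * Ca * s.
  apply: le_trans (ler_wpM2l D0 Aa_le) _; rewrite /D le_eqVlt; apply/orP; left; apply/eqP.
  by field; rewrite gt_eqF.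
(* The assumption [h <= 1] enters here: the radius alone, of order [s^2], is absorbed into order
   [s]. *)
have Ds : D <= D1 * s by apply: ler_wpM2l => //; rewrite expr2; exact: ler_piMr.
have := drift_work_bound hl N0 hT rv alip abar_bd r0 Xc XK Xsol cdD hrho; rewrite LT -/E -/Aa => hB.
have hW t : 0 <= t <= T -> (W1 (density (histogram l1 l2 M (X t)))
    (pushforward (density rho0) (Phi t : torus l1 l2 -> torus l1 l2)) <=
    ((D + (D + D * Aa) * E) * L1_norm l1 l2 rho0)%:E)%E.
  move=> tT; have := transport_bound hl N0 hT rv alip abar_bd r0 Xc XK Xsol D0 ndD cdD hrho fl tT.
  by rewrite LT.
apply: le_trans (leeD hB (_ : (_ <= ((D + (D + D * Aa) * E) * L1_norm l1 l2 rho0)%:E)%E)) _.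
  by apply: ge_ereal_sup => _ [t /= tT <-]; apply: hW; rewrite in_itv in tT.
rewrite -EFinD lee_fin -mulrDl -/s [leRHS]mulrAC; apply: ler_wpM2r => //.
apply: (@le_trans _ _ (K5 * s)); last by apply: ler_wpM2r.
have -> : K5 * s = E * (D1 * Ca * s) + (D1 * s + (D1 * s + D1 * Ca * s) * E) by rewrite /K5; ring.
apply: lerD; first exact: ler_wpM2l.
by apply: lerD => //; apply: ler_wpM2r => //; exact: lerD.
Qed.
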